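(* Let $X>0$, $n\ge1$, let $A_0,A_1,A_2$ be $X$-periodic $\mathbb{C}^{n\times n}$-valued functions in $L^2_{\rm per}([0,X])$, with $A_2$ symmetric positive definite and $A_2(x)\ge CI$ for all $x$, for some $C>0$. Let $LU=\partial_x^2(A_2U)+\partial_x(A_1U)+A_0U$ on $L^2_{\rm per}([0,X];\mathbb{C}^n)$, and for $J\in\mathbb{N}$ let $L_J=P_JLP_J|_{\mathcal{H}_J}$ be the Hill's method truncation, where $P_J$ is the orthogonal projection onto $\mathcal{H}_J=\operatorname{span}\{e^{2\pi ikx/X}v:|k|\le J, v\in\mathbb{C}^n\}$. Then Hill's method converges in location and multiplicity: for any $R>0$ such that $L$ has no eigenvalue on $\{|\lambda|=R\}$ and every sufficiently small $\varepsilon>0$, there is $J_0$ such that for all $J\ge J_0$ every eigenvalue of $L_J$ in $\{|\lambda|<R\}$ lies within $\varepsilon$ of an eigenvalue of $L$, and for each eigenvalue $\lambda_*$ of $L$ with $|\lambda_*|<R$ the number of eigenvalues of $L_J$ (counted with algebraic multiplicity) in $\{|\lambda-\lambda_*|<\varepsilon\}$ equals the algebraic multiplicity of $\lambda_*$.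
   Context: In Fourier coordinates $L_J=\mathcal{D}_J^2\mathcal{A}_{2,J}+\mathcal{D}_J\mathcal{A}_{1,J}+\mathcal{A}_{0,J}$, where $\mathcal{D}_J$ is diagonal with entries $2\pi ik/X$ ($|k|\le J$) and $\mathcal{A}_{m,J}=(\hat A_m(j-k))_{|j|,|k|\le J}$ is the truncated block Toeplitz matrix of Fourier coefficients of $A_m$. Eigenvalues of $L$ are taken in $L^2_{\rm per}([0,X];\mathbb{C}^n)$. *)

(* Defs.v *)
From HB Require Import structures.
From mathcomp Require Import all_boot all_order all_algebra.
From mathcomp Require Import all_classical all_reals all_analysis.
From mathcomp Require Import complex.

Set Implicit Arguments.
Unset Strict Implicit.
Unset Printing Implicit Defensive.

Import Order.TTheory GRing.Theory Num.Theory.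
Import numFieldNormedType.Exports.

Local Open Scope classical_set_scope.
Local Open Scope ring_scope.

Section Hill.
Variable R : realType.
Local Notation C := (R[i]).
Local Notation mu := (@lebesgue_measure R).

Definition cabs (z : C) : R := Normc.normc z.

Definition expi (t : R) : C := Complex (cos t) (sin t).

Definition cint (X : R) (f : R -> C) : C :=
  Complex (\int[mu]_(x in `[0, X]) complex.Re (f x)) (\int[mu]_(x in `[0, X]) complex.Im (f x)).

Definition fcoef (X : R) (f : R -> C) (k : int) : C :=
  (X^-1 +i* 0)%C * cint X (fun x => f x * expi (- (2 * pi * k%:~R * x / X))).

Definition fcoef_mx (X : R) (m p : nat) (A : R -> 'M[C]_(m, p)) (k : int)
  : 'M[C]_(m, p) := \matrix_(i, j) fcoef X (fun x => A x i j) k.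

Definition L2per (X : R) (f : R -> C) : Prop :=
  [/\ (forall x, f (x + X) = f x),
      measurable_fun setT (fun x => complex.Re (f x)),
      measurable_fun setT (fun x => complex.Im (f x)) &
      mu.-integrable `[0, X] (fun x => ((cabs (f x)) ^+ 2)%:E)].

Definition L2per_mx (X : R) (m p : nat) (A : R -> 'M[C]_(m, p)) : Prop :=
  forall i j, L2per X (fun x => A x i j).

Definition ae_zero (X : R) (n : nat) (U : R -> 'cV[C]_n) : Prop :=
  {ae mu, forall x, x \in `[0, X] -> U x = 0}.

(* the multiplier 2 pi i k / X of d/dx in Fourier coordinates *)
Definition dmult (X : R) (k : int) : C := Complex 0 (2 * pi * k%:~R / X).

(* (L - lam) U = V, with L U = d^2/dx^2 (A2 U) + d/dx (A1 U) + A0 U taken in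
   the sense of periodic distributions, i.e. tested against every Fourier
   mode e^{2 pi i j x / X}; U and V are required to lie in L^2_per. *)
Definition Lshift (X : R) (n : nat) (A0 A1 A2 : R -> 'M[C]_n) (lam : C)
  (U V : R -> 'cV[C]_n) : Prop :=
  [/\ L2per_mx X U, L2per_mx X V &
   forall j : int,
     (dmult X j) ^+ 2 *: fcoef_mx X (fun x => A2 x *m U x) j
     + dmult X j *: fcoef_mx X (fun x => A1 x *m U x) j
     + fcoef_mx X (fun x => A0 x *m U x) j
     - lam *: fcoef_mx X U j = fcoef_mx X V j].

Definition is_eigL (X : R) (n : nat) (A0 A1 A2 : R -> 'M[C]_n) (lam : C) : Prop :=
  exists U : R -> 'cV[C]_n,
    [/\ L2per_mx X U, ~ ae_zero X U & Lshift X A0 A1 A2 lam U (fun _ => 0)].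

Definition gen_eigL (X : R) (n : nat) (A0 A1 A2 : R -> 'M[C]_n) (lam : C)
  (U : R -> 'cV[C]_n) : Prop :=
  exists (m : nat) (ch : nat -> R -> 'cV[C]_n),
    [/\ ch 0%N = U,
        forall i, (i < m)%N -> Lshift X A0 A1 A2 lam (ch i) (ch i.+1) &
        ae_zero X (ch m)].

Definition lin_indep (X : R) (n m : nat) (us : 'I_m -> R -> 'cV[C]_n) : Prop :=
  forall c : 'I_m -> C,
    ae_zero X (fun x => \sum_(i < m) c i *: us i x) -> forall i, c i = 0.

Definition alg_multL (X : R) (n : nat) (A0 A1 A2 : R -> 'M[C]_n) (lam : C)
  (m : nat) : Prop :=
  (exists us : 'I_m -> R -> 'cV[C]_n,
      (forall i, gen_eigL X A0 A1 A2 lam (us i)) /\ lin_indep X us) /\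
  (forall us : 'I_m.+1 -> R -> 'cV[C]_n,
      (forall i, gen_eigL X A0 A1 A2 lam (us i)) -> ~ lin_indep X us).

(* decoding of a block index into (Fourier index, component index) *)
Definition blk (J n : nat) (a : 'I_((2 * J).+1 * n)) : 'I_(2 * J).+1 * 'I_n :=
  enum_val (cast_ord (esym (mxvec_cast (2 * J).+1 n)) a).

Definition freq (J : nat) (p : 'I_(2 * J).+1) : int := (p%:Z - J%:Z)%R.

Definition LJ (X : R) (n : nat) (A0 A1 A2 : R -> 'M[C]_n) (J : nat)
  : 'M[C]_((2 * J).+1 * n) :=
  \matrix_(a, b)
    (let j := freq (blk a).1 in let k := freq (blk b).1 in
     let i := (blk a).2 in let l := (blk b).2 in
     (dmult X j) ^+ 2 * fcoef_mx X A2 (j - k) i l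
     + dmult X j * fcoef_mx X A1 (j - k) i l
     + fcoef_mx X A0 (j - k) i l).

(* eigenvalues of a square complex matrix, listed with algebraic multiplicity *)
Definition eigseq (N : nat) (M : 'M[C]_N) : seq C :=
  projT1 (closed_field_poly_normal (char_poly M)).

End Hill.

(* Main.v *)
(* In Fourier coordinates L is an infinite matrix mat with square-summable rows,
   and L_J is, up to a permutation of the indices, an initial N x N section of it.
   The coercivity of A2 makes Galerkin approximations of A2 v = w converge in l2,
   and the growth of the multipliers d^2 forces compactness: vectors u_N with u_N and
   (sec N) u_N bounded lose no mass at infinity.  Hence, if mu0 is not an eigenvalue,
   (sec N - mu0) is bounded below uniformly in N; the sets of eigenvalues of the
   sections therefore accumulate only at eigenvalues of L.

   For the multiplicities put S_N = (sec N - mu0)^-1, mu0 not an eigenvalue.  A family of m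
   independent generalized eigenvectors is an exact invariant family of a matrix F_N that
   differs from S_N by a term of fixed rank tending to 0, so that the resolvent traces of F_N and
   S_N on a small circle around an eigenvalue get close.  Averages of these traces over roots of
   unity count the eigenvalues in the disc, which gives at least m of them.  Conversely,
   a Schur triangularization of S_N yields orthonormal invariant families for the eigenvalues in a
   shrinking disc, and their limits along a free ultrafilter are independent generalized
   eigenvectors of L.

   The passage between functions and sequences rests on uniqueness of Fourier coefficients,
   the Riesz--Fischer theorem and the convolution formula for products. *)
Require Import Defs.
From HB Require Import structures.
From mathcomp Require Import all_boot all_order all_algebra.
From mathcomp Require Import all_classical all_reals all_analysis.
From mathcomp Require Import complex.
From mathcomp Require Import fingroup perm cyclic separable cyclotomic.
From mathcomp Require Import measurable_realfun.
From mathcomp Require Import ring lra zify.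
Import Order.TTheory GRing.Theory Num.Theory.
Import numFieldNormedType.Exports.
Local Open Scope classical_set_scope.
Local Open Scope ring_scope.
Set Implicit Arguments.
Unset Strict Implicit.
Unset Printing Implicit Defensive.

(** * Characteristic polynomials and triangularization *)

Section LinearAlgebra.
Variable C : numClosedFieldType.
Local Open Scope sesquilinear_scope.

(** The coefficients are merely square-integrable, so multiplication by A2 may be unbounded on l2
    and the sections, even those of A2 alone, have no norm bound in N. Two kinds of uniform
    information remain: each single row is square-summable, so that weak limits pass through it, and
    norms are bounded from below. Since the derivatives stand outside A2, row p can be divided by
    d_p^2; this bounds coordinate p of A2 v and is the source of all compactness.

    Limits are taken along one free ultrafilter, where every bounded sequence converges and no
    subsequences are needed; bounds for all large N come back by contradiction, from a sequence of
    bad sizes.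

    Passing to S_N turns a neighbourhood of an eigenvalue into a disc around (lam - mu0)^-1. A trace
    on N x N matrices is controlled by the norm only up to a factor N; the perturbation has fixed
    rank r precisely so that the difference of two resolvent traces becomes the trace of an r x r
    matrix. Since the averages over roots of unity are finite sums, no contour integral is
    needed. *)

Lemma char_poly_similar (F : fieldType) n (P Q A : 'M[F]_n) :
  P *m Q = 1%:M -> char_poly (P *m A *m Q) = char_poly A.
Proof.
move=> PQ; rewrite /char_poly.
have -> : char_poly_mx (P *m A *m Q) =
    map_mx polyC P *m char_poly_mx A *m map_mx polyC Q.
  rewrite /char_poly_mx !map_mxM mulmxBr mulmxBl mul_mx_scalar -scalemxAl.
  by rewrite -[X in _ *: X]map_mxM PQ map_mx1 scalemx1 -!map_mxM.
by rewrite !det_mulmx mulrAC -det_mulmx -map_mxM PQ map_mx1 det1 mul1r.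
Qed.

Lemma char_poly_lblock (F : fieldType) m n (A : 'M[F]_m) (B : 'M[F]_(n, m)) D :
  char_poly (block_mx A 0 B D) = char_poly A * char_poly D.
Proof.
rewrite /char_poly /char_poly_mx map_block_mx scalar_mx_block opp_block_mx.
by rewrite add_block_mx map_mx0 oppr0 addr0 det_lblock.
Qed.

Lemma char_poly_ublock (F : fieldType) m n (A : 'M[F]_m) (B : 'M[F]_(m, n)) D :
  char_poly (block_mx A B 0 D) = char_poly A * char_poly D.
Proof.
rewrite /char_poly /char_poly_mx map_block_mx scalar_mx_block opp_block_mx.
by rewrite add_block_mx map_mx0 oppr0 addr0 det_ublock.
Qed.

(** A left eigenvector for the first root gives the first row of [P], and the lower right block is
    treated by induction; working with rows makes [T] lower triangular. Prescribing the order of the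
    diagonal is what later allows splitting off exactly the eigenvalues that lie in a disc. *)
Lemma schur_ordered n (A : 'M[C]_n) (s : seq C) :
  char_poly A = \prod_(z <- s) ('X - z%:P) ->
  exists P T : 'M[C]_n, [/\ P \is unitarymx, P *m A = T *m P, is_trig_mx T &
    forall i : 'I_n, T i i = nth 0 s i].
Proof.
elim: n A s => [|n IH] A s charA.
  exists 1%:M, A; split; first by apply/unitarymxP/matrixP => -[].
  - by rewrite mulmx1 mul1mx.
  - by apply/is_trig_mxP => -[].
  - by case.
have sz_s : size s = n.+1.
  have := congr1 (size \o val) charA; rewrite /= size_char_poly.
  by rewrite size_prod_XsubC => -[].
case: s sz_s charA => // z s [sz_s]; rewrite big_cons => charA.
have : root (char_poly A) z by rewrite charA rootM root_XsubC eqxx.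
rewrite -eigenvalue_root_char => /eigenvalueP[v vA v0].
(* Gram-Schmidt applied to [v] above zero rows returns a unitary matrix whose first row spans the
   line of [v]. *)
pose M : 'M[C]_(1 + n) := col_mx v 0.
pose P : 'M[C]_(1 + n) := schmidt M.
have Pu : P \is unitarymx by apply: schmidt_unitarymx.
have vP : (v <= usubmx P)%MS.
  have := row_schmidt_sub M (0 : 'I_(1 + n)).
  have -> : row (0 : 'I_(1 + n)) M = v.
    by apply/rowP => j; rewrite !mxE; case: splitP => // k _; rewrite ord1.
  move=> /submx_trans; apply; apply/sumsmx_subP => k; rewrite leqn0 => /eqP k0.
  have -> : k = lshift n (0 : 'I_1) by apply/val_inj.
  rewrite genmxE.
  have -> : row (lshift n (0 : 'I_1)) (schmidt M) = usubmx P.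
    by apply/rowP => j; rewrite !mxE.
  exact: submx_refl.
have uA : usubmx P *m A = z *: usubmx P.
  have [c vc] := submxP vP.
  have c0 : c 0 0 != 0.
    by apply: contra_neq v0 => c0; rewrite vc [c]mx11_scalar c0 mul_scalar_mx scale0r.
  move: vA; rewrite vc [c]mx11_scalar !mul_scalar_mx -scalemxAl scalerA mulrC -scalerA.
  exact: scalerI.
pose T0 := P *m A *m P^t*.
have PPt : P *m P^t* = 1%:M by exact/unitarymxP.
have T0P : P *m A = T0 *m P by rewrite /T0 mulmxKtV.
have T0E : T0 = block_mx z%:M 0 (dlsubmx T0) (drsubmx T0).
  rewrite -[LHS]submxK.
  have : usubmx T0 = row_mx z%:M 0.
    rewrite /T0 -mulmxA -mul_usub_mx mulmxA uA -scalemxAl.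
    have -> : usubmx P *m P^t* = row_mx 1%:M 0.
      rewrite mul_usub_mx PPt (_ : 1%:M = block_mx 1%:M 0 0 1%:M).
        by rewrite /block_mx col_mxKu.
      exact: scalar_mx_block.
    by rewrite scale_row_mx scaler0 scalemx1.
  rewrite -[usubmx T0]hsubmxK => /eq_row_mx[h1 h2].
  by rewrite /ulsubmx /ursubmx h1 h2.
have charT : char_poly T0 = char_poly A by exact: char_poly_similar.
have /IH[P' [T' [uP' PT' tT' dT']]] : char_poly (drsubmx T0) = \prod_(y <- s) ('X - y%:P).
  move: charT; rewrite T0E char_poly_lblock charA block_mxKdr.
  have -> : char_poly (z%:M : 'M[C]_1) = 'X - z%:P.
    by rewrite char_poly_trig ?scalar_mx_is_trig // big_ord1 mxE eqxx.
  by apply: mulfI; rewrite polyXsubC_eq0.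
have uQ : (block_mx 1%:M 0 0 P' : 'M[C]_(1 + n)) \is unitarymx.
  apply/unitarymxP; rewrite tr_block_mx map_block_mx mulmx_block.
  rewrite !trmx0 !map_mx0 !tr_scalar_mx !map_scalar_mx/=.
  rewrite ?rmorph1 !(mulmx1, mul1mx, mulmx0, mul0mx, addr0, add0r).
  by rewrite (unitarymxP _) -?scalar_mx_block.
have QT : (block_mx 1%:M 0 0 P' : 'M[C]_(1 + n)) *m T0 =
    block_mx z%:M 0 (P' *m dlsubmx T0) T' *m block_mx 1%:M 0 0 P'.
  rewrite {1}T0E !mulmx_block.
  by rewrite !(mulmx1, mul1mx, mulmx0, mul0mx, addr0, add0r) PT'.
exists (block_mx 1%:M 0 0 P' *m P), (block_mx z%:M 0 (P' *m dlsubmx T0) T').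
split.
- by rewrite mul_unitarymx.
- rewrite -mulmxA T0P [LHS]mulmxA [RHS]mulmxA.
  exact: (congr1 (mulmx^~ P) QT).
- by rewrite (@is_trig_block_mx _ 1 n 1 n) // eqxx /= tT' scalar_mx_is_trig.
- move=> i; have [j ->|j ->] := @split_ordP 1 n i.
    by rewrite (@block_mxEul _ 1 n 1 n) ord1 mxE eqxx.
  by rewrite (@block_mxEdr _ 1 n 1 n) dT'.
Qed.

(** Forward substitution: entry (i, j) of [T *m X] involves only [X l j] with l <= i, and the
    diagonal of [T] has no zero because its determinant is invertible. *)
Lemma trig_inv n (T X : 'M[C]_n) : is_trig_mx T -> T *m X = 1%:M ->
  is_trig_mx X /\ forall i, X i i = (T i i)^-1.
Proof.
move=> /is_trig_mxP Tt TX.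
have Xt (i j : 'I_n) : (i < j)%N -> X i j = 0.
  have [k] := ubnP (val i); elim: k i => // k IH i /ltnSE ik ij.
  have := congr1 (fun M : 'M[C]_n => M i j) TX; rewrite !mxE.
  rewrite (bigD1 i) //= big1 => [|l li]; last first.
    have [il|il|/val_inj il] := ltngtP i l.
    - by rewrite Tt ?mul0r.
    - by rewrite (IH l (leq_trans il ik) (ltn_trans il ij)) mulr0.
    - by rewrite il eqxx in li.
  rewrite addr0 -val_eqE ltn_eqF // => /eqP; rewrite mulf_eq0 => /orP[|/eqP//].
  have := congr1 (fun M : 'M[C]_n => \det M) TX; rewrite det_mulmx det1 det_trig //; last first.
    exact/is_trig_mxP.
  move=> + /eqP T0; rewrite (bigD1 i) //= T0 !mul0r => /esym/eqP.
  by rewrite oner_eq0.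
split; first exact/is_trig_mxP.
move=> i; have := congr1 (fun M : 'M[C]_n => M i i) TX; rewrite !mxE eqxx.
rewrite (bigD1 i) //= big1 => [|l li].
  rewrite addr0 => TX1; have T0 : T i i != 0.
    by apply: contra_eq_neq TX1 => ->; rewrite mul0r eq_sym oner_eq0.
  by apply: (mulfI T0); rewrite TX1 divff.
have [il|il|/val_inj il] := ltngtP i l.
- by rewrite Tt ?mul0r.
- by rewrite Xt ?mulr0.
- by rewrite il eqxx in li.
Qed.

Lemma char_poly_roots n (A : 'M[C]_n) :
  {s : seq C | char_poly A = \prod_(z <- s) ('X - z%:P)}.
Proof.
have [s] := closed_field_poly_normal (char_poly A).
by rewrite (monicP (char_poly_monic _)) scale1r => sE; exists s.
Qed.

Lemma size_char_roots n (A : 'M[C]_n) (s : seq C) :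
  char_poly A = \prod_(z <- s) ('X - z%:P) -> size s = n.
Proof.
move=> /(congr1 (size \o val)); rewrite /= size_char_poly size_prod_XsubC.
by case.
Qed.

Lemma big_nth_ord (V : nmodType) n (s : seq C) (f : C -> V) : size s = n ->
  \sum_(z <- s) f z = \sum_(i < n) f (nth 0 s i).
Proof. by move=> <-; rewrite (big_nth 0) big_mkord. Qed.

(** Read off on the diagonal of the triangular resolvent. The right-hand side is the logarithmic
    derivative of the characteristic polynomial, whose averages over a circle count roots. *)
Lemma trace_resolvent n (A : 'M[C]_n) (s : seq C) (w : C) :
  char_poly A = \prod_(z <- s) ('X - z%:P) -> w%:M - A \in unitmx ->
  \tr (invmx (w%:M - A)) = \sum_(z <- s) (w - z)^-1.
Proof.
move=> charA Au; have [P [T [Pu PT Tt Td]]] := schur_ordered charA.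
have PPt : P *m P^t* = 1%:M by exact/unitarymxP.
have PtP : P^t* *m P = 1%:M by exact: mulmx1C.
have AE : w%:M - A = P^t* *m (w%:M - T) *m P.
  rewrite mulmxBr mulmxBl -mulmxA mul_scalar_mx -scalemxAr PtP scalemx1.
  by rewrite -mulmxA -PT mulmxA PtP mul1mx.
pose X := P *m invmx (w%:M - A) *m P^t*.
have TX : (w%:M - T) *m X = 1%:M.
  have -> : w%:M - T = P *m (w%:M - A) *m P^t*.
    by rewrite AE !mulmxA PPt mul1mx -mulmxA PPt mulmx1.
  rewrite /X !mulmxA -[_ *m _ *m P^t* *m P]mulmxA PtP mulmx1.
  by rewrite -[_ *m _ *m invmx _]mulmxA mulmxV // mulmx1.
have Tt' : is_trig_mx (w%:M - T).
  apply/is_trig_mxP => i j ij; rewrite !mxE -val_eqE ltn_eqF //.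
  by rewrite (is_trig_mxP Tt) // subr0 mulr0n.
have [_ Xd] := trig_inv Tt' TX.
have -> : \tr (invmx (w%:M - A)) = \tr X.
  by rewrite /X mxtrace_mulC mulmxA PtP mul1mx.
rewrite (big_nth_ord _ (size_char_roots charA)); apply: eq_bigr => i _.
by rewrite Xd !mxE eqxx Td.
Qed.

Lemma char_poly_inv n (A : 'M[C]_n) (s : seq C) :
  char_poly A = \prod_(z <- s) ('X - z%:P) -> A \in unitmx ->
  char_poly (invmx A) = \prod_(z <- [seq z^-1 | z <- s]) ('X - z%:P).
Proof.
move=> charA Au; have [P [T [Pu PT Tt Td]]] := schur_ordered charA.
have PPt : P *m P^t* = 1%:M by exact/unitarymxP.
have PtP : P^t* *m P = 1%:M by exact: mulmx1C.
pose X := P *m invmx A *m P^t*.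
have TX : T *m X = 1%:M.
  by rewrite /X !mulmxA -PT -[P *m A *m _]mulmxA mulmxV // mulmx1.
have [Xt Xd] := trig_inv Tt TX.
rewrite -(char_poly_similar (invmx A) PPt) -/X char_poly_trig // big_map.
rewrite (big_nth 0) (size_char_roots charA) big_mkord.
by apply: eq_bigr => i _; rewrite Xd Td.
Qed.

Lemma char_poly_shift n (A : 'M[C]_n) (s : seq C) c :
  char_poly A = \prod_(z <- s) ('X - z%:P) ->
  char_poly (A - c%:M) = \prod_(z <- [seq z - c | z <- s]) ('X - z%:P).
Proof.
move=> charA; have [P [T [Pu PT Tt Td]]] := schur_ordered charA.
have PPt : P *m P^t* = 1%:M by exact/unitarymxP.
rewrite -(char_poly_similar (A - c%:M) PPt) mulmxBr mulmxBl PT.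
rewrite -[T *m P *m _]mulmxA PPt mulmx1 mul_mx_scalar -scalemxAl PPt scalemx1.
have Tt' : is_trig_mx (T - c%:M).
  apply/is_trig_mxP => i j ij; rewrite !mxE -val_eqE ltn_eqF //.
  by rewrite (is_trig_mxP Tt) // subr0.
rewrite char_poly_trig // big_map.
rewrite (big_nth 0) (size_char_roots charA) big_mkord.
by apply: eq_bigr => i _; rewrite !mxE eqxx Td.
Qed.

(* With the projection (c, v) |-> Y c + v, the block matrix
   T = (a, Z F; 0, (1 - Y Z) F) is conjugate to (0, Z F; 0, F). *)
Lemma char_poly_invariant n r (F : 'M[C]_n) (a : 'M[C]_r) (Y : 'M[C]_(n, r)) (Z : 'M[C]_(r, n)) :
  F *m Y = Y *m a -> Z *m Y = 1%:M -> a \in unitmx ->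
  char_poly a %| char_poly F.
Proof.
move=> FY ZY au.
pose T := block_mx a (Z *m F) 0 (F - Y *m Z *m F).
pose P := block_mx 1%:M 0 Y 1%:M : 'M[C]_(r + n).
pose Q := block_mx 1%:M 0 (- Y) 1%:M : 'M[C]_(r + n).
have PQ : P *m Q = 1%:M.
  rewrite mulmx_block !(mulmx1, mul1mx, mulmx0, mul0mx, addr0, add0r) subrr.
  by rewrite -scalar_mx_block.
have PTQ : P *m T *m Q = block_mx 0 (Z *m F) 0 F.
  rewrite !mulmx_block !(mulmx1, mul1mx, mulmx0, mul0mx, addr0, add0r).
  rewrite [Y *m (Z *m F)]mulmxA [_ + (F - _)]addrC subrK !mulmxN.
  by rewrite -mulmxA FY mulmxA ZY mul1mx !subrr.
have := char_poly_similar T PQ; rewrite PTQ !char_poly_ublock => charE.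
(* The zero block contributes the factor ['X^r], which is coprime to [char_poly a] because [a] is
   invertible, and can be cancelled. *)
have -> : char_poly a %| char_poly F = (char_poly a %| char_poly (0 : 'M[C]_r) * char_poly F).
  rewrite Gauss_dvdpr //.
  have -> : char_poly (0 : 'M[C]_r) = 'X^r.
    rewrite char_poly_trig ?mx0_is_trig // (eq_bigr (fun=> 'X)) => [|i _].
      by rewrite prodr_const card_ord.
    by rewrite mxE subr0.
  rewrite coprimep_expr // coprimepX /root.
  by rewrite horner_coef0 char_poly_det mulf_neq0 // ?signr_eq0 // -unitfE -unitmxE.
by rewrite charE dvdp_mulr.
Qed.

End LinearAlgebra.

(** * Complex absolute values and counting roots in discs *)

Section ComplexModulus.
Variable R : realType.
Local Notation C := (R[i]).
Implicit Types z w : C.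

Lemma cabs_ge0 z : 0 <= cabs z.
Proof. by case: z => a b; apply: sqrtr_ge0. Qed.

Lemma cabsE z : cabs z ^+ 2 = complex.Re z ^+ 2 + complex.Im z ^+ 2.
Proof. by case: z => a b; rewrite sqr_sqrtr // addr_ge0 // sqr_ge0. Qed.

Lemma cabs0 : cabs (0 : C) = 0.
Proof. exact: Normc.normc0. Qed.

Lemma cabs1 : cabs (1 : C) = 1.
Proof. exact: Normc.normc1. Qed.

Lemma cabs_eq0 z : (cabs z == 0) = (z == 0).
Proof. by apply/eqP/eqP => [/Normc.eq0_normc//|->]; rewrite cabs0. Qed.

Lemma cabs_gt0 z : (0 < cabs z) = (z != 0).
Proof. by rewrite lt_def cabs_eq0 cabs_ge0 andbT. Qed.

Lemma cabsM z w : cabs (z * w) = cabs z * cabs w.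
Proof. exact: Normc.normcM. Qed.

Lemma cabsN z : cabs (- z) = cabs z.
Proof. exact: normcN. Qed.

Lemma cabsV z : cabs z^-1 = (cabs z)^-1.
Proof. exact: Normc.normcV. Qed.

Lemma cabsD z w : cabs (z + w) <= cabs z + cabs w.
Proof. exact: le_normcD. Qed.

Lemma cabsB z w : cabs (z - w) <= cabs z + cabs w.
Proof. by rewrite -(cabsN w) cabsD. Qed.

Lemma cabs_distC z w : cabs (z - w) = cabs (w - z).
Proof. by rewrite -cabsN opprB. Qed.

Lemma cabs_triangle u z w : cabs (z - w) <= cabs (z - u) + cabs (u - w).
Proof. by apply: le_trans (cabsD _ _); rewrite addrA subrK. Qed.

Lemma cabs_lerB z w : cabs z - cabs w <= cabs (z - w).
Proof. by rewrite lerBlDr; apply: le_trans (cabsD _ _); rewrite subrK. Qed.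

Lemma cabsX z k : cabs (z ^+ k) = cabs z ^+ k.
Proof. by elim: k => [|k IH]; rewrite ?cabs1 // !exprS cabsM IH. Qed.

Lemma cabs_conj z : cabs (conjc z) = cabs z.
Proof. by case: z => a b; rewrite /cabs /= sqrrN. Qed.

Lemma cabs_real (x : R) : cabs (x%:C)%C = `|x|.
Proof. by rewrite /cabs /= expr0n /= addr0 sqrtr_sqr. Qed.

Lemma cabs_nat k : cabs (k%:R : C) = k%:R.
Proof. by rewrite -(rmorph_nat (real_complex R)) cabs_real ger0_norm. Qed.

Lemma cabs_sum (I : Type) (r : seq I) (P : pred I) (F : I -> C) :
  cabs (\sum_(i <- r | P i) F i) <= \sum_(i <- r | P i) cabs (F i).
Proof.
elim/big_ind2: _ => [|x1 x2 y1 y2 h1 h2|//]; first by rewrite cabs0.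
by apply: le_trans (cabsD _ _) _; apply: lerD.
Qed.

Lemma cabs_Re z : `|complex.Re z| <= cabs z.
Proof.
rewrite -(ler_pXn2r (n := 2)) ?nnegrE ?cabs_ge0 // cabsE real_normK ?num_real // lerDl.
exact: sqr_ge0.
Qed.

Lemma cabs_Im z : `|complex.Im z| <= cabs z.
Proof.
rewrite -(ler_pXn2r (n := 2)) ?nnegrE ?cabs_ge0 // cabsE real_normK ?num_real // lerDr.
exact: sqr_ge0.
Qed.

Lemma cabs_le_ReIm z : cabs z <= `|complex.Re z| + `|complex.Im z|.
Proof.
rewrite -(ler_pXn2r (n := 2)) ?nnegrE ?cabs_ge0 ?addr_ge0 // cabsE sqrrD.
by rewrite !real_normK ?num_real // addrAC lerDl mulrn_wge0 // mulr_ge0.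
Qed.

Lemma mulcJ z : z * conjc z = (cabs z ^+ 2)%:C%C.
Proof. by case: z => a b; rewrite cabsE; apply/eqP; rewrite eq_complex /=; apply/andP; split; apply/eqP; ring. Qed.

End ComplexModulus.

(** * Counting roots in a disc by averages over roots of unity *)

Section CountRoots.
Variable R : realType.
Local Notation C := (R[i]).

Lemma prim_root_ex K : (0 < K)%N -> exists z : C, K.-primitive_root z.
Proof.
move=> K0; have [r] := closed_field_poly_normal ('X^K - 1 : {poly C}).
rewrite (monicP (monicXnsubC 1 K0)) scale1r => rE.
have r1 : all K.-unity_root r.
  by apply/allP => z zr; rewrite /root_of_unity rE root_prod_XsubC.
have szr : (K <= size r)%N.
  by have := size_XnsubC (1 : C) K0; rewrite rE size_prod_XsubC => -[->].
have [|z] := hasP (has_prim_root K0 r1 _ szr); last by exists z.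
by rewrite -separable_prod_XsubC -rE separable_Xn_sub_1 // pnatr_eq0 -lt0n.
Qed.

(** Multiply by 1 - y^K = 1 - (y zeta^k)^K, expand the quotient as a geometric sum and add over k:
    only the power l = 0 survives. This is the K-point quadrature of a circle integral; for large K
    its value is close to K when |y| < 1 and to 0 when |y| > 1. *)
Lemma mean_roots_unity K (zeta y : C) : K.-primitive_root zeta -> y ^+ K != 1 ->
  \sum_(k < K) (1 - y * zeta ^+ k)^-1 = K%:R / (1 - y ^+ K).
Proof.
move=> prz yK; have y0 : 1 - y ^+ K != 0 by rewrite subr_eq0 eq_sym.
apply: (mulIf y0); rewrite divfK // mulr_suml.
have step (k : 'I_K) : (1 - y * zeta ^+ k)^-1 * (1 - y ^+ K) =
    \sum_(l < K) y ^+ l * (zeta ^+ l) ^+ k.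
  have -> : 1 - y ^+ K = (1 - y * zeta ^+ k) * \sum_(l < K) (y * zeta ^+ k) ^+ l.
    rewrite -[1 - y * _]opprB mulNr -subrX1 opprB exprMn -exprM mulnC exprM.
    by rewrite (prim_expr_order prz) expr1n mulr1.
  rewrite mulKf; first by apply: eq_bigr => l _; rewrite exprMn -!exprM mulnC.
  apply: contra_neq yK => /eqP; rewrite subr_eq0 => /eqP h.
  have : (y * zeta ^+ k) ^+ K = 1 by rewrite -h expr1n.
  by rewrite exprMn -exprM mulnC exprM (prim_expr_order prz) expr1n mulr1.
rewrite (eq_bigr _ (fun k _ => step k)) exchange_big /=.
have K0 := prim_order_gt0 prz; rewrite (bigD1 (Ordinal K0)) //= [X in _ + X]big1.
  rewrite addr0 (eq_bigr (fun=> 1)) => [|k _]; last by rewrite expr0 mul1r expr1n.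
  by rewrite sumr_const card_ord.
move=> l l0; rewrite -mulr_sumr.
suff -> : \sum_(k < K) (zeta ^+ l) ^+ k = 0 by rewrite mulr0.
have zl : zeta ^+ l - 1 != 0.
  rewrite subr_eq0 -(prim_order_dvd prz); apply: contra l0 => dl.
  by rewrite -val_eqE /=; move: dl; rewrite /dvdn modn_small.
apply: (mulfI zl); rewrite -subrX1 mulr0 -exprM mulnC exprM.
by rewrite (prim_expr_order prz) expr1n subrr.
Qed.

Lemma expr_small (t e : R) : 0 <= t < 1 -> 0 < e ->
  exists K0, forall K, (K0 <= K)%N -> t ^+ K < e.
Proof.
move=> /andP[t0 t1] e0; have /cvgrPdist_lt/(_ e e0)[K0 _ h] : (fun n => t ^+ n) @ \oo --> (0 : R).
  by apply: cvg_expr; rewrite ger0_norm.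
by exists K0 => K /h /=; rewrite sub0r normrN ger0_norm // exprn_ge0.
Qed.

Lemma disc_indicator (y : C) (e : R) : cabs y != 1 -> 0 < e ->
  exists K0, forall K, (K0 <= K)%N -> (0 < K)%N ->
    y ^+ K != 1 /\ cabs ((1 - y ^+ K)^-1 - (cabs y < 1)%R%:R) < e.
Proof.
move=> y1 e0; have pow1 K : (0 < K)%N -> y ^+ K != 1.
  move=> K0; apply: contra_neq y1 => /(congr1 (@cabs R)).
  rewrite cabsX cabs1 => /eqP; rewrite pexpr_eq1 ?cabs_ge0 //.
  by move/eqP.
(* For 0 <= t < e' one has 1 - t > 1/2, so t / (1 - t) <= 2 t < e. Here t is |y|^K inside the unit
   disc and |y|^-K outside. *)
pose e' := Num.min (e / 2) (1 / 2).
have e'0 : 0 < e' by rewrite lt_min; apply/andP; split; lra.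
have e'1 : e' <= 1 / 2 by rewrite ge_min lexx orbT.
have e'e : e' <= e / 2 by rewrite ge_min lexx.
have bound (t : R) : 0 <= t < e' -> t / (1 - t) < e.
  by move=> /andP[t0 te]; rewrite ltr_pdivrMr; nra.
have [ly|gy|ey] := ltgtP (cabs y) 1; last by rewrite ey eqxx in y1.
- have /expr_small -/(_ e' e'0)[K0 h] : 0 <= cabs y < 1 by rewrite cabs_ge0.
  exists K0 => K /h hK Kp; split; first exact: pow1.
  have n0 : 1 - y ^+ K != 0 by rewrite subr_eq0 eq_sym pow1.
  have -> : (1 - y ^+ K)^-1 - true%:R = y ^+ K / (1 - y ^+ K).
    by apply: (mulIf n0); rewrite mulrBl divfK // mulVf // mul1r opprB addrC subrK.
  rewrite cabsM cabsV cabsX.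
  apply: le_lt_trans (bound (cabs y ^+ K) _); last first.
    by rewrite hK exprn_ge0 ?cabs_ge0.
  rewrite ler_wpM2l ?exprn_ge0 ?cabs_ge0 // lef_pV2 ?posrE ?cabs_gt0 //; last lra.
  by have := cabs_lerB 1 (y ^+ K); rewrite cabs1 cabsX.
- have y0 : 0 < cabs y by lra.
  have /expr_small -/(_ e' e'0)[K0 h] : 0 <= (cabs y)^-1 < 1.
    by rewrite invr_ge0 cabs_ge0 invf_lt1.
  exists K0 => K /h hK Kp; split; first exact: pow1.
  rewrite subr0 cabsV.
  have tp : 0 < cabs y ^+ K by rewrite exprn_gt0.
  have t0 : 0 < (cabs y)^-1 ^+ K by rewrite exprn_gt0 // invr_gt0.
  apply: le_lt_trans (bound ((cabs y)^-1 ^+ K) _); last by rewrite hK ltW.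
  have tE : (cabs y)^-1 ^+ K * cabs y ^+ K = 1 by rewrite -exprMn mulVf ?expr1n // gt_eqF.
  have hc := cabs_lerB (y ^+ K) 1; rewrite cabs1 cabsX cabs_distC in hc.
  have Y1 : 1 < cabs y ^+ K by rewrite exprn_egt1 // -lt0n.
  have -> : (cabs y)^-1 ^+ K / (1 - (cabs y)^-1 ^+ K) = (cabs y ^+ K - 1)^-1.
    rewrite exprVn -[X in _ / (X - _)](mulVf (lt0r_neq0 tp)) -[X in _ / (_ - X)]mulr1 -mulrBr invfM invrK.
    by rewrite mulrA mulVf ?mul1r // lt0r_neq0.
  by rewrite lef_pV2 // posrE ?subr_gt0 // (lt_le_trans _ hc) // subr_gt0.
Qed.

Lemma count_indicator (s : seq C) (e : R) : 0 < e ->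
  (forall y, y \in s -> cabs y != 1) ->
  exists K0, forall K, (K0 <= K)%N -> (0 < K)%N ->
    (forall y, y \in s -> y ^+ K != 1) /\
    cabs (\sum_(y <- s) (1 - y ^+ K)^-1 - (count (fun y => (cabs y < 1)%R) s)%:R) < e.
Proof.
elim: s e => [|y s IH] e e0 ys.
  by exists 0%N => K _ _; split => //; rewrite big_nil subrr cabs0.
have e20 : 0 < e / 2 by lra.
have [|K1 h1] := IH _ e20; first by move=> x xs; apply: ys; rewrite inE xs orbT.
have [K2 h2] := disc_indicator (ys y (mem_head _ _)) e20.
exists (maxn K1 K2) => K; rewrite geq_max => /andP[k1 k2] K0.
have [h11 h12] := h1 K k1 K0; have [h21 h22] := h2 K k2 K0; split.
  by move=> x; rewrite inE => /orP[/eqP->//|/h11].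
rewrite big_cons /= natrD opprD addrACA.
apply: le_lt_trans (cabsD _ _) _; rewrite [e]splitr; exact: ltrD.
Qed.

(** Takes the place of the argument principle. K is chosen after the two lists, so that the K-point
    averages lie within 1/8 of the respective counts. With the 1/2 allowed on the circle, the two
    counts differ by less than 1, and they are integers. *)
Lemma count_disc_eq (s s' : seq C) (d : R) : 0 < d ->
  (forall z : C, z \in s -> cabs z != d) -> (forall z : C, z \in s' -> cabs z != d) ->
  (forall w, cabs w = d ->
    cabs (w * (\sum_(z <- s) (w - z)^-1 - \sum_(z <- s') (w - z)^-1)) <= 1 / 2) ->
  count (fun z => cabs z < d) s = count (fun z => cabs z < d) s'.
Proof.
move=> d0 sd sd' close; pose D : C := (d%:C)%C.
have cD : cabs D = d by rewrite cabs_real gtr0_norm.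
have D0 : D != 0 by rewrite -cabs_gt0 cD.
have cdiv (z : C) : cabs (z / D) = cabs z / d by rewrite cabsM cabsV cD.
have cnt (t : seq C) : count (fun z => cabs z < d) t = count (fun y => cabs y < 1) [seq z / D | z <- t].
  by rewrite count_map; apply: eq_count => z /=; rewrite cdiv ltr_pdivrMr ?mul1r.
have ne1 (t : seq C) : (forall z, z \in t -> cabs z != d) ->
    forall y, y \in [seq z / D | z <- t] -> cabs y != 1.
  move=> td y /mapP[z /td zd ->]; rewrite cdiv; apply: contra_neq zd => zd.
  by rewrite -[LHS](divfK (lt0r_neq0 d0)) zd mul1r.
have e0 : (0 : R) < 1 / 8 by lra.
have [K1 h1] := count_indicator e0 (ne1 _ sd).
have [K2 h2] := count_indicator e0 (ne1 _ sd').
pose K := (maxn K1 K2).+1.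
have [] := h1 K _ _; rewrite // -?cnt; first by rewrite leqW // leq_maxl.
move=> u1 {}h1; have [] := h2 K _ _; rewrite // -?cnt; first by rewrite leqW // leq_maxr.
move=> u2 {}h2; have [zeta prz] := prim_root_ex (isT : (0 < K)%N).
have zu k : zeta ^+ k != 0.
  apply: expf_neq0; apply: contra_eq_neq (prim_expr_order prz) => ->.
  by rewrite expr0n /= eq_sym oner_eq0.
have avg (t : seq C) : (forall y : C, y \in [seq z / D | z <- t] -> y ^+ K != 1) ->
    \sum_(k < K) (D / zeta ^+ k) * (\sum_(z <- t) (D / zeta ^+ k - z)^-1) =
    K%:R * \sum_(y <- [seq z / D | z <- t]) (1 - y ^+ K)^-1.
  move=> tu; under eq_bigr do rewrite mulr_sumr.
  rewrite exchange_big /=.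
  rewrite big_map mulr_sumr big_seq [RHS]big_seq. apply: eq_bigr => z zt.
  rewrite -(mean_roots_unity prz (tu _ (map_f _ zt))); apply: eq_bigr => k _.
  have -> : D / zeta ^+ k - z = (D / zeta ^+ k) * (1 - z / D * zeta ^+ k).
    by field; rewrite D0 zu.
  by rewrite invfM mulrA divff ?mul1r // mulf_neq0 // invr_eq0.
have cz : cabs zeta = 1.
  have := congr1 (@cabs R) (prim_expr_order prz); rewrite cabsX cabs1 => /eqP.
  by rewrite pexpr_eq1 ?cabs_ge0 // => /eqP.
have cw k : cabs (D / zeta ^+ k) = d by rewrite cabsM cabsV cabsX cz expr1n invr1 mulr1 cD.
have hK : cabs (K%:R * (\sum_(y <- [seq z / D | z <- s]) (1 - y ^+ K)^-1 -
    \sum_(y <- [seq z / D | z <- s']) (1 - y ^+ K)^-1)) <= K%:R * (1 / 2).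
  rewrite mulrBr -!avg // -sumrB; apply: le_trans (cabs_sum _ _ _) _.
  rewrite mulr_natl -[K in leRHS]card_ord -sumr_const; apply: ler_sum => k _.
  by rewrite -mulrBr; apply: close.
rewrite cabsM cabs_nat ler_pM2l ?ltr0n // in hK.
set S1 := \sum_(y <- _) _ in h1 hK; set S2 := \sum_(y <- [seq z / D | z <- s']) _ in h2 hK.
set m1 := count _ s in h1 *; set m2 := count _ s' in h2 *.
have : cabs (m1%:R - m2%:R : C) < 1.
  have -> : m1%:R - m2%:R = - (S1 - m1%:R) + ((S1 - S2) + (S2 - m2%:R)) by ring.
  apply: le_lt_trans (cabsD _ _) _; rewrite cabsN.
  apply: (@lt_le_trans _ _ (1/8 + (1/2 + 1/8))); last lra.
  apply: ltr_leD => //; apply: le_trans (cabsD _ _) _; apply: lerD => //; exact: ltW.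
have -> : (m1%:R - m2%:R : C) = ((m1%:R - m2%:R : R)%:C)%C by rewrite rmorphB !rmorph_nat.
rewrite cabs_real; case: (ltngtP m1 m2) => // h.
- by rewrite distrC ger0_norm ?subr_ge0 ?ler_nat 1?ltnW // -natrB 1?ltnW // -[1]/(1%:R) ltr_nat; lia.
- by rewrite ger0_norm ?subr_ge0 ?ler_nat 1?ltnW // -natrB 1?ltnW // -[1]/(1%:R) ltr_nat; lia.
Qed.

End CountRoots.

(** * Frobenius norm and limits of matrices *)

Section MatrixNorm.
Variable R : realType.
Local Notation C := (R[i]).
Local Open Scope sesquilinear_scope.

Lemma cauchy_schwarz_sum (I : finType) (a b : I -> R) :
  (\sum_i a i * b i) ^+ 2 <= (\sum_i a i ^+ 2) * (\sum_i b i ^+ 2).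
Proof.
set A := \sum_i a i ^+ 2; set B := \sum_i b i ^+ 2; set D := \sum_i a i * b i.
have B0 : 0 <= B by apply: sumr_ge0 => i _; apply: sqr_ge0.
have key (t : R) : 0 <= A - t * D *+ 2 + t ^+ 2 * B.
  have -> : A - t * D *+ 2 + t ^+ 2 * B = \sum_i (a i - t * b i) ^+ 2.
    rewrite /A /B /D mulr_sumr mulr_sumr -sumrMnl -sumrB -big_split /=.
    by apply: eq_bigr => i _; ring.
  by apply: sumr_ge0 => i _; apply: sqr_ge0.
have [B1|B1] := eqVneq B 0.
  have [->|D0] := eqVneq D 0; first by rewrite expr0n /= B1 mulr0.
  have := key ((A + 1) / (D *+ 2)); rewrite B1 mulr0 addr0 -mulrnAr divfK; last first.
    by rewrite mulrn_eq0.
  by rewrite opprD addrA subrr add0r oppr_ge0 ler10.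
have Bp : 0 < B by rewrite lt_def B1.
have := key (D / B).
have -> : A - D / B * D *+ 2 + (D / B) ^+ 2 * B = A - D ^+ 2 / B by field.
by rewrite subr_ge0 ler_pdivrMr.
Qed.

Definition nrm2 m n (V : 'M[C]_(m, n)) : R := \sum_i \sum_j cabs (V i j) ^+ 2.
Definition fn m n (V : 'M[C]_(m, n)) : R := Num.sqrt (nrm2 V).

Lemma nrm2_ge0 m n (V : 'M[C]_(m, n)) : 0 <= nrm2 V.
Proof. by apply: sumr_ge0 => i _; apply: sumr_ge0 => j _; apply: sqr_ge0. Qed.

Lemma fn_ge0 m n (V : 'M[C]_(m, n)) : 0 <= fn V.
Proof. exact: sqrtr_ge0. Qed.

Lemma fn_sqr m n (V : 'M[C]_(m, n)) : fn V ^+ 2 = nrm2 V.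
Proof. by rewrite sqr_sqrtr // nrm2_ge0. Qed.

Lemma fn_le m n (V : 'M[C]_(m, n)) c : 0 <= c -> (fn V <= c) = (nrm2 V <= c ^+ 2).
Proof. by move=> c0; rewrite -fn_sqr ler_pXn2r // nnegrE ?fn_ge0. Qed.

Lemma fn_lt m n (V : 'M[C]_(m, n)) c : 0 <= c -> (fn V < c) = (nrm2 V < c ^+ 2).
Proof. by move=> c0; rewrite -fn_sqr ltr_pXn2r // nnegrE ?fn_ge0. Qed.

Lemma nrm2_pair m n (V : 'M[C]_(m, n)) :
  nrm2 V = \sum_(p : 'I_m * 'I_n) cabs (V p.1 p.2) ^+ 2.
Proof. by rewrite /nrm2 pair_bigA. Qed.

Lemma nrm2_row m n (V : 'M[C]_(m, n)) : nrm2 V = \sum_i nrm2 (row i V).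
Proof.
apply: eq_bigr => i _; rewrite /nrm2 big_ord1.
by apply: eq_bigr => j _; rewrite mxE.
Qed.

Lemma nrm2_tr m n (V : 'M[C]_(m, n)) : nrm2 V^T = nrm2 V.
Proof.
by rewrite /nrm2 exchange_big; apply: eq_bigr => i _; apply: eq_bigr => j _; rewrite mxE.
Qed.

Lemma nrm2_adj m n (V : 'M[C]_(m, n)) : nrm2 (V ^t*) = nrm2 V.
Proof.
rewrite -nrm2_tr; apply: eq_bigr => i _; apply: eq_bigr => j _.
by rewrite !mxE cabs_conj.
Qed.

Lemma nrm2_col m n (V : 'M[C]_(m, n)) : nrm2 V = \sum_j nrm2 (col j V).
Proof.
rewrite -nrm2_tr nrm2_row; apply: eq_bigr => j _.
by rewrite -nrm2_tr tr_row trmxK.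
Qed.

Lemma cabs_entry m n (V : 'M[C]_(m, n)) i j : cabs (V i j) <= fn V.
Proof.
rewrite -(ler_pXn2r (n := 2)) ?nnegrE ?cabs_ge0 ?fn_ge0 // fn_sqr nrm2_pair.
by rewrite (bigD1 (i, j)) //= lerDl sumr_ge0 // => k _; apply: sqr_ge0.
Qed.

Lemma nrm2_eq0 m n (V : 'M[C]_(m, n)) : (nrm2 V == 0) = (V == 0).
Proof.
apply/eqP/eqP => [V0|->]; last first.
  by rewrite /nrm2 big1 // => i _; rewrite big1 // => j _; rewrite mxE cabs0 expr0n.
apply/matrixP => i j; rewrite mxE; apply/eqP; rewrite -cabs_eq0 eq_le cabs_ge0 andbT.
by apply: le_trans (cabs_entry V i j) _; rewrite /fn V0 sqrtr0.
Qed.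

Lemma nrm20 m n : nrm2 (0 : 'M[C]_(m, n)) = 0.
Proof. by apply/eqP; rewrite nrm2_eq0. Qed.

Lemma fn0 m n : fn (0 : 'M[C]_(m, n)) = 0.
Proof. by rewrite /fn nrm20 sqrtr0. Qed.

Lemma fn_eq0 m n (V : 'M[C]_(m, n)) : (fn V == 0) = (V == 0).
Proof. by rewrite -nrm2_eq0 -fn_sqr sqrf_eq0. Qed.

Lemma nrm2Z m n a (V : 'M[C]_(m, n)) : nrm2 (a *: V) = cabs a ^+ 2 * nrm2 V.
Proof.
rewrite /nrm2 mulr_sumr; apply: eq_bigr => i _; rewrite mulr_sumr.
by apply: eq_bigr => j _; rewrite mxE cabsM exprMn.
Qed.

Lemma fnZ m n a (V : 'M[C]_(m, n)) : fn (a *: V) = cabs a * fn V.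
Proof. by rewrite /fn nrm2Z sqrtrM ?sqr_ge0 // sqrtr_sqr ger0_norm ?cabs_ge0. Qed.

Lemma fnN m n (V : 'M[C]_(m, n)) : fn (- V) = fn V.
Proof. by rewrite -scaleN1r fnZ cabsN cabs1 mul1r. Qed.

Lemma fnD m n (V W : 'M[C]_(m, n)) : fn (V + W) <= fn V + fn W.
Proof.
rewrite fn_le ?addr_ge0 ?fn_ge0 //.
set a := fun p : 'I_m * 'I_n => cabs (V p.1 p.2).
set b := fun p : 'I_m * 'I_n => cabs (W p.1 p.2).
have h : \sum_p a p * b p <= fn V * fn W.
  have s0 : 0 <= \sum_p a p * b p.
    by apply: sumr_ge0 => p _; rewrite mulr_ge0 // cabs_ge0.
  rewrite -(ler_pXn2r (n := 2)) ?nnegrE ?mulr_ge0 ?fn_ge0 //.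
  by rewrite exprMn !fn_sqr !nrm2_pair cauchy_schwarz_sum.
apply: (@le_trans _ _ (\sum_p (a p + b p) ^+ 2)).
  rewrite nrm2_pair; apply: ler_sum => p _; rewrite mxE ler_pXn2r ?nnegrE ?cabs_ge0 ?addr_ge0 ?cabs_ge0 //.
  exact: cabsD.
have -> : \sum_p (a p + b p) ^+ 2 = nrm2 V + (\sum_p a p * b p) *+ 2 + nrm2 W.
  rewrite !nrm2_pair -sumrMnl -!big_split /=.
  by apply: eq_bigr => p _; rewrite sqrrD.
by rewrite sqrrD !fn_sqr lerD2r lerD2l lerMn2r h.
Qed.

Lemma fnB m n (V W : 'M[C]_(m, n)) : fn (V - W) <= fn V + fn W.
Proof. by rewrite -(fnN W) fnD. Qed.

Lemma fn_distC m n (V W : 'M[C]_(m, n)) : fn (V - W) = fn (W - V).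
Proof. by rewrite -fnN opprB. Qed.

Lemma fn_lerB m n (V W : 'M[C]_(m, n)) : fn V - fn W <= fn (V - W).
Proof. by rewrite lerBlDr; apply: le_trans (fnD _ _); rewrite subrK. Qed.

Lemma fnM m n p (A : 'M[C]_(m, n)) (B : 'M[C]_(n, p)) : fn (A *m B) <= fn A * fn B.
Proof.
rewrite fn_le ?mulr_ge0 ?fn_ge0 // exprMn !fn_sqr.
rewrite -(nrm2_tr B) /nrm2 mulr_suml; apply: ler_sum => i _.
rewrite mulr_sumr; apply: ler_sum => j _; rewrite mxE.
apply: le_trans (_ : (\sum_k cabs (A i k) * cabs (B k j)) ^+ 2 <= _).
  rewrite ler_pXn2r ?nnegrE ?cabs_ge0 ?sumr_ge0 // => [|k _].
    by apply: le_trans (cabs_sum _ _ _) _; under eq_bigr do rewrite cabsM.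
  by rewrite mulr_ge0 ?cabs_ge0.
apply: le_trans (cauchy_schwarz_sum _ _) _.
by rewrite le_eqVlt; apply/orP; left; apply/eqP; congr (_ * _); apply: eq_bigr => k _; rewrite mxE.
Qed.

Lemma fn_sum m n (I : Type) (r : seq I) (P : pred I) (F : I -> 'M[C]_(m, n)) :
  fn (\sum_(i <- r | P i) F i) <= \sum_(i <- r | P i) fn (F i).
Proof.
elim/big_ind2: _ => [|x1 x2 y1 y2 h1 h2|//]; first by rewrite fn0.
by apply: le_trans (fnD _ _) _; apply: lerD.
Qed.

Lemma cabs_trace m (M : 'M[C]_m) : cabs (\tr M) <= m%:R * fn M.
Proof.
apply: le_trans (cabs_sum _ _ _) _; rewrite mulr_natl -[X in _ *+ X]card_ord -sumr_const.
by apply: ler_sum => i _; apply: cabs_entry.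
Qed.

Lemma nrm2_trace m n (V : 'M[C]_(m, n)) : (nrm2 V)%:C%C = \tr (V ^t* *m V).
Proof.
rewrite -nrm2_tr /nrm2 rmorph_sum; apply: eq_bigr => j _; rewrite mxE rmorph_sum.
by apply: eq_bigr => i _; rewrite !mxE mulrC mulcJ.
Qed.

Lemma nrm2_orth m n p (V : 'M[C]_(m, n)) (B : 'M[C]_(n, p)) :
  V ^t* *m V = 1%:M -> nrm2 (V *m B) = nrm2 B.
Proof.
move=> V1; apply: complexI; rewrite !nrm2_trace trmx_mul map_mxM mulmxA.
by rewrite -[_ *m _ *m V]mulmxA V1 mulmx1.
Qed.

Lemma nrm2_unit n : nrm2 (1%:M : 'M[C]_n) = n%:R.
Proof.
apply: complexI; rewrite nrm2_trace mulmx1 trmx1 map_mx1 mxtrace1.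
by rewrite rmorph_nat.
Qed.

(** [V] is isometric: applied to the adjoint of its row r it gives a vector of norm |r| whose i-th
    entry is |r|^2. *)
Lemma nrm2_row_orth m n (V : 'M[C]_(m, n)) i :
  V ^t* *m V = 1%:M -> nrm2 (row i V) <= 1.
Proof.
move=> V1; set r := row i V.
have [->|r0] := eqVneq (nrm2 r) 0; first exact: ler01.
have rp : 0 < nrm2 r by rewrite lt_def r0 nrm2_ge0.
have e : cabs ((V *m r ^t*) i 0) = nrm2 r.
  have -> : (V *m r ^t*) i 0 = (nrm2 r)%:C%C.
    rewrite !mxE /nrm2 big_ord1 rmorph_sum; apply: eq_bigr => j _.
    by rewrite !mxE mulcJ.
  by rewrite cabs_real ger0_norm ?nrm2_ge0.
have := cabs_entry (V *m r ^t*) i 0.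
rewrite e -(ler_pXn2r (n := 2)) ?nnegrE ?fn_ge0 ?nrm2_ge0 // fn_sqr nrm2_orth // nrm2_adj.
by rewrite expr2 -ler_pdivlMr // divff.
Qed.

Lemma fn_le_entries m n (V : 'M[C]_(m, n)) e :
  (forall i j, cabs (V i j) <= e) -> fn V <= (m * n)%:R * e.
Proof.
move=> Ve; rewrite {1}(matrix_sum_delta V).
apply: le_trans (fn_sum _ _ _) _.
apply: le_trans (_ : \sum_(i < m) \sum_(j < n) e <= _); last first.
  by rewrite !sumr_const !card_ord -mulrnA mulr_natl mulnC.
apply: ler_sum => i _; apply: le_trans (fn_sum _ _ _) _; apply: ler_sum => j _.
rewrite fnZ; suff -> : fn (delta_mx i j : 'M[C]_(m, n)) = 1 by rewrite mulr1.
rewrite /fn nrm2_pair (bigD1 (i, j)) //= mxE !eqxx cabs1 expr1n big1 ?addr0 ?sqrtr1 //.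
move=> [k l] /= kl; rewrite mxE.
have -> : (k == i) && (l == j) = false by apply: contraNF kl => /andP[/eqP-> /eqP->].
by rewrite cabs0 expr0n.
Qed.

End MatrixNorm.

(** * Limits of matrices along a filter, and compactness along an ultrafilter *)

Section FilterLimits.
Variable R : realType.
Local Notation C := (R[i]).

(** The filter is a parameter because two of them occur: [\oo] for the partial sums of a row, and a
    free ultrafilter for limits of vectors of growing length. *)
Definition mlim (F : set_system nat) m n (f : nat -> 'M[C]_(m, n)) l :=
  forall e : R, 0 < e -> F [set i | fn (f i - l) < e].

Section Filter.
Context (F : set_system nat) {FF : Filter F}.

Lemma mlim_cst m n (l : 'M[C]_(m, n)) : mlim F (fun=> l) l.
Proof. by move=> e e0; apply: filterS filterT => i _ /=; rewrite subrr fn0. Qed.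

Lemma mlimD m n (f g : nat -> 'M[C]_(m, n)) a b :
  mlim F f a -> mlim F g b -> mlim F (fun i => f i + g i) (a + b).
Proof.
move=> fa gb e e0; have e20 : 0 < e / 2 by lra.
apply: filterS2 (fa _ e20) (gb _ e20) => i /= h1 h2.
rewrite opprD addrACA; apply: le_lt_trans (fnD _ _) _.
by rewrite [e]splitr ltrD.
Qed.

Lemma mlimMl m n p (A : 'M[C]_(m, n)) (f : nat -> 'M[C]_(n, p)) a :
  mlim F f a -> mlim F (fun i => A *m f i) (A *m a).
Proof.
move=> fa e e0; have A0 : 0 < fn A + 1 by rewrite ltr_wpDl ?fn_ge0.
apply: filterS (fa _ (divr_gt0 e0 A0)) => i /= h; rewrite -mulmxBr.
apply: le_lt_trans (fnM _ _) _.
rewrite ltr_pdivlMr // in h; apply: le_lt_trans h.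
by rewrite mulrC ler_wpM2l ?fn_ge0 // lerDl.
Qed.

Lemma mlimM m n p (f : nat -> 'M[C]_(m, n)) (g : nat -> 'M[C]_(n, p)) a b :
  mlim F f a -> mlim F g b -> mlim F (fun i => f i *m g i) (a *m b).
Proof.
move=> fa gb e e0.
pose K := fn a + fn b + 1.
have K0 : 0 < K by rewrite ltr_wpDl // addr_ge0 ?fn_ge0.
pose d := Num.min (e / (2 * K)) 1.
have d0 : 0 < d by rewrite lt_min ltr01 andbT divr_gt0 // mulr_gt0.
have d1 : d <= 1 by rewrite ge_min lexx orbT.
have dK : d * K <= e / 2.
  have : d <= e / (2 * K) by rewrite ge_min lexx.
  by rewrite ler_pdivlMr ?mulr_gt0 // => h; lra.
apply: filterS2 (fa _ d0) (gb _ d0) => i /= h1 h2.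
have -> : f i *m g i - a *m b = (f i - a) *m (g i - b) + (f i - a) *m b + a *m (g i - b).
  by rewrite -mulmxDr subrK mulmxBl mulmxBr addrA subrK.
apply: le_lt_trans (fnD _ _) _; apply: le_lt_trans (lerD (fnD _ _) (lexx _)) _.
apply: le_lt_trans (lerD (lerD (fnM _ _) (fnM _ _)) (fnM _ _)) _.
have := fn_ge0 (f i - a); have := fn_ge0 (g i - b).
have := fn_ge0 a; have := fn_ge0 b; rewrite /K in dK *.
set x := fn (f i - a) in h1 *; set y := fn (g i - b) in h2 *.
by move=> b0 a0 y0 x0; nra.
Qed.

Lemma mlimN m n (f : nat -> 'M[C]_(m, n)) a :
  mlim F f a -> mlim F (fun i => - f i) (- a).
Proof.
by move=> fa e e0; apply: filterS (fa e e0) => i /=; rewrite -opprD fnN.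
Qed.

Lemma mlimB m n (f g : nat -> 'M[C]_(m, n)) a b :
  mlim F f a -> mlim F g b -> mlim F (fun i => f i - g i) (a - b).
Proof. by move=> fa gb; apply: mlimD => //; apply: mlimN. Qed.

Lemma mlim_sum m n (I : Type) (r : seq I) (f : I -> nat -> 'M[C]_(m, n)) a :
  (forall k, mlim F (f k) (a k)) ->
  mlim F (fun i => \sum_(k <- r) f k i) (\sum_(k <- r) a k).
Proof.
move=> fa; elim: r => [|k r IH] e e0.
  by apply: filterS filterT => i _ /=; rewrite !big_nil subrr fn0.
have := mlimD (fa k) IH e0; apply: filterS => i /=.
by rewrite !big_cons.
Qed.

Lemma mlim_ext m n (f g : nat -> 'M[C]_(m, n)) a :
  F [set i | f i = g i] -> mlim F f a -> mlim F g a.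
Proof.
by move=> fg fa e e0; apply: filterS2 fg (fa e e0) => i /= ->.
Qed.

Lemma mlim_scalarP (f : nat -> C) a :
  mlim F (fun i => (f i)%:M : 'M[C]_1) a%:M <->
  (forall e, 0 < e -> F [set i | cabs (f i - a) < e]).
Proof.
have E i : fn ((f i)%:M - a%:M : 'M[C]_1) = cabs (f i - a).
  rewrite /fn /nrm2 !big_ord1 !mxE eqxx !mulr1n sqrtr_sqr ger0_norm ?cabs_ge0 //.
by split=> h e e0; have := h e e0; apply: filterS => i /=; rewrite E.
Qed.

Lemma mlim_tail m n (f : nat -> 'M[C]_(m, n)) a : mlim F f a <->
  forall i j, mlim F (fun k => (f k i j)%:M : 'M[C]_1) (a i j)%:M.
Proof.
split=> [fa i j|fa e e0].
  apply/mlim_scalarP => e e0; have := fa e e0; apply: filterS => k /=.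
  by apply: le_lt_trans; have := cabs_entry (f k - a) i j; rewrite !mxE.
have mp : 0 < (m * n)%:R + 1 :> R by rewrite ltr_wpDl ?ler0n.
have e'0 := divr_gt0 e0 mp.
have : F [set k | forall p : 'I_m * 'I_n,
    cabs (f k p.1 p.2 - a p.1 p.2) < e / ((m * n)%:R + 1)].
  apply: filter_forall => -[i j] /=.
  by have /mlim_scalarP/(_ _ e'0) := fa i j.
apply: filterS => k /= h.
apply: le_lt_trans (fn_le_entries (e := e / ((m * n)%:R + 1)) _) _.
  by move=> i j; rewrite !mxE; apply/ltW/(h (i, j)).
by rewrite mulrA ltr_pdivrMr // mulrC ltr_pM2l // ltrDl.
Qed.

End Filter.

Lemma mlim_unique (F : set_system nat) {FF : ProperFilter F} m n
    (f : nat -> 'M[C]_(m, n)) a b : mlim F f a -> mlim F f b -> a = b.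
Proof.
move=> fa fb; apply/eqP; rewrite -subr_eq0 -fn_eq0; apply: contraT => ab.
have ab0 : 0 < fn (a - b) by rewrite lt_def ab fn_ge0.
have h0 : 0 < fn (a - b) / 2 by lra.
have [i [/= h1 h2]] := filter_ex (filterI (fa _ h0) (fb _ h0)).
have : fn (a - b) <= fn (f i - a) + fn (f i - b).
  by rewrite -(fnN (f i - a)) opprB; apply: le_trans (fnD _ _); rewrite addrA subrK.
by move=> h; lra.
Qed.

Lemma mlim_nrm2_le (F : set_system nat) {FF : ProperFilter F} m n
    (f : nat -> 'M[C]_(m, n)) a M :
  mlim F f a -> F [set i | nrm2 (f i) <= M] -> nrm2 a <= M.
Proof.
move=> fa fM; have M0 : 0 <= M.
  by have [i /= h] := filter_ex fM; apply: le_trans h; apply: nrm2_ge0.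
rewrite -(sqr_sqrtr M0) -fn_le ?sqrtr_ge0 //; apply/ler_addgt0Pr => e e0.
have [i [/= h1 h2]] := filter_ex (filterI (fa _ e0) fM).
have : fn (f i) <= Num.sqrt M by rewrite fn_le ?sqrtr_ge0 // sqr_sqrtr.
by have := fn_lerB a (f i); rewrite fn_distC => *; lra.
Qed.

Lemma ultra_real_lim (U : set_system nat) {UF : UltraFilter U} (f : nat -> R) M :
  (forall i, `|f i| <= M) -> exists l : R, forall e, 0 < e -> U [set i | `|f i - l| < e].
Proof.
move=> fM.
have UfM : (f @ U) `[- M, M]%classic.
  change (U (f @^-1` `[- M, M]%classic)).
  by apply: (@filterS _ U _ setT) filterT => i _; rewrite /= in_itv /= -ler_norml; apply: fM.
have [l [_ cl]] := @segment_compact R (- M) M (f @ U) (fmap_proper_filter f ultra_proper) UfM.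
exists l => e e0.
have [//|nU] := in_ultra_setVsetC [set i | `|f i - l| < e] UF.
have fU : (f @ U) (~` [set y | `|y - l| < e]) := nU.
have [y [/= h]] := cl _ _ fU (nbhsx_ballx l e e0).
by rewrite /ball /= distrC => /h.
Qed.

(** Stands in for Bolzano-Weierstrass: all bounded sequences, in particular all coordinates at once,
    converge along the same ultrafilter, so no diagonal extraction is needed. *)
Lemma ultra_mlim (U : set_system nat) {UF : UltraFilter U} m n
    (f : nat -> 'M[C]_(m, n)) M :
  (forall i, nrm2 (f i) <= M) -> exists l, mlim U f l.
Proof.
move=> fM; have M0 : 0 <= M by apply: le_trans (fM 0%N); apply: nrm2_ge0.
have fe i k l : cabs (f i k l) <= Num.sqrt M.
  apply: le_trans (cabs_entry _ _ _) _.
  by rewrite fn_le ?sqrtr_ge0 // sqr_sqrtr.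
have /choice[g gP] (p : 'I_m * 'I_n) : exists l : C, forall e, 0 < e ->
    U [set i | cabs (f i p.1 p.2 - l) < e].
  have [a aP] := @ultra_real_lim U UF (fun i => complex.Re (f i p.1 p.2)) _
    (fun i => le_trans (cabs_Re _) (fe i p.1 p.2)).
  have [b bP] := @ultra_real_lim U UF (fun i => complex.Im (f i p.1 p.2)) _
    (fun i => le_trans (cabs_Im _) (fe i p.1 p.2)).
  exists (a +i* b)%C => e e0; have e20 : 0 < e / 2 by lra.
  apply: filterS2 (aP _ e20) (bP _ e20) => i /= h1 h2.
  apply: le_lt_trans (cabs_le_ReIm _) _; move: h1 h2.
  by case: (f i p.1 p.2) => x y /= h1 h2; rewrite [e]splitr ltrD.
exists (\matrix_(i, j) g (i, j)); apply/mlim_tail => i j; rewrite mxE.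
by apply/mlim_scalarP; apply: (gP (i, j)).
Qed.

End FilterLimits.

(** * Square-summable sequences and tightness *)

Section SquareSummable.
Variable R : realType.
Local Notation C := (R[i]).

(** The extension by zero makes matrices with different numbers of rows comparable as sequences.
    Throughout, rows are coordinates and the m columns are m vectors treated together. *)
Definition ent N m (V : 'M[C]_(N, m)) (p : nat) : 'rV[C]_m :=
  if insub p is Some i then row i V else 0.

Definition trunc m (U : nat -> 'rV[C]_m) N : 'M[C]_(N, m) := \matrix_(i < N) U i.

Definition ell2 m (U : nat -> 'rV[C]_m) : Prop :=
  exists M, forall K, \sum_(p < K) nrm2 (U p) <= M.

Definition tail K N m (V : 'M[C]_(N, m)) : R :=
  \sum_(i < N | (K <= i)%N) nrm2 (row i V).

Lemma ent_ord N m (V : 'M[C]_(N, m)) (i : 'I_N) : ent V i = row i V.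
Proof. by rewrite /ent valK. Qed.

Lemma ent_out N m (V : 'M[C]_(N, m)) p : (N <= p)%N -> ent V p = 0.
Proof. by move=> Np; rewrite /ent insubF // ltnNge Np. Qed.

Lemma entM N m r (V : 'M[C]_(N, m)) (B : 'M[C]_(m, r)) p :
  ent (V *m B) p = ent V p *m B.
Proof. by rewrite /ent; case: insubP => [i _ _|_]; rewrite ?row_mul ?mul0mx. Qed.

Lemma entD N m (V W : 'M[C]_(N, m)) p : ent (V + W) p = ent V p + ent W p.
Proof. by rewrite /ent; case: insubP => [i _ _|_]; rewrite ?linearD ?addr0. Qed.

Lemma entZ N m a (V : 'M[C]_(N, m)) p : ent (a *: V) p = a *: ent V p.
Proof. by rewrite /ent; case: insubP => [i _ _|_]; rewrite ?linearZ ?scaler0. Qed.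

Lemma entN N m (V : 'M[C]_(N, m)) p : ent (- V) p = - ent V p.
Proof. by rewrite -(scaleN1r V) entZ scaleN1r. Qed.

Lemma entB N m (V W : 'M[C]_(N, m)) p : ent (V - W) p = ent V p - ent W p.
Proof. by rewrite entD entN. Qed.

Lemma ent_trunc m (U : nat -> 'rV[C]_m) N p : (p < N)%N -> ent (trunc U N) p = U p.
Proof. by move=> pN; rewrite -[p]/(nat_of_ord (Ordinal pN)) ent_ord rowK. Qed.

Lemma nrm2_trunc m (U : nat -> 'rV[C]_m) N : nrm2 (trunc U N) = \sum_(p < N) nrm2 (U p).
Proof. by rewrite nrm2_row; apply: eq_bigr => i _; rewrite rowK. Qed.

Lemma nrm2_ent N m (V : 'M[C]_(N, m)) K : (N <= K)%N ->
  \sum_(p < K) nrm2 (ent V p) = nrm2 V.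
Proof.
move=> NK; rewrite nrm2_row.
rewrite -(big_mkord xpredT (fun p => nrm2 (ent V p))) (big_cat_nat _ NK) //=.
rewrite big_mkord [X in _ + X]big1_seq ?addr0 => [|p]; last first.
  by rewrite mem_index_iota => /andP[_ /andP[Np _]]; rewrite ent_out // nrm20.
by apply: eq_bigr => i _; rewrite ent_ord.
Qed.

Lemma nrm2_ent_le N m (V : 'M[C]_(N, m)) K : \sum_(p < K) nrm2 (ent V p) <= nrm2 V.
Proof.
rewrite -(nrm2_ent V (leq_maxl N K)) -!(big_mkord xpredT (fun p => nrm2 (ent V p))).
rewrite [leRHS](big_cat_nat (leq0n K) (leq_maxr N K)) //= lerDl.
by apply: sumr_ge0 => i _; apply: nrm2_ge0.
Qed.

Lemma ent_le N m (V : 'M[C]_(N, m)) p : nrm2 (ent V p) <= nrm2 V.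
Proof.
apply: le_trans (nrm2_ent_le V p.+1); rewrite big_ord_recr /= lerDr.
by apply: sumr_ge0 => i _; apply: nrm2_ge0.
Qed.

Lemma nrm2_split K N m (V : 'M[C]_(N, m)) :
  nrm2 V = \sum_(p < K) nrm2 (ent V p) + tail K V.
Proof.
rewrite nrm2_row (bigID (fun i : 'I_N => (i < K)%N)) /=; congr (_ + _); last first.
  by apply: eq_bigl => i; rewrite -leqNgt.
rewrite (eq_bigr (fun i : 'I_N => nrm2 (ent V i))) => [|i _]; last by rewrite ent_ord.
rewrite -(big_mkord (fun i => i < K)%N (fun p => nrm2 (ent V p))).
rewrite -(big_mkord xpredT (fun p => nrm2 (ent V p))).
have [KN|NK] := leqP K N.
  rewrite (big_cat_nat (leq0n K) KN) //= [X in _ + X]big1_seq ?addr0 => [|p]; last first.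
    by rewrite mem_index_iota => /andP[pK /andP[Kp _]]; move: pK; rewrite ltnNge Kp.
  by rewrite big_nat_cond [RHS]big_nat_cond; apply: eq_bigl => i /=; rewrite andbb andbT.
rewrite [RHS](big_cat_nat (leq0n N) (ltnW NK)) //= [X in _ = _ + X]big1_seq ?addr0 => [|p]; last first.
  by rewrite mem_index_iota => /andP[_ /andP[Np _]]; rewrite ent_out // nrm20.
rewrite big_nat_cond [RHS]big_nat_cond; apply: eq_bigl => i /=.
by case: (ltnP i N) => // iN; rewrite (ltn_trans iN NK).
Qed.

Lemma tail_ge0 K N m (V : 'M[C]_(N, m)) : 0 <= tail K V.
Proof. by apply: sumr_ge0 => i _; apply: nrm2_ge0. Qed.

Lemma tail_le K N m (V : 'M[C]_(N, m)) : tail K V <= nrm2 V.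
Proof. by rewrite (nrm2_split K V) lerDr sumr_ge0 // => i _; apply: nrm2_ge0. Qed.

Lemma tail_mono K K' N m (V : 'M[C]_(N, m)) : (K <= K')%N -> tail K' V <= tail K V.
Proof.
move=> KK; rewrite [leRHS](bigID (fun i : 'I_N => (K' <= i)%N)) /=.
rewrite (eq_bigl (fun i : 'I_N => (K' <= i)%N)) => [|i]; last first.
  by case: (leqP K' i) => h; rewrite ?andbF // andbT (leq_trans KK h).
by rewrite lerDl sumr_ge0 // => i _; apply: nrm2_ge0.
Qed.

Lemma nrm2D m n (V W : 'M[C]_(m, n)) : nrm2 (V + W) <= (nrm2 V + nrm2 W) *+ 2.
Proof.
have h : fn (V + W) ^+ 2 <= (fn V + fn W) ^+ 2.
  by rewrite ler_pXn2r ?nnegrE ?addr_ge0 ?fn_ge0 ?fnD.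
rewrite -!fn_sqr; apply: le_trans h _; rewrite -subr_ge0.
have -> : (fn V ^+ 2 + fn W ^+ 2) *+ 2 - (fn V + fn W) ^+ 2 = (fn V - fn W) ^+ 2 by ring.
exact: sqr_ge0.
Qed.

Lemma nrm2M m n p (A : 'M[C]_(m, n)) (B : 'M[C]_(n, p)) : nrm2 (A *m B) <= nrm2 A * nrm2 B.
Proof.
by rewrite -!fn_sqr -exprMn ler_pXn2r ?nnegrE ?mulr_ge0 ?fn_ge0 ?fnM.
Qed.

Lemma tailD K N m (V W : 'M[C]_(N, m)) : tail K (V + W) <= (tail K V + tail K W) *+ 2.
Proof.
rewrite /tail -big_split -sumrMnl; apply: ler_sum => i _.
by rewrite linearD; apply: nrm2D.
Qed.

Lemma tailM K N m r (V : 'M[C]_(N, m)) (B : 'M[C]_(m, r)) :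
  tail K (V *m B) <= tail K V * nrm2 B.
Proof.
by rewrite /tail mulr_suml; apply: ler_sum => i _; rewrite row_mul nrm2M.
Qed.

Lemma nrm2_lincomb m (r : seq nat) (a : nat -> C) (v : nat -> 'rV[C]_m) :
  nrm2 (\sum_(q <- r) a q *: v q) <=
  (\sum_(q <- r) cabs (a q) ^+ 2) * (\sum_(q <- r) nrm2 (v q)).
Proof.
rewrite -fn_sqr.
rewrite (big_nth 0%N) big_mkord (big_nth 0%N) big_mkord (big_nth 0%N) big_mkord.
apply: le_trans (_ : (\sum_(i < size r) cabs (a (nth 0%N r i)) * fn (v (nth 0%N r i))) ^+ 2 <= _).
  rewrite ler_pXn2r ?nnegrE ?fn_ge0 ?sumr_ge0 // => [|i _].
    by apply: le_trans (fn_sum _ _ _) _; under eq_bigr do rewrite fnZ.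
  by rewrite mulr_ge0 ?cabs_ge0 ?fn_ge0.
apply: le_trans (cauchy_schwarz_sum _ _) _.
by under [X in _ * X <= _]eq_bigr do rewrite fn_sqr.
Qed.

Lemma bounded_series_tail (a : nat -> R) M : (forall p, 0 <= a p) ->
  (forall K, \sum_(p < K) a p <= M) ->
  forall e, 0 < e -> exists K0, forall K K', (K0 <= K)%N -> \sum_(K <= p < K') a p < e.
Proof.
move=> a0 aM e e0; pose s K := \sum_(p < K) a p.
have sup_s : has_sup (range s).
  by split; [exists (s 0%N), 0%N|exists M => _ [K _ <-]; apply: aM].
have [_ [K0 _ <-] hK0] := sup_adherent e0 sup_s.
exists K0 => K K' K0K.
have [KK|KK] := leqP K' K; first by rewrite big_geq.
have h : s K' <= sup (range s) by apply: ub_le_sup; [case: sup_s|exists K'].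
have : s K' = s K + \sum_(K <= p < K') a p.
  by rewrite /s -!(big_mkord xpredT a) -big_cat_nat // ltnW.
have : s K0 <= s K.
  rewrite /s -!(big_mkord xpredT a) (big_cat_nat (leq0n K0) K0K) //= lerDl.
  by apply: sumr_ge0.
by move=> *; lra.
Qed.

End SquareSummable.

(** * Weak limits and tightness for vectors of growing length *)

Section SequenceLimits.
Variable R : realType.
Local Notation C := (R[i]).
Context (U : set_system nat) {UF : UltraFilter U}.
Hypothesis Uinf : \oo `<=` U.

Lemma ultra_large (K : nat) : U [set i | (K <= i)%N].
Proof. by apply: Uinf; exists K. Qed.

Lemma ultra_harmonic (e : R) : 0 < e -> U [set i | i.+1%:R^-1 < e].
Proof.
move=> e0; apply: Uinf.
have [K _ h] := @cvgr0_norm_lt _ _ _ _ _ _ (@cvg_harmonic R) e e0.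
by exists K => // i /h /=; rewrite ger0_norm ?invr_ge0.
Qed.

Variable N_ : nat -> nat.
Hypothesis N_ge : forall i, (i <= N_ i)%N.

(** For bounded families this is weak convergence in l2. The number of rows varies with i, so the
    limit is taken coordinate by coordinate. *)
Definition plim m (V : forall i, 'M[C]_(N_ i, m)) (L : nat -> 'rV[C]_m) :=
  forall p, mlim U (fun i => ent (V i) p) (L p).

(** No mass escapes to infinity. Tightness upgrades coordinatewise convergence to convergence in
    norm, see [tight_plim0]. *)
Definition tight m (V : forall i, 'M[C]_(N_ i, m)) :=
  forall e : R, 0 < e -> exists K, U [set i | tail K (V i) < e].

Lemma plim_ex m (V : forall i, 'M[C]_(N_ i, m)) M : (forall i, nrm2 (V i) <= M) ->
  exists L, plim V L.
Proof.
move=> VM; have /choice[L hL] p : exists l, mlim U (fun i => ent (V i) p) l.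
  by apply: (@ultra_mlim _ U UF _ _ _ M) => i; apply: le_trans (ent_le _ _) (VM i).
by exists L.
Qed.

Lemma plim_bound m (V : forall i, 'M[C]_(N_ i, m)) L M :
  (forall i, nrm2 (V i) <= M) -> plim V L -> forall K, \sum_(p < K) nrm2 (L p) <= M.
Proof.
move=> VM VL K; rewrite -nrm2_trunc.
apply: (@mlim_nrm2_le _ U _ _ _ (fun i => trunc (ent (V i)) K)).
  apply/mlim_tail => p q; have /mlim_tail/(_ 0 q) := VL p.
  by rewrite !mxE; apply: mlim_ext; apply: filterS filterT => i _ /=; rewrite !mxE.
apply: filterS filterT => i _ /=; rewrite nrm2_trunc.
by apply: le_trans (nrm2_ent_le _ _) (VM i).
Qed.

Lemma plim_ell2 m (V : forall i, 'M[C]_(N_ i, m)) L M :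
  (forall i, nrm2 (V i) <= M) -> plim V L -> ell2 L.
Proof. by move=> VM VL; exists M; apply: plim_bound VL. Qed.

Lemma plimB m (V W : forall i, 'M[C]_(N_ i, m)) L L' : plim V L -> plim W L' ->
  plim (fun i => V i - W i) (fun p => L p - L' p).
Proof.
move=> VL WL p; apply: mlim_ext (mlimB (VL p) (WL p)).
by apply: filterS filterT => i _; rewrite /= entB.
Qed.

Lemma plimM m r (V : forall i, 'M[C]_(N_ i, m)) L (B : nat -> 'M[C]_(m, r)) b :
  plim V L -> mlim U B b -> plim (fun i => V i *m B i) (fun p => L p *m b).
Proof.
move=> VL Bb p; apply: mlim_ext (mlimM (VL p) Bb).
by apply: filterS filterT => i _; rewrite /= entM.
Qed.

Lemma plimMr m r (V : forall i, 'M[C]_(N_ i, m)) L (b : 'M[C]_(m, r)) :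
  plim V L -> plim (fun i => V i *m b) (fun p => L p *m b).
Proof. by move=> VL; apply: plimM => //; apply: mlim_cst. Qed.

Lemma plim_trunc m (L : nat -> 'rV[C]_m) : plim (fun i => trunc L (N_ i)) L.
Proof.
move=> p; apply: mlim_ext (mlim_cst (L p)).
apply: filterS (ultra_large p.+1) => i /= pi.
by rewrite ent_trunc // (leq_trans pi).
Qed.

Lemma plim_null m (V : forall i, 'M[C]_(N_ i, m)) :
  (forall e, 0 < e -> U [set i | fn (V i) < e]) -> plim V (fun=> 0).
Proof.
move=> V0 p e e0; apply: filterS (V0 e e0) => i /=; rewrite subr0.
by apply: le_lt_trans; rewrite fn_le ?fn_ge0 // fn_sqr ent_le.
Qed.

Lemma tight_null m (V : forall i, 'M[C]_(N_ i, m)) :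
  (forall e, 0 < e -> U [set i | fn (V i) < e]) -> tight V.
Proof.
move=> V0 e e0; exists 0%N; have s0 : 0 < Num.sqrt e by rewrite sqrtr_gt0.
apply: filterS (V0 _ s0) => i /=; rewrite fn_lt ?ltW // sqr_sqrtr ?ltW //.
by apply: le_lt_trans; apply: tail_le.
Qed.

Lemma tightD m (V W : forall i, 'M[C]_(N_ i, m)) :
  tight V -> tight W -> tight (fun i => V i + W i).
Proof.
move=> tV tW e e0; have e4 : 0 < e / 4 by lra.
have [K1 h1] := tV _ e4; have [K2 h2] := tW _ e4.
exists (maxn K1 K2); apply: filterS2 h1 h2 => i /= h1 h2.
apply: le_lt_trans (tailD _ _ _) _.
have := tail_mono (V i) (leq_maxl K1 K2); have := tail_mono (W i) (leq_maxr K1 K2).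
by move=> *; lra.
Qed.

Lemma tightM m r (V : forall i, 'M[C]_(N_ i, m)) (B : nat -> 'M[C]_(m, r)) M :
  tight V -> (forall i, nrm2 (B i) <= M) -> tight (fun i => V i *m B i).
Proof.
move=> tV BM e e0; have M0 : 0 < M + 1.
  by rewrite ltr_wpDl //; apply: le_trans (BM 0%N); apply: nrm2_ge0.
have [K h] := tV _ (divr_gt0 e0 M0); exists K; apply: filterS h => i /= h.
rewrite ltr_pdivlMr // in h; apply: le_lt_trans h.
apply: le_trans (tailM _ _ _) _; rewrite ler_wpM2l ?tail_ge0 //.
by apply: le_trans (BM i) _; rewrite lerDl.
Qed.

Lemma tight_trunc m (L : nat -> 'rV[C]_m) : ell2 L -> tight (fun i => trunc L (N_ i)).
Proof.
move=> [M LM] e e0.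
have [K0 h] := bounded_series_tail (fun p => nrm2_ge0 (L p)) LM e0.
exists K0; apply: filterS filterT => i _ /=.
apply: le_lt_trans (h K0 (N_ i) (leqnn _)).
rewrite /tail (eq_bigr (fun k : 'I_(N_ i) => nrm2 (L k))) => [|k _]; last by rewrite rowK.
rewrite -(big_mkord (fun k => K0 <= k)%N (fun p => nrm2 (L p))).
have [KN|NK] := leqP K0 (N_ i).
  rewrite (big_cat_nat (leq0n K0) KN) //= big1_seq ?add0r => [|p].
    rewrite big_mkcond; apply: ler_sum => k _; case: ifP => // _; exact: nrm2_ge0.
  by rewrite mem_index_iota => /andP[Kp /andP[_ pK]]; move: pK; rewrite ltnNge Kp.
rewrite [leRHS]big_geq 1?ltnW // big1_seq // => p.
by rewrite mem_index_iota => /andP[Kp /andP[_ pN]]; move: (leq_trans NK Kp); rewrite ltnNge ltnW // .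
Qed.

(** Tightness leaves at most e^2/2 of the mass beyond some K, and the finitely many coordinates
    below K tend to 0. *)
Lemma tight_plim0 m (V : forall i, 'M[C]_(N_ i, m)) : tight V -> plim V (fun=> 0) ->
  forall e, 0 < e -> U [set i | fn (V i) < e].
Proof.
move=> tV V0 e e0; have e20 : 0 < e ^+ 2 / 2 by rewrite divr_gt0 // exprn_gt0.
have [K hK] := tV _ e20.
(* K coordinates of mass below d add up to at most e^2/2; the successor avoids a zero
   denominator. *)
pose d := e ^+ 2 / 2 / (K.+1%:R).
have d0 : 0 < d by rewrite divr_gt0.
have : U [set i | forall p : 'I_K, nrm2 (ent (V i) p) < d].
  apply: filter_forall => p; have s0 : 0 < Num.sqrt d by rewrite sqrtr_gt0.
  apply: filterS (V0 p _ s0) => i /=; rewrite subr0 fn_lt ?ltW //.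
  by rewrite sqr_sqrtr // ltW.
apply: filterS2 hK => i /= h1 h2; rewrite fn_lt ?ltW // (nrm2_split K).
suff : \sum_(p < K) nrm2 (ent (V i) p) <= e ^+ 2 / 2 by move=> h; lra.
apply: le_trans (_ : \sum_(p < K) d <= _); first by apply: ler_sum => p _; apply: ltW.
rewrite sumr_const card_ord /d -(mulr_natr _ K) -[leLHS]mulrA ler_piMr ?ltW //.
by rewrite [_ * K%:R]mulrC ltr_pdivrMr // mul1r ltr_nat.
Qed.

Lemma tight_limit_neq0 m (V : forall i, 'M[C]_(N_ i, m)) L c : 0 < c ->
  tight V -> plim V L -> (forall i, c <= fn (V i)) -> exists p, L p != 0.
Proof.
move=> c0 tV VL V1; apply: contrapT => /forallNP L0.
have : plim V (fun=> 0).
  by move=> p; have := VL p; have /negP := L0 p; rewrite negbK => /eqP ->.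
move=> /(tight_plim0 tV)/(_ c c0)/filter_ex[i /=].
by rewrite ltNge V1.
Qed.

End SequenceLimits.

(** * Infinite matrices and their sections *)

Section InfiniteMatrix.
Variable R : realType.
Local Notation C := (R[i]).
Variable mat : nat -> nat -> C.

Definition sec N : 'M[C]_N := \matrix_(i < N, j < N) mat i j.

(** The matrix is an unbounded operator on l2, so its action is given as a graph, row by row;
    membership in [ell2] is stated separately where it matters. Using m columns treats a whole
    family at once. *)
Definition acts m (L F : nat -> 'rV[C]_m) : Prop :=
  forall p, mlim \oo (fun K => \sum_(q < K) mat p q *: L q) (F p).

Definition is_eig (lam : C) : Prop := exists u : nat -> 'rV[C]_1,
  [/\ ell2 u, exists p, u p != 0 & acts u (fun p => lam *: u p)].

Lemma acts_ext m (L L' F F' : nat -> 'rV[C]_m) :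
  L =1 L' -> F =1 F' -> acts L F -> acts L' F'.
Proof. by move=> /funext-> /funext->. Qed.

Lemma acts_uniq m (L F F' : nat -> 'rV[C]_m) : acts L F -> acts L F' -> F =1 F'.
Proof. by move=> h h' p; apply: mlim_unique (h p) (h' p). Qed.

Lemma actsD m (L F L' F' : nat -> 'rV[C]_m) : acts L F -> acts L' F' ->
  acts (fun p => L p + L' p) (fun p => F p + F' p).
Proof.
move=> h h' p; apply: mlim_ext (mlimD (h p) (h' p)).
apply: filterS filterT => K _ /=; rewrite -big_split /=.
by apply: eq_bigr => q _; rewrite scalerDr.
Qed.

Lemma acts_mulr m r (L F : nat -> 'rV[C]_m) (B : 'M[C]_(m, r)) : acts L F ->
  acts (fun p => L p *m B) (fun p => F p *m B).
Proof.
move=> h p; apply: mlim_ext (mlimM (h p) (mlim_cst B)).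
apply: filterS filterT => K _ /=; rewrite mulmx_suml.
by apply: eq_bigr => q _; rewrite scalemxAl.
Qed.

Lemma actsZ m a (L F : nat -> 'rV[C]_m) : acts L F ->
  acts (fun p => a *: L p) (fun p => a *: F p).
Proof.
move=> /(acts_mulr a%:M); apply: acts_ext => p; by rewrite mul_mx_scalar.
Qed.

Lemma actsB m (L F L' F' : nat -> 'rV[C]_m) : acts L F -> acts L' F' ->
  acts (fun p => L p - L' p) (fun p => F p - F' p).
Proof.
move=> h /(actsZ (-1)) h'; apply: acts_ext (actsD h h') => p; by rewrite scaleN1r.
Qed.

Lemma ell2_mulr m r (L : nat -> 'rV[C]_m) (B : 'M[C]_(m, r)) :
  ell2 L -> ell2 (fun p => L p *m B).
Proof.
move=> [M h]; exists (M * nrm2 B) => K.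
apply: le_trans (_ : \sum_(p < K) nrm2 (L p) * nrm2 B <= _).
  by apply: ler_sum => p _; apply: nrm2M.
by rewrite -mulr_suml ler_wpM2r ?nrm2_ge0.
Qed.

Lemma ell2D m (L L' : nat -> 'rV[C]_m) : ell2 L -> ell2 L' -> ell2 (fun p => L p + L' p).
Proof.
move=> [M h] [M' h']; exists ((M + M') *+ 2) => K.
apply: le_trans (_ : \sum_(p < K) (nrm2 (L p) + nrm2 (L' p)) *+ 2 <= _).
  by apply: ler_sum => p _; apply: nrm2D.
by rewrite sumrMnl big_split lerMn2r /= lerD ?h ?h'.
Qed.

Lemma ell2Z m a (L : nat -> 'rV[C]_m) : ell2 L -> ell2 (fun p => a *: L p).
Proof.
move=> /(ell2_mulr a%:M)[M h]; exists M => K; apply: le_trans (h K).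
by apply: ler_sum => p _; rewrite mul_mx_scalar.
Qed.

Lemma ell2B m (L L' : nat -> 'rV[C]_m) : ell2 L -> ell2 L' -> ell2 (fun p => L p - L' p).
Proof.
move=> h /(ell2Z (-1)) h'; have [M hM] := ell2D h h'; exists M => K.
by apply: le_trans (hM K); apply: ler_sum => p _; rewrite scaleN1r.
Qed.

Lemma ent_sec N m (V : 'M[C]_(N, m)) p : (p < N)%N ->
  ent (sec N *m V) p = \sum_(q < N) mat p q *: ent V q.
Proof.
move=> pN; rewrite -[p in LHS]/(nat_of_ord (Ordinal pN)) ent_ord; apply/rowP => j.
rewrite /sec !mxE summxE; apply: eq_bigr => q _.
by rewrite ent_ord !mxE.
Qed.

Hypothesis mat_row : forall p, exists M, forall K, \sum_(q < K) cabs (mat p q) ^+ 2 <= M.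

Context (U : set_system nat) {UF : UltraFilter U}.
Hypothesis Uinf : \oo `<=` U.

(** The graph is closed under weak limits: a square-summable row is a weakly continuous functional
    on bounded families. By Cauchy-Schwarz, cutting the row at K changes the sum by at most e/4
    uniformly in i, and one good index i suffices for each K. *)
Lemma acts_lim N_ (N_ge : forall i, (i <= N_ i)%N) m (V : forall i, 'M[C]_(N_ i, m)) L F M :
  (forall i, nrm2 (V i) <= M) -> plim U V L ->
  plim U (fun i => sec (N_ i) *m V i) F -> acts L F.
Proof.
move=> VM VL VF p e e0; have [Mp hp] := mat_row p.
have M0 : 0 <= M by apply: le_trans (VM 0%N); apply: nrm2_ge0.
have M1 : 0 < M + 1 by lra.
have e40 : 0 < e / 4 by lra.
have e20 : 0 < (e / 4) ^+ 2 / (M + 1) by rewrite divr_gt0 // exprn_gt0.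
have [K0 h0] := bounded_series_tail (fun q => sqr_ge0 (cabs (mat p q))) hp e20.
exists K0 => // K /= K0K.
have hK : mlim U (fun i => \sum_(q < K) mat p q *: ent (V i) q)
    (\sum_(q < K) mat p q *: L q).
  apply: mlim_sum => q; have h := mlimMl (mat p q)%:M (VL q).
  rewrite mul_scalar_mx in h; apply: mlim_ext (h _).
  by apply: filterS filterT => i _ /=; rewrite mul_scalar_mx.
have [i [[/= h1 h2] /= h3]] := filter_ex (filterI (filterI (hK _ e40) (VF p _ e40))
  (ultra_large Uinf (maxn K p.+1))).
have [iK ip] : (K <= N_ i)%N /\ (p < N_ i)%N.
  by split; apply: leq_trans (N_ge i); apply: leq_trans h3; rewrite ?leq_maxl ?leq_maxr.
set a := \sum_(q < K) mat p q *: L q in h1 *.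
rewrite ent_sec // in h2.
have E : \sum_(q < N_ i) mat p q *: ent (V i) q =
    \sum_(q < K) mat p q *: ent (V i) q + \sum_(K <= q < N_ i) mat p q *: ent (V i) q.
  by rewrite -!(big_mkord xpredT (fun q => mat p q *: ent (V i) q)) -big_cat_nat.
set b := \sum_(q < K) mat p q *: ent (V i) q in h1 E.
set t := \sum_(K <= q < N_ i) _ in E.
have ht : fn t <= e / 4.
  rewrite fn_le ?(ltW e40) // /t; apply: le_trans (nrm2_lincomb _ _ _) _.
  apply: le_trans (_ : (e / 4) ^+ 2 / (M + 1) * M <= _); last first.
    by rewrite mulrAC ler_pdivrMr // ler_pM2l ?exprn_gt0 // lerDl.
  apply: ler_pM; [|by apply: sumr_ge0 => q _; apply: nrm2_ge0|exact/ltW/h0|].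
    by apply: sumr_ge0 => q _; apply: sqr_ge0.
  apply: le_trans (VM i); apply: le_trans (nrm2_ent_le (V i) (N_ i)).
  rewrite -(big_mkord xpredT (fun p => nrm2 (ent (V i) p))) (big_cat_nat (leq0n K) iK) //=.
  by rewrite lerDr; apply: sumr_ge0 => q _; apply: nrm2_ge0.
have -> : a - F p = - (b - a) + (\sum_(q < N_ i) mat p q *: ent (V i) q - F p) - t.
  by rewrite E opprB addrA; rewrite [_ - _ + (_ + _)]addrA subrK addrAC addrK.
apply: le_lt_trans (fnB _ _) _; apply: le_lt_trans (lerD (fnD _ _) (lexx _)) _.
by rewrite fnN; lra.
Qed.

Hypothesis compactness : forall (N_ : nat -> nat), (forall i, (i <= N_ i)%N) ->
  forall m (V : forall i, 'M[C]_(N_ i, m)) M, (forall i, nrm2 (V i) <= M) ->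
  (forall i, nrm2 (sec (N_ i) *m V i) <= M) -> tight U V.

(** The images under the sections are bounded, so [compactness] makes [V] tight, and the unit norm
    survives in the limit. If mass escaped, the limit could vanish and limits of approximate
    eigenvalues could be spurious. *)
Lemma approx_eig N_ (N_ge : forall i, (i <= N_ i)%N) (V : forall i, 'cV[C]_(N_ i))
    (mu : nat -> C) B :
  (forall i, fn (V i) = 1) -> (forall i, cabs (mu i) <= B) ->
  (forall i, fn (sec (N_ i) *m V i - mu i *: V i) <= i.+1%:R^-1) ->
  exists lam, is_eig lam /\ forall e, 0 < e -> U [set i | cabs (mu i - lam) < e].
Proof.
move=> V1 muB small.
have B0 : 0 <= B by apply: le_trans (muB 0%N); apply: cabs_ge0.
have nV i : nrm2 (V i) <= 1 by rewrite -fn_sqr V1 expr1n.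
have nV' i : nrm2 (V i) <= (B + 1) ^+ 2.
  by apply: le_trans (nV i) _; rewrite exprn_ege1 // lerDr.
have nS i : nrm2 (sec (N_ i) *m V i) <= (B + 1) ^+ 2.
  rewrite -fn_le ?addr_ge0 //.
  rewrite -[X in fn X](subrK (mu i *: V i)); apply: le_trans (fnD _ _) _.
  rewrite addrC lerD ?fnZ ?V1 ?mulr1 //; apply: le_trans (small i) _.
  by rewrite invf_le1 // ler1n.
have tV := compactness N_ge nV' nS.
have [L VL] := plim_ex nV.
have [l0 hl0] : exists l, mlim U (fun i => (mu i)%:M : 'M[C]_1) l.
  apply: (@ultra_mlim _ U UF _ _ _ (B ^+ 2)) => i.
  by rewrite /nrm2 !big_ord1 mxE eqxx mulr1n ler_pXn2r ?nnegrE ?cabs_ge0.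
have l0E : l0 = (l0 0 0)%:M by rewrite -mx11_scalar.
set lam := l0 0 0 in l0E; rewrite l0E in hl0.
exists lam; split; last exact/mlim_scalarP.
have [p Lp] : exists p, L p != 0.
  apply: (@tight_limit_neq0 _ U UF _ _ V L 1 ltr01 tV VL) => i.
  by rewrite V1.
exists L; split; [exact: plim_ell2 nV VL|by exists p|].
have h0 : plim U (fun i => sec (N_ i) *m V i - mu i *: V i) (fun=> 0).
  apply: plim_null => e e0; apply: filterS (ultra_harmonic Uinf e0) => i /=.
  exact: le_lt_trans (small i).
have h1 : plim U (fun i => sec (N_ i) *m V i) (fun p => lam *: L p).
  move=> q; rewrite -[lam *: L q]add0r -mul_mx_scalar.
  apply: mlim_ext (mlimD (h0 q) (plimM VL hl0 q)); apply: filterS filterT => i _ /=.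
  by rewrite entB [ent (V i *m _) q]entM [ent (mu i *: V i) q]entZ mul_mx_scalar subrK.
exact: acts_lim nV VL h1.
Qed.

(** Otherwise there are sizes N >= k, points of [G] and unit vectors with residual at most 1/(k+1);
    by [approx_eig] the points approach an eigenvalue, which keeps a positive distance from [G].
    That distance may depend on the eigenvalue. The set [G] is a point, a closed curve or a disc
    with holes in the applications. *)
Lemma uniform_resolvent (G : C -> Prop) B :
  (forall z, G z -> cabs z <= B) ->
  (forall lam, is_eig lam -> exists2 e, 0 < e & forall z, G z -> e <= cabs (z - lam)) ->
  exists2 c, 0 < c & exists N0, forall N, (N0 <= N)%N -> forall z, G z ->
    forall m (V : 'M[C]_(N, m)), c * fn V <= fn ((sec N - z%:M) *m V).
Proof.
move=> GB Geig.
have [c c0 [N0 h]] : exists2 c, 0 < c & exists N0, forall N, (N0 <= N)%N -> forall z, G z ->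
    forall V : 'cV[C]_N, c * fn V <= fn ((sec N - z%:M) *m V).
  apply: contrapT => /forall2NP neg.
  have /choice[f hf] : forall k : nat, exists x : {N : nat & 'cV[C]_N} * C,
      [/\ (k <= projT1 x.1)%N, G x.2, fn (projT2 x.1) = 1 &
      fn (sec (projT1 x.1) *m projT2 x.1 - x.2 *: projT2 x.1) <= k.+1%:R^-1].
    move=> k; have k0 : 0 < k.+1%:R^-1 :> R by rewrite invr_gt0.
    have [//|/forallNP/(_ k)/existsNP[N /not_implyP[kN]]] := neg k.+1%:R^-1.
    move=> /existsNP[z /not_implyP[Gz]] /existsNP[V /negP]; rewrite -ltNge => hV.
    have V0 : 0 < fn V.
      rewrite lt_def fn_ge0 andbT; apply: contraTneq hV => V0.
      by rewrite V0 mulr0 -leNgt fn_ge0.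
    exists (existT _ N (((fn V)^-1)%:C%C *: V), z); split=> //=.
      by rewrite fnZ cabs_real ger0_norm ?invr_ge0 ?fn_ge0 // mulVf // gt_eqF.
    rewrite scalerA mulrC -scalerA -scalemxAr -scalerBr fnZ cabs_real.
    rewrite ger0_norm ?invr_ge0 ?fn_ge0 // mulrC ler_pdivrMr //.
    by move: hV; rewrite mulmxBl mul_scalar_mx => /ltW.
  have [||||lam [lam_eig lam_lim]] := @approx_eig (fun i => projT1 (f i).1) _
      (fun i => projT2 (f i).1) (fun i => (f i).2) B.
  - by move=> i; have [] := hf i.
  - by move=> i; have [] := hf i.
  - by move=> i; have [_ /GB] := hf i.
  - by move=> i; have [] := hf i.
  have [e e0 he] := Geig _ lam_eig.
  have /filter_ex[i /=] := lam_lim e e0.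
  by have [_ /he] := hf i; rewrite ltNge => ->.
(* The bound for single columns extends to m columns since [nrm2] is additive over columns. *)
exists c => //; exists N0 => N /h{}h z /h{}h m V.
rewrite -(ler_pXn2r (n := 2)) ?nnegrE ?fn_ge0 ?mulr_ge0 ?fn_ge0 ?(ltW c0) //.
rewrite exprMn !fn_sqr [X in _ * X]nrm2_col [leRHS]nrm2_col mulr_sumr.
apply: ler_sum => j _; rewrite -!fn_sqr -exprMn.
rewrite ler_pXn2r ?nnegrE ?fn_ge0 ?mulr_ge0 ?fn_ge0 ?(ltW c0) //.
apply: le_trans (h _) _.
suff -> : (sec N - z%:M) *m col j V = col j ((sec N - z%:M) *m V) by [].
by rewrite !colE mulmxA.
Qed.

Lemma bounded_below_unit N (A : 'M[C]_N) c : 0 < c ->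
  (forall V : 'cV[C]_N, c * fn V <= fn (A *m V)) -> A \in unitmx.
Proof.
move=> c0 h; rewrite -unitmx_tr unitmxE unitfE; apply/negP => /det0P[v v0 vA].
have := h v^T; have -> : A *m v^T = 0 by rewrite -[A]trmxK -trmx_mul vA trmx0.
rewrite fn0 leNgt mulr_gt0 // lt_def fn_ge0 fn_eq0 andbT.
by apply: contra_neq v0 => /(congr1 trmx); rewrite trmxK trmx0.
Qed.

Section Resolvent.
Variables (mu0 : C) (c0 : R) (N0 : nat).
Hypothesis mu0_eig : ~ is_eig mu0.
Hypothesis c0_gt0 : 0 < c0.
Hypothesis lower : forall N, (N0 <= N)%N -> forall m (V : 'M[C]_(N, m)),
  c0 * fn V <= fn ((sec N - mu0%:M) *m V).

Definition solve N : 'M[C]_N := invmx (sec N - mu0%:M).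

Lemma sec_unit N : (N0 <= N)%N -> sec N - mu0%:M \in unitmx.
Proof. by move=> /lower h; apply: bounded_below_unit c0_gt0 _; apply: h. Qed.

Lemma sec_solve N m (V : 'M[C]_(N, m)) : (N0 <= N)%N ->
  sec N *m (solve N *m V) = V + mu0 *: (solve N *m V).
Proof.
move=> /sec_unit u; rewrite /solve -[X in _ = X + _](mulKVmx u) mulmxBl mul_scalar_mx.
by rewrite subrK.
Qed.

Lemma fn_solve N m (V : 'M[C]_(N, m)) : (N0 <= N)%N -> fn (solve N *m V) <= c0^-1 * fn V.
Proof.
move=> h; rewrite ler_pdivlMl //; apply: le_trans (lower h _) _.
by rewrite mulKVmx // sec_unit.
Qed.

(** The difference of two solutions is annihilated by mat - mu0; a column of it with a nonzero entry
    would be an eigenvector for [mu0]. *)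
Lemma solve_uniq m (Y Y' L : nat -> 'rV[C]_m) : ell2 Y -> ell2 Y' ->
  acts Y (fun p => L p + mu0 *: Y p) -> acts Y' (fun p => L p + mu0 *: Y' p) -> Y =1 Y'.
Proof.
move=> Y2 Y2' aY aY' p; apply/eqP; rewrite -subr_eq0; apply: contra_notT mu0_eig => d0.
have [j dj] : exists j, (Y p - Y' p) 0 j != 0.
  apply: contrapT => /forallNP h; case/eqP: d0; apply/rowP => j; rewrite [RHS]mxE.
  by apply/eqP; rewrite -[_ == _]negbK; apply/negP/h.
pose b : 'cV[C]_m := delta_mx j 0.
exists (fun p => (Y p - Y' p) *m b); split; first exact/ell2_mulr/ell2B.
- exists p; apply: contra_neq dj => /(congr1 (fun M : 'M[C]_(1, 1) => M 0 0)).
  rewrite -colE !mxE //.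
- apply: acts_ext (acts_mulr b (actsB aY aY')) => // q.
  by rewrite opprD addrACA subrr add0r -scalerBr scalemxAl.
Qed.

(** Collective compactness of the inverses: [solve V] is bounded by [lower], and so is its image V +
    mu0 solve V under the section, hence [compactness] applies. Weakly convergent data thus have
    tight solutions, whose limit solves the limiting equation by [acts_lim]. *)
Lemma solve_lim N_ (N_ge : forall i, (i <= N_ i)%N) (N_ge0 : forall i, (N0 <= N_ i)%N)
    m (V : forall i, 'M[C]_(N_ i, m)) L M :
  (forall i, nrm2 (V i) <= M) -> plim U V L ->
  tight U (fun i => solve (N_ i) *m V i) /\
  exists Y, [/\ plim U (fun i => solve (N_ i) *m V i) Y, ell2 Y &
    acts Y (fun p => L p + mu0 *: Y p)].
Proof.
move=> VM VL; have M0 : 0 <= M by apply: le_trans (VM 0%N); apply: nrm2_ge0.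
pose M1 := c0^-2 * M.
have c2 : 0 <= c0^-2 by rewrite invr_ge0 sqr_ge0.
have SV i : nrm2 (solve (N_ i) *m V i) <= M1.
  rewrite -fn_sqr /M1; apply: le_trans (_ : (c0^-1 * fn (V i)) ^+ 2 <= _).
    by rewrite ler_pXn2r ?nnegrE ?fn_ge0 ?mulr_ge0 ?invr_ge0 ?fn_ge0 ?(ltW c0_gt0) // fn_solve.
  by rewrite exprMn exprVn fn_sqr ler_wpM2l.
have M10 : 0 <= M1 by rewrite mulr_ge0.
pose M2 := (M + cabs mu0 ^+ 2 * M1) *+ 2 + M1.
have h0 : 0 <= cabs mu0 ^+ 2 * M1 by rewrite mulr_ge0 // sqr_ge0.
have SV2 i : nrm2 (solve (N_ i) *m V i) <= M2.
  by apply: le_trans (SV i) _; rewrite /M2 lerDr mulrn_wge0 // addr_ge0.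
have sSV i : nrm2 (sec (N_ i) *m (solve (N_ i) *m V i)) <= M2.
  rewrite sec_solve //; apply: le_trans (nrm2D _ _) _.
  rewrite /M2 ler_wpDr // lerMn2r /= nrm2Z lerD // ler_wpM2l ?sqr_ge0 //.
split; first exact: compactness N_ge _ _ _ SV2 sSV.
have [Y SY] := plim_ex SV; exists Y; split=> //; first exact: plim_ell2 SV SY.
apply: (acts_lim N_ge SV SY) => p.
rewrite -[mu0 *: Y p]mul_scalar_mx.
apply: mlim_ext (mlimD (VL p) (mlimMl mu0%:M (SY p))); apply: filterS filterT => i _ /=.
by rewrite sec_solve // entD entZ mul_scalar_mx.
Qed.

End Resolvent.
End InfiniteMatrix.

(** * Orthonormal invariant families from a partial Schur form *)

Section PartialSchur.
Variable R : realType.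
Local Notation C := (R[i]).
Local Open Scope sesquilinear_scope.

Lemma char_poly_tr (F : fieldType) n (A : 'M[F]_n) : char_poly A^T = char_poly A.
Proof.
rewrite /char_poly -[RHS]det_tr; congr (\det _); apply/matrixP => i j.
by rewrite !mxE eq_sym.
Qed.

(** The leading m rows of a lower triangular Schur form span an invariant space. Applying
    [schur_ordered] to the transpose turns rows into columns, which makes [T] upper triangular. *)
Lemma schur_part N (A : 'M[C]_N) m (s : seq C) :
  char_poly A = \prod_(z <- s) ('X - z%:P) -> (m <= N)%N ->
  exists (V : 'M[C]_(N, m)) (T : 'M[C]_m), [/\ V ^t* *m V = 1%:M, A *m V = V *m T,
    is_trig_mx T^T & forall i, T i i = nth 0 s i].
Proof.
rewrite -char_poly_tr => /schur_ordered[P [T [uP PT tT dT]]] mN.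
pose w := widen_ord mN.
exists (\matrix_(i, j) P (w j) i), (\matrix_(i, j) T (w j) (w i)); split.
- apply/matrixP => i j; have /unitarymxP/matrixP/(_ (w j) (w i)) := uP.
  rewrite !mxE -!val_eqE /= [(j == i :> nat)%N]eq_sym => <-.
  by apply: eq_bigr => k _; rewrite !mxE mulrC.
- apply/matrixP => i j; have /matrixP/(_ (w j) i) := PT; rewrite !mxE => E.
  transitivity (\sum_j0 P (w j) j0 * A^T j0 i).
    by apply: eq_bigr => k _; rewrite !mxE mulrC.
  rewrite E (bigID (fun k : 'I_N => (k < m)%N)) /= [X in _ + X]big1 ?addr0 => [|k]; last first.
    by rewrite -leqNgt => mk; rewrite (is_trig_mxP tT) ?mul0r //= (leq_trans _ mk).
  rewrite (big_ord_narrow mN); apply: eq_bigr => k _; rewrite !mxE mulrC.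
  by congr (P _ _ * T _ _); apply/val_inj.
- by apply/is_trig_mxP => i j ij; rewrite !mxE (is_trig_mxP tT).
- by move=> i; rewrite !mxE dT.
Qed.

Lemma orth_col N m (V : 'M[C]_(N, m)) j : V ^t* *m V = 1%:M -> nrm2 (col j V) = 1.
Proof.
by move=> V1; rewrite colE nrm2_orth // /nrm2 exchange_big big_ord1 (bigD1 j) //= big1 =>
  [|i ij]; rewrite !mxE ?eqxx ?(negbTE ij) ?cabs1 ?cabs0 ?expr1n ?expr0n ?addr0.
Qed.

Lemma diag_colE N m (V : 'M[C]_(N, m)) (M : 'M[C]_N) j :
  (V ^t* *m (M *m V)) j j = ((col j V) ^t* *m (M *m col j V)) 0 0.
Proof.
have -> : M *m col j V = col j (M *m V) by rewrite !colE mulmxA.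
by rewrite !mxE; apply: eq_bigr => k _; rewrite !mxE.
Qed.

Lemma diag_entry_le N m (V : 'M[C]_(N, m)) (M : 'M[C]_N) j : V ^t* *m V = 1%:M ->
  cabs ((V ^t* *m (M *m V)) j j) <= fn M.
Proof.
move=> V1; rewrite diag_colE; set v := col j V.
have v1 : fn v = 1 by rewrite /fn orth_col // sqrtr1.
apply: le_trans (cabs_entry _ _ _) _; apply: le_trans (fnM _ _) _.
rewrite {1}/fn nrm2_adj -/(fn v) v1 mul1r.
by apply: le_trans (fnM _ _) _; rewrite v1 mulr1.
Qed.

Lemma root_char_nonunit N (A : 'M[C]_N) w : root (char_poly A) w -> w%:M - A \notin unitmx.
Proof.
rewrite -eigenvalue_root_char => /eigenvalueP[v vA v0]; apply: contra_neqN v0 => u.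
by rewrite -[v](mulmxK u) mulmxBr mul_mx_scalar vA subrr mul0mx.
Qed.

Lemma eigenvalue_colP N (A : 'M[C]_N) w : root (char_poly A) w ->
  exists2 c : 'cV[C]_N, c != 0 & A *m c = w *: c.
Proof.
rewrite -char_poly_tr -eigenvalue_root_char => /eigenvalueP[v vA v0].
exists v^T; first by apply: contra_neq v0 => /(congr1 trmx); rewrite trmxK trmx0.
by rewrite -[A]trmxK -trmx_mul vA linearZ.
Qed.

End PartialSchur.

(** * Invariant families of the infinite matrix as exact invariant families of perturbed inverses *)

Section InvariantFamilies.
Variable R : realType.
Local Notation C := (R[i]).
Local Open Scope sesquilinear_scope.
Variable mat : nat -> nat -> C.
Hypothesis mat_row : forall p, exists M, forall K, \sum_(q < K) cabs (mat p q) ^+ 2 <= M.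
Context (U : set_system nat) {UF : UltraFilter U}.
Hypothesis Uinf : \oo `<=` U.
Hypothesis compactness : forall (N_ : nat -> nat), (forall i, (i <= N_ i)%N) ->
  forall m (V : forall i, 'M[C]_(N_ i, m)) M, (forall i, nrm2 (V i) <= M) ->
  (forall i, nrm2 (sec mat (N_ i) *m V i) <= M) -> tight U V.
Variables (mu0 : C) (c0 : R) (N0 : nat).
Hypothesis mu0_eig : ~ is_eig mat mu0.
Hypothesis c0_gt0 : 0 < c0.
Hypothesis lower : forall N, (N0 <= N)%N -> forall m (V : 'M[C]_(N, m)),
  c0 * fn V <= fn ((sec mat N - mu0%:M) *m V).

Local Notation sec := (sec mat).
Local Notation acts := (acts mat).
Local Notation is_eig := (is_eig mat).
Local Notation solve := (solve mat mu0).

(* An orthonormal family much longer than k contains a vector with almost no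
   mass on the first k coordinates, and solve maps such vectors to small ones. *)
Lemma diag_bound s0 : 0 < s0 -> exists mmax N1, forall N, (N1 <= N)%N ->
  forall m (V : 'M[C]_(N, m)), V ^t* *m V = 1%:M ->
  (forall j, s0 <= cabs ((V ^t* *m (solve N *m V)) j j)) -> (m <= mmax)%N.
Proof.
move=> s00; apply: contrapT => /forallNP neg.
have /choice[f hf] : forall k : nat, exists x : {N : nat & 'cV[C]_N},
    [/\ (k <= projT1 x)%N, (N0 <= projT1 x)%N, fn (projT2 x) = 1,
     forall p, (p < k)%N -> nrm2 (ent (projT2 x) p) <= k.+1%:R^-1 &
     s0 <= fn (solve (projT1 x) *m projT2 x)].
  (* Each row of [V] has norm at most 1, so the first k coordinates carry total mass at most k.
     Among more than k (k + 1) columns, one carries at most 1/(k + 1) of it. *)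
  move=> k; have /forallNP/(_ (maxn k N0))/existsNP[N] := neg (k * k.+1)%N.
  move=> /not_implyP[kN] /existsNP[m] /existsNP[V] /not_implyP[V1] /not_implyP[Vs].
  rewrite geq_max in kN; case/andP: kN => kN N0N.
  move=> /negP; rewrite -ltnNge => hm.
  have [j hj] : exists j, \sum_(p < k) nrm2 (ent (col j V) p) <= k.+1%:R^-1.
    apply: contrapT => /forallNP hj.
    have : \sum_(p < k) nrm2 (ent V p) <= k%:R.
      apply: le_trans (_ : \sum_(p < k) 1 <= _); last by rewrite sumr_const card_ord.
      apply: ler_sum => p _; rewrite /ent; case: insubP => [i _ _|_]; last by rewrite nrm20.
      exact: nrm2_row_orth.
    apply/negP; rewrite -ltNge.
    have -> : \sum_(p < k) nrm2 (ent V p) = \sum_j \sum_(p < k) nrm2 (ent (col j V) p).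
      rewrite [RHS]exchange_big /=; apply: eq_bigr => p _; rewrite [LHS]nrm2_col.
      by apply: eq_bigr => j _; rewrite [col j V]colE entM -colE.
    apply: (@lt_le_trans _ _ (m%:R * k.+1%:R^-1)).
      by rewrite ltr_pdivlMr // -natrM ltr_nat.
    rewrite mulr_natl -[m in _ *+ m]card_ord -sumr_const; apply: ler_sum => j _.
    by have /negP := hj j; rewrite -ltNge => /ltW.
  have nv : fn (col j V) = 1 by rewrite /fn orth_col // sqrtr1.
  exists (existT _ N (col j V)); split=> //=.
    move=> p pk; apply: le_trans hj; rewrite (bigD1 (Ordinal pk)) //= lerDl.
    by apply: sumr_ge0 => q _; apply: nrm2_ge0.
  apply: le_trans (Vs j) _; rewrite diag_colE.
  apply: le_trans (cabs_entry _ _ _) _; apply: le_trans (fnM _ _) _.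
  by rewrite {1}/fn nrm2_adj -/(fn (col j V)) nv mul1r.
pose N_ i := projT1 (f i); pose V i := projT2 (f i).
have N_ge i : (i <= N_ i)%N by have [] := hf i.
have N_ge0 i : (N0 <= N_ i)%N by have [] := hf i.
have V1 i : nrm2 (V i) <= 1.
  by have [_ _ h _ _] := hf i; rewrite -fn_sqr h expr1n.
have V0 : plim U V (fun=> 0).
  move=> p e e0; have e20 : 0 < e ^+ 2 by rewrite exprn_gt0.
  apply: filterS2 (ultra_large Uinf p.+1) (ultra_harmonic Uinf e20) => i /= pi hi.
  rewrite subr0 fn_lt; last exact: ltW.
  by have [_ _ _ h _] := hf i; apply: le_lt_trans (h p pi) hi.
have [tS [Y [SY Y2 aY]]] := solve_lim mat_row Uinf compactness c0_gt0 lower N_ge N_ge0 V1 V0.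
have Y0 : Y =1 (fun=> 0).
  apply: (solve_uniq mu0_eig Y2 _ aY) => /=.
    by exists 0 => K; rewrite big1 // => i _; apply: nrm20.
  move=> p; rewrite scaler0 addr0; apply: mlim_ext (mlim_cst (0 : 'rV[C]_1)).
  by apply: filterS filterT => K _ /=; rewrite big1 // => q _; rewrite scaler0.
have SY0 : plim U (fun i => solve (N_ i) *m V i) (fun=> 0).
  by move=> p; have := SY p; rewrite Y0.
have /filter_ex[i /=] : U [set i | fn (solve (N_ i) *m V i) < s0].
  exact: tight_plim0 tS SY0 _ s00.
by have [_ _ _ _ h] := hf i; rewrite ltNge h.
Qed.

Definition indep m (L : nat -> 'rV[C]_m) : Prop :=
  forall c : 'cV[C]_m, (forall p, L p *m c = 0) -> c = 0.

(** The ranks of the truncations are bounded by m; after a truncation of maximal rank no further row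
    leaves its row space. The boolean form of the predicate serves [ex_maxnP]. *)
Lemma rank_stab m (L : nat -> 'rV[C]_m) : exists N1, forall p, (L p <= trunc L N1)%MS.
Proof.
have ex : exists r, [exists k : 'I_m.+1, (k == r :> nat)] && `[< exists N, \rank (trunc L N) = r >].
  exists (\rank (trunc L 0)); apply/andP; split; last by apply/asboolP; exists 0%N.
  by apply/existsP; exists (Ordinal (rank_leq_col (trunc L 0) : _ < m.+1)%N).
have ub r : [exists k : 'I_m.+1, (k == r :> nat)] && `[< exists N, \rank (trunc L N) = r >] ->
    (r <= m)%N.
  by move=> /andP[/existsP[k /eqP <-] _]; rewrite -ltnS.
have [r /andP[_ /asboolP[N1 rN1]] rmax] := ex_maxnP ex ub.
exists N1 => p; have [pN|Np] := ltnP p N1.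
  by rewrite -(rowK (fun i : 'I_N1 => L i) (Ordinal pN)) row_sub.
have sub : (trunc L N1 <= trunc L p.+1)%MS.
  apply/row_subP => i; rewrite rowK.
  have ip : (i < p.+1)%N by rewrite ltnS (leq_trans _ Np) // ltnW.
  by rewrite -[L i](rowK (fun i : 'I_p.+1 => L i) (Ordinal ip)) row_sub.
have rle : (\rank (trunc L p.+1) <= \rank (trunc L N1))%N.
  rewrite rN1; apply: rmax; apply/andP; split; last by apply/asboolP; exists p.+1.
  by apply/existsP; exists (Ordinal (rank_leq_col (trunc L p.+1) : _ < m.+1)%N).
have req : \rank (trunc L N1) == \rank (trunc L p.+1).
  by rewrite eqn_leq rle mxrankS.
move: req; rewrite (mxrank_leqif_eq sub) => /eqmxP/eqmx_sym e.
rewrite -e -[L p](rowK (fun i : 'I_p.+1 => L i) ord_max); exact: row_sub.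
Qed.

(** A column killed by the truncation at which the rank stabilizes is killed by every row, so
    independence of the infinite family makes a finite truncation injective. *)
Lemma indep_left_inv m (L : nat -> 'rV[C]_m) : indep L ->
  exists N1 (Z : 'M[C]_(m, N1)), Z *m trunc L N1 = 1%:M.
Proof.
move=> iL; have [N1 h] := rank_stab L; exists N1; apply/row_fullP.
rewrite -cokermx_eq0; apply/eqP/matrixP => i j.
suff /colP/(_ i) : col j (cokermx (trunc L N1)) = 0 by rewrite !mxE.
apply: iL => p; have /submxP[D ->] := h p.
by rewrite -mulmxA colE [trunc L N1 *m _]mulmxA mulmx_coker mul0mx mulmx0.
Qed.

Lemma eig_of_col m (L : nat -> 'rV[C]_m) (B : 'M[C]_m) (c : 'cV[C]_m) lam :
  ell2 L -> indep L -> acts L (fun p => L p *m B) -> c != 0 -> B *m c = lam *: c ->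
  is_eig lam.
Proof.
move=> L2 iL aL c0' Bc; exists (fun p => L p *m c); split; first exact: ell2_mulr.
  apply: contrapT => /forallNP h; case/eqP: c0'; apply: iL => p.
  by apply/eqP; have /negP := h p; rewrite negbK.
apply: acts_ext (acts_mulr c aL) => // p.
by rewrite -mulmxA Bc scalemxAr.
Qed.

(** Inverting mat - mu0 maps the invariant family [L] to [L] times (B - mu0)^-1. This is the error
    of that identity when both sides are replaced by their truncations. *)
Definition defect m (L : nat -> 'rV[C]_m) (B : 'M[C]_m) N : 'M[C]_(N, m) :=
  solve N *m trunc L N - trunc L N *m invmx (B - mu0%:M).

Section OneFamily.
Variables (m : nat) (L : nat -> 'rV[C]_m) (B : 'M[C]_m).
Hypothesis L2 : ell2 L.
Hypothesis iL : indep L.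
Hypothesis aL : acts L (fun p => L p *m B).

Lemma shift_unit : B - mu0%:M \in unitmx.
Proof.
apply: contraT => nu; exfalso; apply: mu0_eig.
have : ~~ (-1 *: (mu0%:M - B) \in unitmx) by rewrite scaleN1r opprB.
have [sB hB] := char_poly_roots (B - mu0%:M).
have r0 : root (char_poly (B - mu0%:M)) 0.
  rewrite /root horner_coef0 char_poly_det mulf_eq0 signr_eq0 /=.
  by move: nu; rewrite unitmxE unitfE negbK.
have [c cn0 hc] := eigenvalue_colP r0 => _.
apply: (eig_of_col L2 iL aL cn0); apply/eqP.
by rewrite -subr_eq0 -mul_scalar_mx -mulmxBl hc scale0r.
Qed.

(** Compactness only gives smallness along the ultrafilter. Choosing a bad size N >= k for every k
    and applying it to these sizes yields smallness for all large N. *)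
Lemma defect_small e : 0 < e -> exists N1, forall N, (N1 <= N)%N -> fn (defect L B N) < e.
Proof.
move=> e0; apply: contrapT => /forallNP neg.
have /choice[N_ hN] : forall k : nat, exists N, [/\ (k <= N)%N, (N0 <= N)%N & e <= fn (defect L B N)].
  move=> k; have /existsNP[N /not_implyP[]] := neg (maxn k N0).
  by rewrite geq_max => /andP[? ?] /negP; rewrite -leNgt; exists N.
have N_ge i : (i <= N_ i)%N by have [] := hN i.
have N_ge0 i : (N0 <= N_ i)%N by have [] := hN i.
have [M LM] := L2.
have VM i : nrm2 (trunc L (N_ i)) <= M by rewrite nrm2_trunc.
have VL := @plim_trunc _ U UF Uinf N_ N_ge m L.
have [tS [Y [SY Y2 aY]]] := solve_lim mat_row Uinf compactness c0_gt0 lower N_ge N_ge0 VM VL.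
pose a := invmx (B - mu0%:M).
have YE : Y =1 (fun p => L p *m a).
  apply: (solve_uniq mu0_eig Y2 (ell2_mulr a L2) aY).
  apply: acts_ext (acts_mulr a aL) => // p.
  have -> : B = (B - mu0%:M) + mu0%:M by rewrite subrK.
  by rewrite mulmxDr mulmxDl mulmxK ?shift_unit // mul_mx_scalar scalemxAl.
have d0 : plim U (fun i => defect L B (N_ i)) (fun=> 0).
  move=> p; rewrite -(subrr (Y p)) {2}YE.
  exact: (plimB SY (plimMr a VL)).
have td : tight U (fun i => defect L B (N_ i)).
  rewrite /defect; have h : tight U (fun i => trunc L (N_ i) *m (- a)).
    by apply: (tightM (B := fun=> - a) (M := nrm2 (- a))) => //; apply: tight_trunc.
  have -> : (fun i => solve (N_ i) *m trunc L (N_ i) - trunc L (N_ i) *m invmx (B - mu0%:M)) =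
      (fun i => solve (N_ i) *m trunc L (N_ i) + trunc L (N_ i) *m (- a)).
    by apply/functional_extensionality_dep => i; rewrite mulmxN.
  exact: tightD tS h.
have /filter_ex[i /=] : U [set i | fn (defect L B (N_ i)) < e].
  exact: tight_plim0 td d0 _ e0.
by have [_ _ h] := hN i; rewrite ltNge h.
Qed.

(** A left inverse of a finite truncation, padded with zero columns, is a left inverse of every
    longer truncation with a norm independent of N. Subtracting [defect] times it from [solve N]
    makes the truncated family exactly invariant. *)
Lemma exact_perturbation : exists (K : R) (N1 : nat), 0 < K /\
  forall N, (N1 <= N)%N -> exists Z : 'M[C]_(m, N),
    [/\ fn Z <= K, Z *m trunc L N = 1%:M &
     (solve N - defect L B N *m Z) *m trunc L N = trunc L N *m invmx (B - mu0%:M)].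
Proof.
have [N1 [Z ZL]] := indep_left_inv iL.
(* The square root bounds the Frobenius norm of the restriction to the first N1 coordinates; the
   summand 1 makes the bound positive. *)
exists (fn Z * Num.sqrt N1%:R + 1), N1; split.
  by rewrite ltr_wpDl // mulr_ge0 ?fn_ge0 ?sqrtr_ge0.
move=> N N1N; pose P : 'M[C]_(N1, N) := \matrix_(i, j) (i == j :> nat)%:R.
have PL : P *m trunc L N = trunc L N1.
  apply/matrixP => i j; rewrite !mxE (bigD1 (widen_ord N1N i)) //= big1 => [|k ki].
    by rewrite !mxE eqxx mul1r addr0.
  rewrite !mxE; have -> : (i == k :> nat) = false; last by rewrite mul0r.
  by apply: contraNF ki => /eqP ik; apply/eqP/val_inj.
have nP : nrm2 P <= N1%:R.
  rewrite -[N1 in leRHS]card_ord -sumr_const; apply: ler_sum => i _.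
  rewrite (bigD1 (widen_ord N1N i)) //= big1 => [|k ki].
    by rewrite !mxE eqxx cabs1 expr1n addr0.
  rewrite !mxE; have -> : (i == k :> nat) = false; last by rewrite cabs0 expr0n.
  by apply: contraNF ki => /eqP ik; apply/eqP/val_inj.
have ZPL : Z *m P *m trunc L N = 1%:M by rewrite -mulmxA PL.
exists (Z *m P); split=> //.
  apply: le_trans (fnM _ _) _; rewrite ler_wpDr // ler_wpM2l ?fn_ge0 //.
  by rewrite ler_sqrt ?ler0n.
by rewrite mulmxBl -[_ *m _ *m trunc L N]mulmxA ZPL mulmx1 /defect opprB addrC subrK.
Qed.

Lemma roots_a (s : seq C) : char_poly B = \prod_(z <- s) ('X - z%:P) ->
  char_poly (invmx (B - mu0%:M)) = \prod_(z <- [seq (z - mu0)^-1 | z <- s]) ('X - z%:P).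
Proof.
by move=> /(char_poly_shift mu0)/char_poly_inv/(_ shift_unit); rewrite -map_comp.
Qed.

Lemma perturbed_roots N (Z : 'M[C]_(m, N)) (s : seq C) :
  Z *m trunc L N = 1%:M ->
  (solve N - defect L B N *m Z) *m trunc L N = trunc L N *m invmx (B - mu0%:M) ->
  char_poly B = \prod_(z <- s) ('X - z%:P) ->
  exists t, char_poly (solve N - defect L B N *m Z) =
    \prod_(z <- [seq (z - mu0)^-1 | z <- s] ++ t) ('X - z%:P).
Proof.
move=> ZL FL charB; set F := solve N - _ in FL *.
have u : invmx (B - mu0%:M) \in unitmx by rewrite unitmx_inv shift_unit.
have /dvdpP[q charF] := char_poly_invariant FL ZL u.
have [t qE] := closed_field_poly_normal q.
exists t; rewrite big_cat /= -(roots_a charB) charF mulrC; congr (_ * _).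
rewrite {1}qE; suff -> : lead_coef q = 1 by rewrite scale1r.
have := monicP (char_poly_monic F); rewrite charF lead_coefM.
by rewrite (monicP (char_poly_monic _)) mulr1.
Qed.

End OneFamily.

(** Take the first m Schur vectors of the perturbed inverse: its diagonal entries there are (z -
    mu0)^-1 with z a root for [B], hence bounded below, and those of [solve N] differ little.
    [diag_bound] then limits m. This one bound yields both the finiteness of the set of eigenvalues
    in a disc and that of their multiplicities. *)
Lemma family_bound Rb : 0 <= Rb -> exists mmax, forall m (L : nat -> 'rV[C]_m) (B : 'M[C]_m),
  ell2 L -> indep L -> acts L (fun p => L p *m B) ->
  (forall z, root (char_poly B) z -> cabs z <= Rb) -> (m <= mmax)%N.
Proof.
(* [D] bounds |z - mu0| for all roots z, so the diagonal entries are at least 1/D; the perturbation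
   may consume half of this. *)
move=> Rb0; pose D := Rb + cabs mu0 + 1.
have D0 : 0 < D by rewrite ltr_wpDl // addr_ge0 ?cabs_ge0.
pose s0 := D^-1 / 2; have s00 : 0 < s0 by rewrite divr_gt0 ?invr_gt0.
have [mmax [N1 hN1]] := diag_bound s00; exists mmax => m L B L2 iL aL Broots.
have [K [N2 [K0 hN2]]] := exact_perturbation B iL.
have [N3 hN3] := defect_small L2 iL aL (divr_gt0 s00 K0).
pose N := maxn N1 (maxn N2 N3).
have N1N : (N1 <= N)%N by rewrite leq_maxl.
have N2N : (N2 <= N)%N by rewrite /N maxnCA leq_maxl.
have N3N : (N3 <= N)%N by rewrite /N maxnA leq_maxr.
have [Z [nZ ZL FL]] := hN2 N N2N; have {hN3} nE := hN3 N N3N.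
have [s charB] := char_poly_roots B.
have [t charF] := perturbed_roots L2 iL aL ZL FL charB.
have szs := size_char_roots charB.
have mN : (m <= N)%N.
  by have := size_char_roots charF; rewrite size_cat size_map szs => <-; rewrite leq_addr.
have [V [T [V1 FV Tt Td]]] := schur_part charF mN.
apply: (hN1 N N1N m V V1) => j.
set E := defect L B N *m Z in FV *.
have -> : solve N = (solve N - E) + E by rewrite subrK.
rewrite mulmxDl mulmxDr FV mulmxA V1 mul1mx mxE Td nth_cat size_map szs ltn_ord.
rewrite (nth_map 0) ?szs //; set z := nth 0 s j.
have zr : root (char_poly B) z.
  by rewrite charB root_prod_XsubC mem_nth // szs.
have hz : D^-1 <= cabs (z - mu0)^-1.
  have zm : z - mu0 != 0.
    rewrite subr_eq0; apply/eqP => zm; apply: mu0_eig.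
    by have [c c0' Bc] := eigenvalue_colP zr; rewrite -zm; apply: (eig_of_col L2 iL aL c0').
  rewrite cabsV lef_pV2 ?posrE ?cabs_gt0 //.
  apply: le_trans (cabsB _ _) _; have := Broots z zr; rewrite /D => h.
  by have := cabs_ge0 mu0; lra.
have hE : cabs ((V ^t* *m (E *m V)) j j) <= s0.
  apply: le_trans (diag_entry_le _ _ V1) _; apply: le_trans (fnM _ _) _.
  rewrite -[leRHS](divfK (lt0r_neq0 K0)); apply: ler_pM; rewrite ?fn_ge0 //; exact: ltW.
have := cabs_lerB ((z - mu0)^-1) (- (V ^t* *m (E *m V)) j j); rewrite opprK cabsN.
by rewrite /s0 in hE *; move=> *; lra.
Qed.

End InvariantFamilies.

(** * Families of eigenvectors and of generalized eigenvectors *)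

Section SpectralConvergence.
Variable R : realType.
Local Notation C := (R[i]).
Local Open Scope sesquilinear_scope.
Variable mat : nat -> nat -> C.

(** The operator mat - lam sends [ch l] to [ch l.+1]. Chains are indexed by all naturals and vanish
    from some length on, so that chains of different lengths can be stored in one rectangular
    array. *)
Definition gen_eig (lam : C) (u : nat -> 'rV[C]_1) : Prop :=
  exists ch : nat -> nat -> 'rV[C]_1, [/\ ch 0%N = u, forall l, ell2 (ch l),
    forall l, acts mat (ch l) (fun p => ch l.+1 p + lam *: ch l p) &
    exists len, forall l p, (len <= l)%N -> ch l p = 0].

Definition indep_cols m (us : 'I_m -> nat -> 'rV[C]_1) : Prop :=
  forall c : 'I_m -> C, (forall p, \sum_i c i *: us i p = 0) -> forall i, c i = 0.

Hypothesis mat_row : forall p, exists M, forall K, \sum_(q < K) cabs (mat p q) ^+ 2 <= M.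
Context (U : set_system nat) {UF : UltraFilter U}.
Hypothesis Uinf : \oo `<=` U.
Hypothesis compactness : forall (N_ : nat -> nat), (forall i, (i <= N_ i)%N) ->
  forall m (V : forall i, 'M[C]_(N_ i, m)) M, (forall i, nrm2 (V i) <= M) ->
  (forall i, nrm2 (sec mat (N_ i) *m V i) <= M) -> tight U V.
Variables (mu0 : C) (c0 : R) (N0 : nat).
Hypothesis mu0_eig : ~ is_eig mat mu0.
Hypothesis c0_gt0 : 0 < c0.
Hypothesis lower : forall N, (N0 <= N)%N -> forall m (V : 'M[C]_(N, m)),
  c0 * fn V <= fn ((sec mat N - mu0%:M) *m V).

Local Notation sec := (sec mat).
Local Notation acts := (acts mat).
Local Notation is_eig := (is_eig mat).
Local Notation solve := (solve mat mu0).

Definition cols m (us : 'I_m -> nat -> 'rV[C]_1) (p : nat) : 'rV[C]_m :=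
  \row_j us j p 0 0.

Lemma cols_mul m (us : 'I_m -> nat -> 'rV[C]_1) (c : 'cV[C]_m) p :
  cols us p *m c = \sum_j c j 0 *: us j p.
Proof.
apply/matrixP => a b; rewrite !ord1 !mxE summxE; apply: eq_bigr => j _.
by rewrite !mxE mulrC.
Qed.

Lemma ell2_cols m (us : 'I_m -> nat -> 'rV[C]_1) :
  (forall j, ell2 (us j)) -> ell2 (cols us).
Proof.
move=> /choice[M hM]; exists (\sum_j M j) => K.
have E p : nrm2 (cols us p) = \sum_j nrm2 (us j p).
  rewrite /nrm2 big_ord1; apply: eq_bigr => j _.
  by rewrite !big_ord1 !mxE.
under eq_bigr do rewrite E.
rewrite exchange_big /=.
by apply: ler_sum => j _; apply: hM.
Qed.

Lemma acts_cols m (us fs : 'I_m -> nat -> 'rV[C]_1) :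
  (forall j, acts (us j) (fs j)) -> acts (cols us) (cols fs).
Proof.
move=> h p; apply/mlim_tail => i j; rewrite ord1 mxE.
have /mlim_tail/(_ 0 0) := h j p; apply: mlim_ext.
apply: filterS filterT => K _ /=; congr (_%:M).
by rewrite !summxE; apply: eq_bigr => q _; rewrite !mxE.
Qed.

Lemma indep_colsP m (us : 'I_m -> nat -> 'rV[C]_1) : indep_cols us <-> indep (cols us).
Proof.
split=> h c hc.
  apply/colP => j; rewrite [RHS]mxE; apply: (h (fun j => c j 0)) => p.
  by rewrite -cols_mul.
move=> i; have : \col_j c j = 0.
  apply: h => p; rewrite cols_mul -[RHS](hc p).
  by apply: eq_bigr => j _; rewrite mxE.
by move=> /colP/(_ i); rewrite !mxE.
Qed.

(** Induction on the support of a linear relation c: applying the matrix and subtracting a multiple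
    of c gives the relation (D - es_j0) c, in which the term j0 is gone; distinctness of the
    eigenvalues then leaves only that term in c. *)
Lemma distinct_eig_indep (es : seq C) : uniq es ->
  (forall z, z \in es -> is_eig z) ->
  exists (L : nat -> 'rV[C]_(size es)), [/\ ell2 L, indep L &
    acts L (fun p => L p *m diag_mx (\row_j nth 0 es j))].
Proof.
move=> ues eig; pose m := size es.
have /choice[us hus] (j : 'I_m) : exists u : nat -> 'rV[C]_1,
    [/\ ell2 u, exists p, u p != 0 & acts u (fun p => es`_j *: u p)].
  exact/eig/mem_nth.
pose L := cols us; pose D : 'M[C]_m := diag_mx (\row_j nth 0 es j).
have aL : acts L (fun p => L p *m D).
  have h j : acts (us j) (fun p => es`_j *: us j p) by have [] := hus j.
  apply: acts_ext (acts_cols h) => // p; apply/rowP => j.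
  by rewrite !mxE (bigD1 j) //= big1 ?addr0 => [|k kj]; rewrite !mxE ?eqxx ?(negbTE kj) ?mulr0 // mulr1n mulrC.
exists L; split=> //; first by apply: ell2_cols => j; have [] := hus j.
have ker (c : 'cV[C]_m) : (forall p, L p *m c = 0) -> forall p, L p *m (D *m c) = 0.
  move=> hc p; rewrite mulmxA; apply: (acts_uniq (F' := fun=> 0) (acts_mulr c aL)) => q /=.
  apply: mlim_ext (mlim_cst 0); apply: filterS filterT => K _ /=.
  by rewrite big1 // => k _; rewrite hc scaler0.
have DE (c : 'cV[C]_m) z j : (D *m c - z *: c) j 0 = (es`_j - z) * c j 0.
  by rewrite mul_diag_mx !mxE mulrBl.
suff main k (c : 'cV[C]_m) : (#|[pred j | (c j 0 != 0)%R]| <= k)%N ->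
    (forall p, L p *m c = 0) -> c = 0.
  by move=> c hc; apply: (main _ c (leqnn _) hc).
elim: k c => [|k IH] c ck hc.
  apply/colP => j; rewrite mxE; apply/eqP; apply: contraTT ck => cj.
  by rewrite -ltnNge; apply/card_gt0P; exists j; rewrite inE.
apply/eqP; apply: contraT => /cV0Pn[j0 cj0].
have cpt : (#|[pred j | ((D *m c - es`_j0 *: c) j 0%R != 0)%R]| <= k)%N.
  rewrite -ltnS; apply: leq_trans ck; apply: proper_card; apply/properP; split.
    apply/fintype.subsetP => j; rewrite !inE; apply: contra_neq => cj.
    by rewrite DE cj mulr0.
  by exists j0; rewrite !inE // DE subrr mul0r eqxx.
have Dc0 : D *m c - es`_j0 *: c = 0.
  by apply: IH cpt _ => p; rewrite mulmxBr ker // -scalemxAr hc scaler0 subrr.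
have cE j : j != j0 -> c j 0 = 0.
  move=> jj; have /colP/(_ j) := Dc0; rewrite DE mxE => /eqP.
  by rewrite mulf_eq0 subr_eq0 nth_uniq // val_eqE (negbTE jj) => /eqP.
have [_ [p up] _] := hus j0; case/eqP: up.
have := hc p; rewrite cols_mul (bigD1 j0) //= big1 ?addr0 => [/eqP|j /cE ->]; last by rewrite scale0r.
by rewrite scaler_eq0 (negbTE cj0) => /eqP.
Qed.

(* Chains of generalized eigenvectors span an invariant space; dividing out
   the linear relations gives an independent invariant family. *)
Lemma gen_eig_family lam m (us : 'I_m -> nat -> 'rV[C]_1) :
  (forall i, gen_eig lam (us i)) -> indep_cols us ->
  exists r (L : nat -> 'rV[C]_r) (B : 'M[C]_r), [/\ (m <= r)%N, ell2 L, indep L,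
    acts L (fun p => L p *m B) & forall z, root (char_poly B) z -> z = lam].
Proof.
move=> /choice[ch hch] ius.
have /choice[len0 hlen0] (i : 'I_m) : exists len, forall l p, (len <= l)%N -> ch i l p = 0.
  by have [] := hch i.
(* The successor keeps [len] positive, so that the column of index 0, which holds the chain heads,
   always exists. *)
pose len := (\max_i len0 i).+1.
have hlen i l p : (len <= l)%N -> ch i l p = 0.
  by move=> hl; apply: hlen0; apply: leq_trans hl; rewrite ltnW // ltnS leq_bigmax.
pose X p : 'M[C]_(m, len) := \matrix_(i, l) ch i l p 0 0.
pose Sh : 'M[C]_len := \matrix_(k, l) (k == l.+1 :> nat)%:R.
pose L p := mxvec (X p); pose B := lin_mulmxr (lam%:M + Sh) : 'M[C]_(m * len).
have XS p (q : nat) i (l : 'I_len) : (X p *m Sh ^+ q) i l = ch i (l + q)%N p 0 0.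
  elim: q l => [|q IH] l; first by rewrite expr0 mulmx1 mxE addn0.
  rewrite exprSr mulmxA mxE.
  have [lq|lq] := ltnP l.+1 len.
    rewrite (bigD1 (Ordinal lq)) //= big1 ?addr0 => [|k kl]; last first.
      by rewrite [Sh _ _]mxE -[_ == _ :> nat]/(k == Ordinal lq) (negbTE kl) mulr0.
    by rewrite IH [Sh _ _]mxE eqxx mulr1 /= addSnnS.
  rewrite big1 => [|k _].
    rewrite hlen ?mxE //; apply: leq_trans lq _; by rewrite addnS ltnS leq_addr.
  rewrite [Sh _ _]mxE; have -> : (k == l.+1 :> nat) = false; last by rewrite mulr0.
  by apply/eqP => kl; have := ltn_ord k; rewrite kl ltnNge lq.
have LB p : L p *m B = mxvec (lam *: X p + X p *m Sh).
  by rewrite /L /B mul_vec_lin /mulmxr /= mulmxDr mul_mx_scalar.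
have aL : acts L (fun p => L p *m B).
  move=> p; apply/mlim_tail => i j; rewrite ord1 LB.
  have [a b] := mxvec_indexP j; rewrite mxvecE.
  have [_ _ hacts _] := hch a; have /mlim_tail/(_ 0 0) := hacts b p.
  have -> : (ch a b.+1 p + lam *: ch a b p) 0 0 = (lam *: X p + X p *m Sh) a b.
    by have := XS p 1%N a b; rewrite expr1 addn1 => E; rewrite !mxE addrC; congr (_ + _); move: E; rewrite mxE.
  apply: mlim_ext; apply: filterS filterT => K _ /=; congr (_%:M).
  by rewrite !summxE; apply: eq_bigr => q _; rewrite mxE [RHS]mxE mxvecE mxE.
have L2 : ell2 L.
  pose vs (j : 'I_(m * len)) p : 'rV[C]_1 := (L p 0 j)%:M.
  have -> : L = cols vs.
    by apply/funext => p; apply/rowP => j; rewrite !mxE eqxx.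
  apply: ell2_cols => j; have [a b] := mxvec_indexP j.
  have [_ /(_ b)[M hM] _ _] := hch a; exists M => K; apply: le_trans (hM K).
  apply: ler_sum => p _; rewrite /nrm2 !big_ord1 mxE eqxx mulr1n /L mxvecE mxE //.
have [N1 hN1] := rank_stab L.
(* The rows of [W] form a basis of the space spanned by all rows of [L], and [L'] consists of the
   coordinates in this basis. This removes the linear relations between members of the chains. *)
pose W := row_base (trunc L N1); pose r := \rank (trunc L N1).
pose Wi := pinvmx W.
have WWi : W *m Wi = 1%:M by rewrite mulmxVp // row_base_free.
pose L' p := L p *m Wi; pose B' := W *m B *m Wi.
have LW p : L' p *m W = L p.
  by rewrite /L' mulmxKpV // eq_row_base hN1.
have iL' : indep L'.
  move=> c hc; have tc : trunc L N1 *m (Wi *m c) = 0.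
    apply/row_matrixP => i; rewrite row_mul rowK row0 mulmxA; exact: hc.
  have /submxP[D WD] : (W <= trunc L N1)%MS by rewrite eq_row_base.
  by rewrite -[c]mul1mx -WWi -mulmxA {1}WD -mulmxA tc mulmx0.
have aL' : acts L' (fun p => L' p *m B').
  apply: acts_ext (acts_mulr Wi aL) => // p /=.
  by rewrite /B' [RHS]mulmxA [L' p *m _]mulmxA LW.
exists r, L', B'; split=> //; last 1 first.
- move=> z /eigenvalue_colP[c c0' Bc].
  pose d := Wi *m c.
  (* For an eigenvector c of [B'] with eigenvalue z, applying mat - lam repeatedly multiplies L' c
     by z - lam and shifts the chains. After [len] shifts the chains are exhausted while L' c is
     nonzero, hence z = lam. *)
  have key q : forall p, (z - lam) ^+ q *: (L' p *m c) = mxvec (X p *m Sh ^+ q) *m d.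
    elim: q => [|q IH] p; first by rewrite !expr0 scale1r mulmx1 /L' /d -mulmxA.
    have a1 : acts (fun p => (z - lam) ^+ q *: (L' p *m c))
                   (fun p => (z - lam) ^+ q *: (z *: (L' p *m c))).
      apply: actsZ; apply: acts_ext (acts_mulr c aL') => // s.
      by rewrite -mulmxA Bc scalemxAr.
    have a2 : acts (fun p => mxvec (X p *m Sh ^+ q) *m d)
        (fun p => (lam *: mxvec (X p *m Sh ^+ q) + mxvec (X p *m Sh ^+ q.+1)) *m d).
      have E s : mxvec (X s *m Sh ^+ q) = L s *m lin_mulmxr (Sh ^+ q).
        by rewrite /L mul_vec_lin.
      apply: acts_ext (acts_mulr (lin_mulmxr (Sh ^+ q) *m d) aL) => s.
        by rewrite E mulmxA.
      rewrite mulmxA; congr (_ *m _); rewrite LB mul_vec_lin /mulmxr /= mulmxDl.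
      have SS : Sh *m Sh ^+ q = Sh ^+ q.+1 by rewrite exprS.
      by rewrite -scalemxAl -mulmxA SS !linearD /= linearZ.
    have := acts_uniq a1 (acts_ext (fun s => esym (IH s)) (frefl _) a2) p.
    rewrite mulmxDl -scalemxAl -IH => E.
    rewrite exprS -scalerA scalerBl; apply/eqP; rewrite subr_eq; apply/eqP.
    by rewrite scalerA mulrC -scalerA E addrC.
  have [p hp] : exists p, L' p *m c != 0.
    apply: contrapT => /forallNP h; case/eqP: c0'; apply: iL' => p.
    by apply/eqP; have /negP := h p; rewrite negbK.
  have := key len p; have -> : X p *m Sh ^+ len = 0.
    by apply/matrixP => i l; rewrite XS [RHS]mxE hlen ?mxE // leq_addl.
  rewrite linear0 mul0mx => /eqP; rewrite scaler_eq0 (negbTE hp) orbF.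
  by rewrite expf_eq0 /= subr_eq0 => /eqP.
- have len0' : (0 < len)%N by [].
  (* [Sel] extracts the chain heads, that is the family [us]. Its independence makes the r x m
     matrix [W *m Sel] of rank m, so m <= r. *)
  pose Sel : 'M[C]_(m * len, m) := \matrix_(j, i) (j == mxvec_index i (Ordinal len0'))%:R.
  have LS p : L p *m Sel = cols us p.
    apply/rowP => i; rewrite [LHS]mxE (bigD1 (mxvec_index i (Ordinal len0'))) //= big1 ?addr0.
      by rewrite !mxE eqxx mulr1 mxvecE mxE; have [-> _ _ _] := hch i.
    by move=> k ki; rewrite [Sel _ _]mxE (negbTE ki) mulr0.
  suff : row_full (W *m Sel) by move=> /eqP <-; apply: rank_leq_row.
  rewrite -cokermx_eq0; apply/eqP/matrixP => i j.
  suff /colP/(_ i) : col j (cokermx (W *m Sel)) = 0 by rewrite !mxE.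
  apply: (iffLR (indep_colsP us) ius) => p.
  by rewrite -LS -LW -[L' p *m W *m Sel]mulmxA -mulmxA colE [W *m Sel *m _]mulmxA mulmx_coker mul0mx mulmx0.
- exact: ell2_mulr.
Qed.

End SpectralConvergence.

(** * Counting eigenvalues of the sections *)

Section Estimates.
Variable R : realType.
Implicit Types a d x y z c e eps : R.

Lemma inv_le_half a x : 0 < a -> a / 2 <= x -> x^-1 <= 2 / a.
Proof.
move=> a0 ax; have a2 : 0 < a / 2 by lra.
rewrite -[2 / a]invf_div lef_pV2 ?posrE //; lra.
Qed.

(** Geometry of the inversion w -> mu0 + w^-1 near sg = (lam - mu0)^-1: with a = |sg|, x = |w| and d
    = |w - sg|, the quotient d / (x a) is the distance from mu0 + w^-1 to lam. *)
Lemma circle_dist a d x eps : 0 < a -> 0 < d -> a / 2 <= x -> x <= 3 / 2 * a ->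
  d <= eps * a ^+ 2 / 4 -> d / (3 / 2 * a * a) <= d / (x * a) <= eps / 2.
Proof.
move=> a0 d0 ax xa de; have x0 : 0 < x by lra.
have a2 : 0 < a ^+ 2 by rewrite exprn_gt0.
have e0 : 0 < eps.
  by have := lt_le_trans d0 de; rewrite -mulrA pmulr_lgt0 // divr_gt0.
have p1 : 0 < x * a by rewrite mulr_gt0.
have p2 : 0 < 3 / 2 * a * a by rewrite !mulr_gt0.
have h1 : x * a <= 3 / 2 * a * a by rewrite ler_pM2r.
apply/andP; split; first by rewrite ler_pM2l // lef_pV2 ?posrE.
rewrite ler_pdivrMr //; apply: le_trans de _.
have h : a / 2 * a <= x * a by rewrite ler_pM2r.
have -> : eps * a ^+ 2 / 4 = eps / 2 * (a / 2 * a) by field.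
by rewrite ler_pM2l // divr_gt0.
Qed.

Lemma circle_dist_lt a d x y eps : 0 < a -> 0 < d -> a / 2 <= x -> x <= 3 / 2 * a ->
  d <= eps * a ^+ 2 / 4 -> y < d -> y / (x * a) < eps.
Proof.
move=> a0 d0 ax xa de yd; have /andP[_ h] := circle_dist a0 d0 ax xa de.
have x0 : 0 < x * a by rewrite mulr_gt0 //; lra.
have h1 : y / (x * a) < d / (x * a) by rewrite ltr_pM2r // invr_gt0.
have h2 : 0 < d / (x * a) by rewrite divr_gt0.
lra.
Qed.

Lemma resolvent_const a c x : 0 < a -> 0 < c -> a / 2 <= x ->
  x^-1 * (1 + (c * x)^-1) <= (a / 2)^-1 * (1 + (c * (a / 2))^-1).
Proof.
move=> a0 c0 ax; have a2 : 0 < a / 2 by lra.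
have x0 : 0 < x by lra.
have i1 : x^-1 <= (a / 2)^-1 by rewrite lef_pV2 ?posrE.
have i2 : (c * x)^-1 <= (c * (a / 2))^-1.
  by rewrite lef_pV2 ?posrE ?mulr_gt0 // ler_pM2l.
apply: ler_pM => //; first by rewrite invr_ge0 ltW.
  by rewrite addr_ge0 // invr_ge0 mulr_ge0 ?ltW.
by rewrite lerD2l.
Qed.

(** Stability of a lower bound: x, y, z are the norms of V, (w - F) V and (w - S) V, and a
    perturbation of norm e with 2 c e <= 1 is absorbed on the left at the price of doubling c. *)
Lemma absorb x y z e c : 0 <= x -> 0 <= y -> 0 < c -> x <= c * z -> z <= y + e * x ->
  e * (2 * c) <= 1 -> x <= 2 * c * y.
Proof.
move=> x0 y0 c0 h1 h2 h3; have : c * z <= c * (y + e * x) by rewrite ler_pM2l.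
by nra.
Qed.

Lemma le_three_halves a d : 0 < a -> d <= a / 2 -> d <= 3 / 2 * a.
Proof. by move=> *; lra. Qed.

Lemma circle_gap_gt0 a d : 0 < a -> 0 < d -> 0 < d / (3 / 2 * a * a).
Proof. by move=> a0 d0; rewrite divr_gt0 // !mulr_gt0. Qed.

Lemma resolvent_const_gt0 a c : 0 < a -> 0 < c -> 0 < (a / 2)^-1 * (1 + (c * (a / 2))^-1).
Proof.
by move=> a0 c0; rewrite mulr_gt0 ?invr_gt0 ?divr_gt0 // addr_gt0 // invr_gt0 mulr_gt0 // divr_gt0.
Qed.

(** The two conditions on the size e of the defect: the hypothesis of [absorb], and the trace
    difference at most 1/2 demanded by [count_disc_eq]. Here k bounds the left inverse, c is the
    resolvent constant and 3/2 a majorizes the radius of the circle. *)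
Lemma small_defect (r : nat) k c a : 0 < k -> 0 < c -> 0 < a -> exists2 e, 0 < e &
  e * k * (2 * c) <= 1 /\ 3 / 2 * a * (r%:R * (k * (2 * c * (c * e)))) <= 1 / 2.
Proof.
move=> k0 c0 a0; pose A := 2 * c * k; pose B := 2 * r%:R * k * (2 * c) * c * (3 / 2 * a).
have A0 : 0 <= A by rewrite !mulr_ge0 // ltW.
have B0 : 0 <= B by rewrite !mulr_ge0 ?ler0n // ltW.
have D0 : 0 < A + B + 1 by lra.
exists (A + B + 1)^-1; first by rewrite invr_gt0.
split.
  have -> : (A + B + 1)^-1 * k * (2 * c) = A / (A + B + 1).
    by rewrite /A -mulrA mulrC [k * _]mulrC.
  by rewrite ler_pdivrMr //; lra.
have -> : 3 / 2 * a * (r%:R * (k * (2 * c * (c * (A + B + 1)^-1)))) = B / (A + B + 1) / 2.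
  by rewrite {2}/B; field; rewrite gt_eqF.
rewrite ler_pM2r ?invr_gt0 // ler_pdivrMr //; lra.
Qed.

(** Second resolvent identity followed by cyclicity of the trace. The right-hand side is the trace
    of an r x r matrix, so estimating it by a norm costs a factor r that does not grow with N. *)
Lemma trace_inv_diff (F : fieldType) N r (A A' : 'M[F]_N) (E : 'M[F]_(N, r)) (Z : 'M[F]_(r, N)) :
  A \in unitmx -> A' \in unitmx -> E *m Z = A' - A ->
  \tr (invmx A) - \tr (invmx A') = \tr (Z *m (invmx A' *m (invmx A *m E))).
Proof.
move=> uA uA' EZ; rewrite -raddfB /=.
have -> : invmx A - invmx A' = invmx A *m E *m (Z *m invmx A').
  rewrite mulmxA -[_ *m E *m Z]mulmxA EZ mulmxBr mulVmx // mulmxBl mul1mx.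
  by rewrite -mulmxA mulmxV // mulmx1.
by rewrite mxtrace_mulC -mulmxA.
Qed.

End Estimates.

(** * At least the algebraic multiplicity many eigenvalues near an eigenvalue *)

Section CountConvergence.
Variable R : realType.
Local Notation C := (R[i]).
Local Open Scope sesquilinear_scope.
Variable mat : nat -> nat -> C.
Hypothesis mat_row : forall p, exists M, forall K, \sum_(q < K) cabs (mat p q) ^+ 2 <= M.
Context (U : set_system nat) {UF : UltraFilter U}.
Hypothesis Uinf : \oo `<=` U.
Hypothesis compactness : forall (N_ : nat -> nat), (forall i, (i <= N_ i)%N) ->
  forall m (V : forall i, 'M[C]_(N_ i, m)) M, (forall i, nrm2 (V i) <= M) ->
  (forall i, nrm2 (sec mat (N_ i) *m V i) <= M) -> tight U V.
Local Notation sec := (sec mat).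
Local Notation acts := (acts mat).
Local Notation is_eig := (is_eig mat).

Section WithResolvent.
Variables (mu0 : C) (c0 : R) (N0 : nat).
Hypothesis mu0_eig : ~ is_eig mu0.
Hypothesis c0_gt0 : 0 < c0.
Hypothesis lower : forall N, (N0 <= N)%N -> forall m (V : 'M[C]_(N, m)),
  c0 * fn V <= fn ((sec N - mu0%:M) *m V).
Local Notation solve := (solve mat mu0).

(** With Y = solve V and X = (w - solve) V one has w V = X + Y and (sec - mu0 - w^-1) Y = w^-1 X, so
    a lower bound for the section at mu0 + w^-1 controls Y, hence V, by X. *)
Lemma solve_resolvent N m (V : 'M[C]_(N, m)) w c : (N0 <= N)%N -> w != 0 -> 0 < c ->
  (forall r (W : 'M[C]_(N, r)), c * fn W <= fn ((sec N - (mu0 + w^-1)%:M) *m W)) ->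
  fn V <= (cabs w)^-1 * (1 + (c * cabs w)^-1) * fn ((w%:M - solve N) *m V).
Proof.
move=> N0N w0 cp hc; set X := (w%:M - solve N) *m V.
pose Y := solve N *m V.
have wV : w *: V = X + Y by rewrite /X mulmxBl mul_scalar_mx subrK.
have AY : (sec N - (mu0 + w^-1)%:M) *m Y = w^-1 *: X.
  rewrite mulmxBl (sec_solve c0_gt0 lower) //.
  rewrite mul_scalar_mx scalerDl opprD addrA addrK.
  have -> : V = w^-1 *: (X + Y) by rewrite -wV scalerA mulVf // scale1r.
  by rewrite scalerDr addrK.
have wp : 0 < cabs w by rewrite cabs_gt0.
have fY : fn Y <= (c * cabs w)^-1 * fn X.
  rewrite ler_pdivlMl ?mulr_gt0 //.
  have := hc _ Y; rewrite AY fnZ cabsV ler_pdivlMl //.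
  by rewrite mulrA [cabs w * c]mulrC.
rewrite -mulrA ler_pdivlMl // -fnZ wV; apply: le_trans (fnD _ _) _.
by rewrite mulrDl mul1r lerD2l.
Qed.

(** All roots for [B] equal lam, so sg = (lam - mu0)^-1 is at least an r-fold root for the perturbed
    inverse. Counting in a small disc around sg transfers the number r to [solve N], and inversion
    maps this disc into the disc of radius eps around lam. *)
Lemma lower_count (lam : C) r (L : nat -> 'rV[C]_r) (B : 'M[C]_r) (eps : R) :
  ell2 L -> indep L -> acts L (fun p => L p *m B) ->
  (forall z, root (char_poly B) z -> z = lam) -> is_eig lam -> 0 < eps ->
  (forall z, is_eig z -> z != lam -> eps <= cabs (z - lam)) ->
  exists N2, forall N, (N2 <= N)%N -> forall s : seq C,
    char_poly (sec N) = \prod_(z <- s) ('X - z%:P) ->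
    (r <= count (fun z => (cabs (z - lam) < eps)%R) s)%N.
Proof.
move=> L2 iL aL Broots lam_eig eps0 isol.
have lm : lam - mu0 != 0.
  by rewrite subr_eq0; apply/eqP => lm; apply: mu0_eig; rewrite -lm.
have [sg sg0 sgE] : exists2 sg : C, sg != 0 & sg = (lam - mu0)^-1.
  by exists (lam - mu0)^-1; rewrite ?invr_eq0.
have lamE : lam = mu0 + sg^-1 by rewrite sgE invrK addrC subrK.
have [a a0 aE] : exists2 a : R, 0 < a & cabs sg = a.
  by exists (cabs sg); rewrite ?cabs_gt0.
(* d <= a/2 keeps the disc around sg away from 0; d <= eps a^2/4 keeps its image under w -> mu0 +
   w^-1 within eps/2 of lam. *)
have [d [d0 da de]] : exists d, [/\ 0 < d, d <= a / 2 & d <= eps * a ^+ 2 / 4].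
  exists (Num.min (a / 2) (eps * a ^+ 2 / 4)); split.
  - by rewrite lt_min !divr_gt0 ?mulr_gt0 ?exprn_gt0.
  - by rewrite ge_min lexx.
  - by rewrite ge_min lexx orbT.
have dle w : cabs (w - sg) = d -> cabs (w - sg) <= d by move=> ->.
have near w : cabs (w - sg) <= d ->
    [/\ a / 2 <= cabs w, cabs w <= 3 / 2 * a &
     cabs (mu0 + w^-1 - lam) = cabs (w - sg) / (cabs w * a)].
  move=> wd; have h1 := cabs_lerB sg w; have h2 := cabs_lerB w sg.
  rewrite cabs_distC aE in h1; rewrite aE in h2.
  have wa : a / 2 <= cabs w by lra.
  split; [exact: wa|lra|].
  have w0 : w != 0 by rewrite -cabs_gt0; lra.
  rewrite lamE opprD addrACA subrr add0r.
  have -> : w^-1 - sg^-1 = - ((w - sg) / (w * sg)) by field; rewrite w0 sg0.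
  by rewrite cabsN !cabsM cabsV cabsM aE.
(* The image of the circle: resolvent bounds for the sections on [G] become, by [solve_resolvent],
   resolvent bounds for [solve N] on the circle. *)
pose G z := exists2 w, cabs (w - sg) = d & z = mu0 + w^-1.
have GB z : G z -> cabs z <= cabs mu0 + 2 / a.
  move=> [w wd ->]; have [h1 _ _] := near w (dle _ wd).
  apply: le_trans (cabsD _ _) _; rewrite lerD2l cabsV; exact: inv_le_half.
have Glam z : G z -> d / (3 / 2 * a * a) <= cabs (z - lam) <= eps / 2.
  move=> [w wd ->]; have [h1 h2 ->] := near w (dle _ wd); rewrite wd.
  exact: circle_dist.
(* Points of [G] lie within eps/2 of lam without reaching it, and any other eigenvalue is at least
   eps away from lam. *)
have Geig z : is_eig z -> exists2 e, 0 < e & forall y, G y -> e <= cabs (y - z).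
  move=> zeig; have [->|zl] := eqVneq z lam.
    exists (d / (3 / 2 * a * a)); first exact: circle_gap_gt0.
    by move=> y /Glam /andP[].
  exists (eps / 2); first lra.
  move=> y /Glam /andP[_ h]; have := isol z zeig zl.
  by have := cabs_triangle y z lam; rewrite (cabs_distC z y) => *; lra.
have [c cp [N3 hc]] := uniform_resolvent mat_row Uinf compactness GB Geig.
pose K1 := (a / 2)^-1 * (1 + (c * (a / 2))^-1).
have K1p : 0 < K1 by exact: resolvent_const_gt0.
have [K [N4 [K0 hK]]] := exact_perturbation mat mu0 B iL.
have [e1 e10 [he1 he2]] := small_defect r K0 K1p a0.
have [N5 hE] := defect_small mat_row Uinf compactness mu0_eig c0_gt0 lower L2 iL aL e10.
exists (maxn (maxn N0 N3) (maxn N4 N5)) => N.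
rewrite !geq_max => /andP[/andP[N0N N3N] /andP[N4N N5N]] s chars.
have [Z [nZ ZL FL]] := hK N N4N; have {}hE := hE N N5N.
set E := defect mat mu0 L B N in FL hE.
set F := solve N - E *m Z in FL.
have Ar w m (V : 'M[C]_(N, m)) : cabs (w - sg) = d -> fn V <= K1 * fn ((w%:M - solve N) *m V).
  move=> wd; have [h1 _ _] := near w (dle _ wd).
  have a2 : 0 < a / 2 by rewrite divr_gt0.
  have wp : 0 < cabs w by exact: lt_le_trans h1.
  have hc' : forall r (W : 'M[C]_(N, r)), c * fn W <= fn ((sec N - (mu0 + w^-1)%:M) *m W).
    by move=> ? W; exact: (hc _ N3N _ (ex_intro2 _ _ w wd erefl) _ W).
  apply: le_trans (solve_resolvent V N0N _ cp hc') _; first by rewrite -cabs_gt0.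
  by apply: ler_wpM2r; [apply: fn_ge0|apply: resolvent_const].
have EZ : fn (E *m Z) * (2 * K1) <= 1.
  apply: le_trans he1; rewrite ler_pM2r; last exact: mulr_gt0 (ltr0Sn _ 1) K1p.
  by apply: le_trans (fnM _ _) _; apply: ler_pM (fn_ge0 _) (fn_ge0 _) (ltW hE) nZ.
have Fr w m (V : 'M[C]_(N, m)) : cabs (w - sg) = d -> fn V <= 2 * K1 * fn ((w%:M - F) *m V).
  move=> wd; have h := Ar w m V wd.
  have e : (w%:M - solve N) *m V = (w%:M - F) *m V - E *m Z *m V.
    by rewrite -mulmxBl /F; congr (_ *m _); rewrite opprB addrA addrAC addrK.
  have h2 : fn ((w%:M - solve N) *m V) <= fn ((w%:M - F) *m V) + fn (E *m Z) * fn V.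
    by rewrite e; apply: le_trans (fnB _ _) _; rewrite lerD2l fnM.
  exact: absorb (fn_ge0 _) (fn_ge0 _) K1p h h2 EZ.
have unitS w : cabs (w - sg) = d -> w%:M - solve N \in unitmx.
  move=> wd; apply: (bounded_below_unit (c := K1^-1)); first by rewrite invr_gt0.
  by move=> V; rewrite ler_pdivrMl; [apply: (Ar w _ V wd)|exact: K1p].
have unitF w : cabs (w - sg) = d -> w%:M - F \in unitmx.
  have K2 : 0 < 2 * K1 by rewrite mulr_gt0.
  move=> wd; apply: (bounded_below_unit (c := (2 * K1)^-1)); first by rewrite invr_gt0.
  by move=> V; rewrite ler_pdivrMl; [apply: (Fr w _ V wd)|exact: K2].
have charS : char_poly (solve N) = \prod_(z <- [seq (z - mu0)^-1 | z <- s]) ('X - z%:P).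
  have := char_poly_inv (char_poly_shift mu0 chars) (sec_unit c0_gt0 lower N0N).
  by rewrite -map_comp.
have [sB charB] := char_poly_roots B.
have [t charF] := perturbed_roots mu0_eig L2 iL aL ZL FL charB.
set sS := [seq (z - mu0)^-1 | z <- s] in charS.
set sF := _ ++ t in charF.
pose shift (l : seq C) := [seq z - sg | z <- l].
have cnt : count (fun z => cabs z < d) (shift sS) = count (fun z => cabs z < d) (shift sF).
  apply: (count_disc_eq d0).
  - move=> z /mapP[y ys ->]; apply/negP => /eqP yd.
    have := unitS y yd; apply/negP; apply: root_char_nonunit.
    by rewrite charS root_prod_XsubC.
  - move=> z /mapP[y ys ->]; apply/negP => /eqP yd.
    have := unitF y yd; apply/negP; apply: root_char_nonunit.
    by rewrite charF root_prod_XsubC.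
  - move=> w' wd; pose w := w' + sg.
    have wd' : cabs (w - sg) = d by rewrite /w addrK.
    have E1 l : \sum_(z <- shift l) (w' - z)^-1 = \sum_(z <- l) (w - z)^-1.
      by rewrite big_map; apply: eq_bigr => z _; rewrite /w opprB addrA addrAC.
    rewrite !E1 -(trace_resolvent charS (unitS w wd')) -(trace_resolvent charF (unitF w wd')).
    set A := w%:M - solve N; set A' := w%:M - F.
    have uA : A \in unitmx := unitS w wd'.
    have uA' : A' \in unitmx := unitF w wd'.
    have -> : \tr (invmx A) - \tr (invmx A') = \tr (Z *m (invmx A' *m (invmx A *m E))).
      apply: (trace_inv_diff uA uA').
      by rewrite /A /A' /F [- (w%:M - solve N)]opprD opprK addrACA subrr add0r opprB subrK.
    rewrite cabsM wd.
    have d32 := le_three_halves a0 da.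
    have h1 : fn (invmx A *m E) <= K1 * e1.
      apply: le_trans (Ar w _ _ wd') _; rewrite -/A (mulKVmx uA).
      by rewrite ler_pM2l; [apply: ltW|].
    have h2 : fn (invmx A' *m (invmx A *m E)) <= 2 * K1 * (K1 * e1).
      apply: le_trans (Fr w _ _ wd') _; rewrite -/A' (mulKVmx uA').
      by rewrite ler_pM2l; last exact: mulr_gt0 (ltr0Sn _ 1) K1p.
    have h3 : fn (Z *m (invmx A' *m (invmx A *m E))) <= K * (2 * K1 * (K1 * e1)).
      by apply: le_trans (fnM _ _) _; apply: ler_pM (fn_ge0 _) (fn_ge0 _) nZ h2.
    have h4 : cabs (\tr (Z *m (invmx A' *m (invmx A *m E)))) <= r%:R * (K * (2 * K1 * (K1 * e1))).
      by apply: le_trans (cabs_trace _) _; apply: ler_wpM2l h3; apply: ler0n.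
    by apply: le_trans he2; apply: ler_pM (ltW d0) (cabs_ge0 _) d32 h4.
have szB := size_char_roots charB.
apply: (@leq_trans (count (fun z => (cabs z < d)%R) (shift sF))).
  rewrite /shift map_cat count_cat; apply: leq_trans (leq_addr _ _).
  rewrite -map_comp -szB -(size_map ((fun z => z - sg) \o (fun z => (z - mu0)^-1)) sB).
  rewrite leq_eqVlt eq_sym -all_count; apply/orP; left; apply/allP => y /mapP[z zs ->].
  have -> : z = lam by apply: Broots; rewrite charB root_prod_XsubC.
  by rewrite /= -sgE subrr cabs0.
rewrite -cnt count_map count_map; apply: sub_count => z /= hz.
have [h1 h2] := near _ (ltW hz).
rewrite invrK [mu0 + _]addrC subrK => ->.
exact: circle_dist_lt a0 d0 h1 h2 de hz.
Qed.

End WithResolvent.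
End CountConvergence.

(** * At most the algebraic multiplicity many, and convergence of the spectra of the sections *)

Section SectionConvergence.
Variable R : realType.
Local Notation C := (R[i]).
Local Open Scope sesquilinear_scope.
Variable mat : nat -> nat -> C.
Hypothesis mat_row : forall p, exists M, forall K, \sum_(q < K) cabs (mat p q) ^+ 2 <= M.
Context (U : set_system nat) {UF : UltraFilter U}.
Hypothesis Uinf : \oo `<=` U.
Hypothesis compactness : forall (N_ : nat -> nat), (forall i, (i <= N_ i)%N) ->
  forall m (V : forall i, 'M[C]_(N_ i, m)) M, (forall i, nrm2 (V i) <= M) ->
  (forall i, nrm2 (sec mat (N_ i) *m V i) <= M) -> tight U V.
Local Notation sec := (sec mat).
Local Notation acts := (acts mat).
Local Notation is_eig := (is_eig mat).
Local Notation gen_eig := (gen_eig mat).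

Section WithResolvent.
Variables (mu0 : C) (c0 : R) (N0 : nat).
Hypothesis mu0_eig : ~ is_eig mu0.
Hypothesis c0_gt0 : 0 < c0.
Hypothesis lower : forall N, (N0 <= N)%N -> forall m (V : 'M[C]_(N, m)),
  c0 * fn V <= fn ((sec N - mu0%:M) *m V).
Local Notation solve := (solve mat mu0).

Lemma solve_invariant N m (V : 'M[C]_(N, m)) T : (N0 <= N)%N -> V ^t* *m V = 1%:M ->
  sec N *m V = V *m T -> T - mu0%:M \in unitmx /\ solve N *m V = V *m invmx (T - mu0%:M).
Proof.
move=> N0N V1 VT.
have AV : (sec N - mu0%:M) *m V = V *m (T - mu0%:M).
  by rewrite mulmxBl VT mulmxBr mul_scalar_mx mul_mx_scalar.
have uT : T - mu0%:M \in unitmx.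
  apply: (bounded_below_unit c0_gt0) => c.
  have := lower N0N (V *m c); rewrite mulmxA AV -mulmxA.
  by rewrite /fn !(nrm2_orth _ V1).
split=> //; rewrite /solve -[RHS](mulKmx (sec_unit c0_gt0 lower N0N)).
by congr (_ *m _); rewrite [RHS]mulmxA AV mulmxK.
Qed.

(** Clearing the denominator, |(mu0 - lam) tau + 1| <= eps |tau| is an inequality between continuous
    functions of tau and passes to the limit. *)
Lemma limit_in_disc (tau : nat -> C) (t lam : C) (eps : R) : 0 <= eps -> t != 0 ->
  (forall e, 0 < e -> U [set i | cabs (tau i - t) < e]) ->
  (forall i, tau i != 0) -> (forall i, cabs (mu0 + (tau i)^-1 - lam) <= eps) ->
  cabs (mu0 + t^-1 - lam) <= eps.
Proof.
move=> eps0 t0 tt tau0 h.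
have E (x : C) : x != 0 -> mu0 + x^-1 - lam = ((mu0 - lam) * x + 1) / x.
  by move=> x0; field.
have tp : 0 < cabs t by rewrite cabs_gt0.
rewrite E // cabsM cabsV ler_pdivrMr //; apply/ler_addgt0Pr => e e0.
pose k := eps + cabs (mu0 - lam) + 1.
have k0 : 0 < k by rewrite ltr_wpDl // addr_ge0 // cabs_ge0.
have [i /= hi] := filter_ex (tt _ (divr_gt0 e0 k0)).
have xi : cabs ((mu0 - lam) * tau i + 1) <= eps * cabs (tau i).
  have xp : 0 < cabs (tau i) by rewrite cabs_gt0.
  by have := h i; rewrite E // cabsM cabsV ler_pdivrMr.
have -> : (mu0 - lam) * t + 1 = ((mu0 - lam) * tau i + 1) - (mu0 - lam) * (tau i - t) by ring.
apply: le_trans (cabsB _ _) _; rewrite cabsM.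
have h2 : cabs (tau i) <= cabs t + cabs (tau i - t).
  by rewrite addrC -lerBlDr cabs_lerB.
rewrite ltr_pdivlMr // /k in hi; have := cabs_ge0 (tau i - t).
have := cabs_ge0 (mu0 - lam).
set x := cabs (tau i - t) in h2 hi *; set y := cabs (mu0 - lam) in hi *.
move=> y0 x0; apply: le_trans (_ : eps * (cabs t + x) + y * x <= _).
  by rewrite lerD2r; apply: le_trans xi _; rewrite ler_wpM2l.
by rewrite mulrDr; nra.
Qed.

Lemma cayley_single m (B : 'M[C]_m.+1) lam : is_trig_mx B^T -> (forall j, B j j = lam) ->
  (B - lam%:M) ^+ m.+1 = 0.
Proof.
move=> tB dB; have := Cayley_Hamilton B; rewrite -char_poly_tr char_poly_trig //.
rewrite (eq_bigr (fun=> 'X - lam%:P)) => [|i _]; last by rewrite mxE dB.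
by rewrite prodr_const card_ord rmorphXn rmorphB /= horner_mx_X horner_mx_C.
Qed.

(** The compressions of [solve] to the invariant families converge as small triangular matrices to
    some t', and the limit family is invariant under the infinite matrix with block B = t'^-1 + mu0.
    Orthonormality and tightness keep it independent, and isolation forces every diagonal entry of B
    to equal lam, so B - lam is nilpotent. *)
Lemma upper_count (lam : C) m (eps : R) : 0 <= eps ->
  (forall z, is_eig z -> cabs (z - lam) <= eps -> z = lam) ->
  (forall N2, exists N (s : seq C), [/\ (N2 <= N)%N, char_poly (sec N) = \prod_(z <- s) ('X - z%:P) &
    (m <= count (fun z => (cabs (z - lam) < eps)%R) s)%N]) ->
  exists us : 'I_m -> nat -> 'rV[C]_1, (forall i, gen_eig lam (us i)) /\ indep_cols us.
Proof.
case: m => [|m] eps0 isol inf.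
  by exists (fun _ _ => 0); split=> [[]//|c _ []].
have /choice[f hf] : forall k : nat, exists x : {N : nat & 'M[C]_(N, m.+1)} * 'M[C]_m.+1,
    [/\ (k <= projT1 x.1)%N /\ (N0 <= projT1 x.1)%N, (projT2 x.1) ^t* *m projT2 x.1 = 1%:M,
      sec (projT1 x.1) *m projT2 x.1 = projT2 x.1 *m x.2, is_trig_mx x.2^T &
      forall j, cabs (x.2 j j - lam) < eps].
  move=> k; have [N [s [kN chars ms]]] := inf (maxn k N0).
  rewrite geq_max in kN; case/andP: kN => kN N0N.
  pose P : pred C := fun z => cabs (z - lam) < eps; rewrite -/P in ms.
  (* The roots inside the disc are listed first, so that the leading part of the Schur form belongs
     to them. *)
  have chars' : char_poly (sec N) = \prod_(z <- seq.filter P s ++ seq.filter (predC P) s) ('X - z%:P).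
    by rewrite chars; apply/perm_big; rewrite perm_sym perm_filterC.
  have mN : (m.+1 <= N)%N by apply: leq_trans ms _; rewrite -(size_char_roots chars) count_size.
  have [V [T [V1 VT Tt Td]]] := schur_part chars' mN.
  exists (existT _ N V, T); split=> //= j.
  rewrite Td nth_cat size_filter (leq_trans (ltn_ord j) ms).
  have : P (nth 0 (seq.filter P s) j).
    by apply: (all_nthP 0 (filter_all P s)); rewrite size_filter (leq_trans (ltn_ord j) ms).
  by [].
pose N_ i := projT1 (f i).1; pose V i : 'M[C]_(N_ i, m.+1) := projT2 (f i).1.
pose T i := (f i).2; pose t i := invmx (T i - mu0%:M).
have N_ge i : (i <= N_ i)%N by have [[]] := hf i.
have N_ge0 i : (N0 <= N_ i)%N by have [[]] := hf i.
have V1 i : (V i) ^t* *m V i = 1%:M by have [] := hf i.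
have uT i : T i - mu0%:M \in unitmx.
  by have [_ v1 vT _ _] := hf i; have [] := solve_invariant (N_ge0 i) v1 vT.
have SV i : solve (N_ i) *m V i = V i *m t i.
  by have [_ v1 vT _ _] := hf i; have [_ ->] := solve_invariant (N_ge0 i) v1 vT.
have nV i : nrm2 (V i) <= m.+1%:R by rewrite -[V i]mulmx1 nrm2_orth // nrm2_unit.
have td i : is_trig_mx (t i)^T /\ forall j, t i j j = (T i j j - mu0)^-1.
  have [_ _ _ Tt _] := hf i.
  have tr : is_trig_mx (T i - mu0%:M)^T.
    apply/is_trig_mxP => a b ab; rewrite !mxE -val_eqE gtn_eqF // subr0.
    by have /is_trig_mxP/(_ a b ab) := Tt; rewrite mxE.
  have Tt1 : (T i - mu0%:M)^T *m (t i)^T = 1%:M by rewrite -trmx_mul mulVmx ?uT // trmx1.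
  have [h1 h2] := trig_inv tr Tt1; split=> // j.
  by have := h2 j; rewrite !mxE eqxx.
(* [V i] is isometric, so t has the norm of V t = solve V, at most sqrt(m+1)/c0. No such bound is at
   hand for the blocks [T i], which is why limits are taken of the inverses. *)
have [t' ht'] : exists l, mlim U t l.
  apply: (@ultra_mlim _ U UF _ _ _ ((c0^-1 * Num.sqrt m.+1%:R) ^+ 2)) => i.
  rewrite -(nrm2_orth _ (V1 i)) -SV -fn_le; last by rewrite mulr_ge0 ?invr_ge0 ?sqrtr_ge0 // ltW.
  apply: le_trans (fn_solve c0_gt0 lower _ (N_ge0 i)) _.
  by rewrite ler_wpM2l ?invr_ge0 ?(ltW c0_gt0) // ler_sqrt ?ler0n.
have entry a b : mlim U (fun i => (t i a b)%:M : 'M[C]_1) (t' a b)%:M.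
  exact: (iffLR (mlim_tail _ _) ht' a b).
have t't : is_trig_mx t'^T.
  apply/is_trig_mxP => a b ab; rewrite mxE.
  have h : mlim U (fun i => (t i b a)%:M : 'M[C]_1) 0%:M.
    apply: mlim_ext (mlim_cst 0%:M); apply: filterS filterT => i _ /=.
    by have [/is_trig_mxP/(_ a b ab)] := td i; rewrite mxE => ->.
  have /matrixP/(_ 0 0) : (t' b a)%:M = 0%:M :> 'M[C]_1.
    by apply: mlim_unique h; apply: entry.
  by rewrite !mxE eqxx.
(* [D] bounds |T_jj - mu0|, so the diagonal of every t i stays above 1/D in modulus and the
   triangular limit t' is invertible. *)
pose D := cabs (lam - mu0) + eps + 1.
have D0 : 0 < D by rewrite ltr_wpDl // addr_ge0 ?cabs_ge0.
have tnz i j : t i j j != 0.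
  have := uT i; rewrite -unitmx_inv -/(t i) -unitmx_tr unitmxE unitfE det_trig; last by have [] := td i.
  by rewrite prodf_seq_neq0 => /allP/(_ j (mem_index_enum _)); rewrite mxE.
have tlow i j : D^-1 <= cabs (t i j j).
  have [_ ->] := td i; rewrite cabsV lef_pV2 ?posrE //.
    apply: le_trans (cabs_triangle lam _ _) _.
    by have [_ _ _ _ /(_ j)/ltW h] := hf i; rewrite /D addrC -addrA lerD2l ler_wpDr.
  rewrite cabs_gt0; have := tnz i j; have [_ ->] := td i.
  by rewrite invr_eq0.
have t'nz j : t' j j != 0.
  rewrite -cabs_gt0; have D2 : 0 < D^-1 / 2 by rewrite divr_gt0 // invr_gt0.
  have /mlim_scalarP/(_ _ D2)/filter_ex[i /= hi] := entry j j.
  have := cabs_lerB (t i j j) (t i j j - t' j j).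
  rewrite subKr => h; have h2 := tlow i j.
  by apply: lt_le_trans D2 _; lra.
have ut' : t' \in unitmx.
  rewrite -unitmx_tr unitmxE unitfE det_trig // prodf_seq_neq0; apply/allP => j _.
  by rewrite mxE t'nz.
pose it := invmx t'; pose B := it + mu0%:M.
have [L VL] := plim_ex nV.
have L2 : ell2 L by exact: plim_ell2 nV VL.
have [tS [Y [SY Y2 aY]]] := solve_lim mat_row Uinf compactness c0_gt0 lower N_ge N_ge0 nV VL.
have YE p : Y p = L p *m t'.
  apply: (mlim_unique (F := U)) (SY p) _.
  apply: mlim_ext (plimM VL ht' p); apply: filterS filterT => i _ /=.
  by rewrite SV.
have aL : acts L (fun p => L p *m B).
  apply: acts_ext (acts_mulr it aY) => p; first by rewrite YE mulmxK.
  by rewrite YE mulmxDl -scalemxAl mulmxK // mulmxDr mul_mx_scalar.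
have tV : tight U V.
  (* From solve V = V t: the first summand is tight by [solve_lim], and the second tends to 0
     because t i tends to t'. *)
  have -> : V = fun i => (solve (N_ i) *m V i) *m it + V i *m ((t' - t i) *m it).
    apply: functional_extensionality_dep => i.
    by rewrite SV mulmxA -mulmxDl -mulmxDr addrC subrK mulmxK.
  apply: tightD.
    by apply: (tightM (B := fun=> it) (M := nrm2 it)).
  apply: tight_null => e e0; pose k := Num.sqrt m.+1%:R * fn it + 1.
  have k0 : 0 < k by rewrite ltr_wpDl // mulr_ge0 ?fn_ge0 ?sqrtr_ge0.
  apply: filterS (ht' _ (divr_gt0 e0 k0)) => i /=.
  rewrite fn_distC ltr_pdivlMr // => hi; apply: le_lt_trans hi.
  apply: le_trans (fnM _ _) _; apply: le_trans (ler_wpM2l (fn_ge0 _) (fnM _ _)) _.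
  rewrite mulrCA ler_wpM2l ?fn_ge0 //; apply: le_trans (_ : Num.sqrt m.+1%:R * fn it <= _).
    by rewrite ler_wpM2r ?fn_ge0 // ler_sqrt ?ler0n.
  by rewrite /k lerDl.
have iL : indep L.
  move=> c hc; apply/eqP; rewrite -fn_eq0; apply: contraT => c1.
  have cp : 0 < fn c by rewrite lt_def c1 fn_ge0.
  have tVc : tight U (fun i => V i *m c).
    by apply: (tightM (B := fun=> c) (M := nrm2 c)).
  have [p /eqP] : exists p, L p *m c != 0.
    apply: (tight_limit_neq0 cp tVc (plimMr c VL)) => i.
    by rewrite /fn (nrm2_orth _ (V1 i)).
  by case; apply: hc.
have tit : it^T = invmx t'^T by rewrite trmx_inv.
have [itt itd] : is_trig_mx it^T /\ forall j, it^T j j = (t'^T j j)^-1.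
  by apply: trig_inv t't _; rewrite tit mulmxV // unitmx_tr.
have Bt : is_trig_mx B^T.
  apply/is_trig_mxP => a b ab; rewrite !mxE -val_eqE gtn_eqF // addr0.
  by have /is_trig_mxP/(_ a b ab) := itt; rewrite mxE.
have Bd j : B j j = mu0 + (t' j j)^-1.
  by have := itd j; rewrite !mxE eqxx => ->; rewrite addrC.
(* The diagonal entry is a root for B, hence an eigenvalue of the infinite matrix, and it is a limit
   of points within eps of lam. Strict inequalities become weak ones in the limit, hence the closed
   disc in the isolation hypothesis. *)
have Blam j : B j j = lam.
  apply: isol.
    have : root (char_poly B) (B j j).
      rewrite -char_poly_tr char_poly_trig // /root horner_prod; apply/eqP.
      by rewrite (bigD1 j) //= hornerXsubC [B^T j j]mxE subrr mul0r.
    by move=> /eigenvalue_colP[c c1 Bc]; apply: (eig_of_col L2 iL aL c1 Bc).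
  rewrite Bd; apply: (limit_in_disc (tau := fun i => t i j j)) => //.
    exact/mlim_scalarP/entry.
  move=> i; have [_ ->] := td i; rewrite invrK [mu0 + _]addrC subrK.
  by have [_ _ _ _ /(_ j)/ltW] := hf i.
have Bn := cayley_single Bt Blam.
(* The columns of the limit family; powers of the nilpotent B - lam produce their chains, of length
   at most m + 1. *)
pose us (j : 'I_m.+1) p : 'rV[C]_1 := L p *m delta_mx j 0.
exists us; split.
  move=> j; exists (fun l p => L p *m ((B - lam%:M) ^+ l *m delta_mx j 0)); split.
  - by apply: funext => p; rewrite expr0 mul1mx.
  - by move=> l; apply: ell2_mulr.
  - move=> l; apply: acts_ext (acts_mulr ((B - lam%:M) ^+ l *m delta_mx j 0) aL) => // p.
    have -> : (B - lam%:M) ^+ l.+1 = B *m (B - lam%:M) ^+ l - lam *: (B - lam%:M) ^+ l.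
      by rewrite exprS -mulmxE mulmxBl mul_scalar_mx.
    by rewrite mulmxBl mulmxBr -scalemxAl -scalemxAr subrK !mulmxA.
  - exists m.+1 => l p ml; rewrite -(subnK ml) exprD Bn mulr0 mul0mx mulmx0 //.
apply/indep_colsP; have -> // : cols us = L.
by apply: funext => p; apply/rowP => j; rewrite mxE /us -colE mxE.
Qed.

End WithResolvent.

Lemma list_lower_bound (l : seq R) : (forall x, x \in l -> 0 < x) ->
  exists2 e : R, 0 < e & forall x, x \in l -> e <= x.
Proof.
elim: l => [|x l IH] h; first by exists 1.
have [|e e0 he] := IH; first by move=> y yl; apply: h; rewrite inE yl orbT.
exists (Num.min x e); first by rewrite lt_min e0 h ?mem_head.
move=> y; rewrite inE ge_min => /orP[/eqP->|/he ->]; by rewrite ?lexx ?orbT.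
Qed.

Lemma cabs_near (z lam : C) (a e : R) : cabs lam < a -> cabs (z - lam) <= e -> e < 1 ->
  cabs z <= a + 1.
Proof. by move=> h1 h2 h3; have := cabs_lerB z lam; lra. Qed.

Lemma list_threshold (T : eqType) (l : seq T) (Q : T -> nat -> Prop) :
  (forall x, x \in l -> exists N1, forall N, (N1 <= N)%N -> Q x N) ->
  exists N1, forall N, (N1 <= N)%N -> forall x, x \in l -> Q x N.
Proof.
elim: l => [|x l IH] h; first by exists 0%N.
have [|N1 h1] := IH; first by move=> y yl; apply: h; rewrite inE yl orbT.
have [N2 h2] := h x (mem_head _ _); exists (maxn N1 N2) => N.
rewrite geq_max => /andP[n1 n2] y; rewrite inE => /orP[/eqP->|]; [exact: h2|exact: h1].
Qed.

Lemma bounded_max (P : nat -> Prop) b : P 0%N -> (forall k, P k -> (k <= b)%N) ->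
  exists k, P k /\ ~ P k.+1.
Proof.
move=> P0 Pb; apply: contrapT => /forallNP h.
have all k : P k.
  by elim: k => // k Pk; apply: contrapT => nP; apply: (h k).
by have := Pb _ (all b.+1); rewrite ltnn.
Qed.

Theorem section_convergence (Rad : R) : 0 < Rad ->
  (forall lam, cabs lam = Rad -> ~ is_eig lam) ->
  exists2 eps0 : R, 0 < eps0 & forall eps : R, 0 < eps -> eps < eps0 ->
  exists N2, forall N, (N2 <= N)%N -> forall s : seq C,
    char_poly (sec N) = \prod_(z <- s) ('X - z%:P) ->
    (forall z, z \in s -> cabs z < Rad -> exists lam, is_eig lam /\ cabs (z - lam) < eps) /\
    (forall lam, is_eig lam -> cabs lam < Rad -> exists m : nat,
      [/\ exists us : 'I_m -> nat -> 'rV[C]_1, (forall i, gen_eig lam (us i)) /\ indep_cols us,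
        forall us : 'I_m.+1 -> nat -> 'rV[C]_1, (forall i, gen_eig lam (us i)) -> ~ indep_cols us &
        count (fun z => cabs (z - lam) < eps) s = m]).
Proof.
(* A point of the circle, where eigenvalues are excluded, serves as base point of the resolvent. *)
move=> Rad0 circle; pose mu0 : C := (Rad%:C)%C.
have Rad1 : Rad <= Rad + 1 by rewrite lerDl.
have mu0_eig : ~ is_eig mu0 by apply: circle; rewrite cabs_real gtr0_norm.
have [c0 c0_gt0 [N0 lower']] : exists2 c, 0 < c & exists N0, forall N, (N0 <= N)%N ->
    forall z, z = mu0 -> forall m (V : 'M[C]_(N, m)), c * fn V <= fn ((sec N - z%:M) *m V).
  apply: (uniform_resolvent mat_row Uinf compactness (B := cabs mu0)); first by move=> z ->.
  move=> lam lam_eig; exists (cabs (mu0 - lam)); last by move=> z ->.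
  by rewrite cabs_gt0 subr_eq0; apply/eqP => h; apply: mu0_eig; rewrite h.
have {lower'}lower N : (N0 <= N)%N -> forall m (V : 'M[C]_(N, m)),
    c0 * fn V <= fn ((sec N - mu0%:M) *m V).
  by move=> N0N m V; apply: lower' N0N _ erefl _ V.
have Rb0 : 0 <= Rad + 1 by rewrite addr_ge0 // ltW.
have [mmax hmax] := family_bound mat_row Uinf compactness mu0_eig c0_gt0 lower Rb0.
(* A list of distinct eigenvalues of maximal length is complete; its length is limited by
   [family_bound]. The margin 1 in the radius catches eigenvalues outside the disc that lie within
   eps < 1 of one inside. *)
pose P k := exists es : seq C, [/\ uniq es, size es = k &
  forall z, z \in es -> is_eig z /\ cabs z <= Rad + 1].
have [k [[es [ues szes hes]] nP]] : exists k, P k /\ ~ P k.+1.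
  apply: (bounded_max (b := mmax)); first by exists [::].
  move=> k [es [ues <- hes]].
  have [L [L2 iL aL]] := distinct_eig_indep ues (fun z h => (hes z h).1).
  apply: (hmax _ L _ L2 iL aL) => z.
  rewrite char_poly_trig ?diag_mx_is_trig // /root horner_prod prodf_seq_eq0.
  move=> /hasP[j _]; rewrite hornerXsubC !mxE eqxx mulr1n subr_eq0 => /eqP ->.
  by apply: (hes _ _).2; apply: mem_nth.
have es_all z : is_eig z -> cabs z <= Rad + 1 -> z \in es.
  move=> zeig zR; apply: contrapT => /negP zes; apply: nP.
  exists (z :: es); split=> /=; [by rewrite zes|by rewrite szes|].
  by move=> y; rewrite inE => /orP[/eqP->|]; [exact: conj zeig zR|exact: hes].
(* With eps below all mutual distances, the closed eps-disc around an eigenvalue contains no other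
   eigenvalue. *)
pose gaps := [seq cabs (p.1 - p.2) | p <- [seq (x, y) | x <- es, y <- es] & p.1 != p.2].
have [e1 e10 he1] : exists2 e, 0 < e & forall x, x \in gaps -> e <= x.
  apply: list_lower_bound => x /mapP[p]; rewrite mem_filter => /andP[pp _] ->.
  by rewrite cabs_gt0 subr_eq0.
exists (Num.min e1 1); first by rewrite lt_min e10 ltr01.
move=> eps eps0; rewrite lt_min => /andP[eps1 eps11].
have isol lam : is_eig lam -> cabs lam < Rad -> forall z, is_eig z -> cabs (z - lam) <= eps -> z = lam.
  move=> lam_eig lamR z zeig zl; apply/eqP; apply: contraT => zlam.
  have lam_es := es_all lam lam_eig (le_trans (ltW lamR) Rad1).
  have z_es := es_all z zeig (cabs_near lamR zl eps11).
  have : e1 <= cabs (z - lam).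
    apply: he1; apply/mapP; exists (z, lam); last exact: erefl.
    rewrite mem_filter /= zlam /=; apply/allpairsP; exists (z, lam).
    by split; [exact: z_es|exact: lam_es|].
  by move=> /le_trans/(_ zl); rewrite leNgt eps1.
(* On the closed disc minus the eps-neighbourhoods of the eigenvalues the sections are invertible
   for large N, which locates their eigenvalues. *)
have [c cp [N1 hN1]] : exists2 c, 0 < c & exists N1, forall N, (N1 <= N)%N ->
    forall z, (cabs z <= Rad /\ forall lam, is_eig lam -> eps <= cabs (z - lam)) ->
    forall m (V : 'M[C]_(N, m)), c * fn V <= fn ((sec N - z%:M) *m V).
  apply: (uniform_resolvent mat_row Uinf compactness (B := Rad)); first by move=> z [].
  by move=> lam lam_eig; exists eps; [exact: eps0|move=> z [_ /(_ _ lam_eig)]].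
(* A multiplicity is a maximal number of independent generalized eigenvectors; a maximum exists by
   [family_bound] applied to the span of their chains. *)
pose mult lam m := (exists us : 'I_m -> nat -> 'rV[C]_1, (forall i, gen_eig lam (us i)) /\ indep_cols us) /\
  ~ (exists us : 'I_m.+1 -> nat -> 'rV[C]_1, (forall i, gen_eig lam (us i)) /\ indep_cols us).
have [N3 hN3] : exists N3, forall N, (N3 <= N)%N -> forall lam, lam \in es ->
    cabs lam < Rad -> forall s : seq C, char_poly (sec N) = \prod_(z <- s) ('X - z%:P) ->
    exists2 m, mult lam m & count (fun z => cabs (z - lam) < eps) s = m.
  apply: list_threshold => lam /hes[lam_eig _].
  have [lamR|lamR] := ltP (cabs lam) Rad; last by exists 0%N.
  have [m [[us [gus ius]] nm]] : exists m, mult lam m.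
    apply: (bounded_max (b := mmax)).
      by exists (fun _ _ => 0); split=> [[]//|c' _ []].
    move=> m [us [gus ius]].
    have [r [L [B [mr L2 iL aL hB]]]] := gen_eig_family gus ius.
    apply: leq_trans mr _; apply: (hmax _ L B L2 iL aL) => z /hB ->.
    exact: le_trans (ltW lamR) Rad1.
  have [r [L [B [mr L2 iL aL hB]]]] := gen_eig_family gus ius.
  have isol' z : is_eig z -> z != lam -> eps <= cabs (z - lam).
    move=> zeig zl; rewrite leNgt; apply/negP => /ltW h.
    by case/eqP: zl; apply: isol.
  have [N4 hN4] := lower_count mat_row Uinf compactness mu0_eig c0_gt0 lower L2 iL aL hB lam_eig eps0 isol'.
  (* If arbitrarily large sections had more than m eigenvalues in the disc, [upper_count] would
     produce m + 1 independent generalized eigenvectors. *)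
  have [N5 hN5] : exists N5, forall N, (N5 <= N)%N -> forall s : seq C,
      char_poly (sec N) = \prod_(z <- s) ('X - z%:P) ->
      (count (fun z => (cabs (z - lam) < eps)%R) s <= m)%N.
    apply: contrapT => /forallNP neg; apply: nm.
    refine (upper_count c0_gt0 lower (ltW eps0) (isol lam lam_eig lamR) _) => N5.
    have /existsNP[N /not_implyP[hN /existsNP[s /not_implyP[chars /negP]]]] := neg N5.
    by rewrite -ltnNge => ms; exists N, s; split; [exact: hN|exact: chars|exact: ms].
  exists (maxn N4 N5) => N; rewrite geq_max => /andP[h4 h5] _ s chars.
  exists m; first exact: conj (ex_intro _ us (conj gus ius)) nm.
  apply/eqP; rewrite eqn_leq (hN5 N h5 s chars) /=.
  exact: leq_trans mr (hN4 N h4 s chars).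
exists (maxn N1 N3) => N; rewrite geq_max => /andP[h1 h3] s chars; split.
  move=> z zs zR; apply: contrapT => /forallNP nz.
  have zfar : cabs z <= Rad /\ forall lam, is_eig lam -> eps <= cabs (z - lam).
    split; first exact: ltW.
    by move=> lam lam_eig; rewrite leNgt; apply/negP => h; exact: (nz lam (conj lam_eig h)).
  have : root (char_poly (sec N)) z by rewrite chars root_prod_XsubC.
  move=> /root_char_nonunit/negP; apply.
  have u : sec N - z%:M \in unitmx.
    by apply: (bounded_below_unit cp) => V; exact: (hN1 N h1 z zfar _ V).
  by rewrite -opprB -scaleN1r unitmxZ ?unitrN1.
move=> lam lam_eig lamR; have lam_es := es_all lam lam_eig (le_trans (ltW lamR) Rad1).
have [m [h nm] cnt] := hN3 N h3 lam lam_es lamR s chars.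
exists m; split; [exact: h| |exact: cnt].
by move=> us gus ius; apply: nm; exact: (ex_intro _ us (conj gus ius)).
Qed.

End SectionConvergence.

(** * Discrete compactness of Hill matrices *)

Section Compactness.
Variable R : realType.
Local Notation C := (R[i]).
Local Open Scope sesquilinear_scope.
Variables (a0 a1 a2 : nat -> nat -> C) (d : nat -> C) (delta : nat -> R).
Variables (Mr Md kappa Cc : R).

Definition hill_mat p q : C := d p ^+ 2 * a2 p q + d p * a1 p q + a0 p q.

Hypothesis row0 : forall p K, \sum_(q < K) cabs (a0 p q) ^+ 2 <= Mr.
Hypothesis row1 : forall p K, \sum_(q < K) cabs (a1 p q) ^+ 2 <= Mr.
Hypothesis row2 : forall p K, \sum_(q < K) cabs (a2 p q) ^+ 2 <= Mr.
Hypothesis herm : forall p q, a2 q p = conjc (a2 p q).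
Hypothesis Cc0 : 0 < Cc.
Hypothesis coercive : forall N (v : 'cV[C]_N),
  Cc * nrm2 v <= complex.Re (\tr (v ^t* *m (sec a2 N *m v))).
Hypothesis kappa0 : 0 < kappa.
Hypothesis delta_ge0 : forall p, 0 <= delta p.
Hypothesis delta_le1 : forall p, delta p <= 1.
Hypothesis delta_sum : forall K, \sum_(p < K) delta p ^+ 2 <= Md.
Hypothesis d_delta : forall p, (d p = 0 /\ delta p = 1) \/ kappa <= cabs (d p) * delta p.

Lemma Re_le_cabs (z : C) : complex.Re z <= cabs z.
Proof. by apply: le_trans (cabs_Re z); apply: ler_norm. Qed.

Lemma coercive_cols N m (V : 'M[C]_(N, m)) :
  Cc * nrm2 V <= complex.Re (\tr (V ^t* *m (sec a2 N *m V))).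
Proof.
rewrite nrm2_col mulr_sumr /mxtrace raddf_sum; apply: ler_sum => j _.
apply: le_trans (coercive _) _; rewrite /mxtrace big_ord1.
by rewrite -diag_colE.
Qed.

(** Coercivity bounds the sections of A2 from below uniformly in N. The factor m comes from
    estimating an m x m trace by a norm and is harmless since m is fixed. *)
Lemma fn_lower N m (V : 'M[C]_(N, m)) : Cc * fn V <= m%:R * fn (sec a2 N *m V).
Proof.
have [->|V0] := eqVneq (fn V) 0; first by rewrite mulr0 mulr_ge0 ?ler0n ?fn_ge0.
have Vp : 0 < fn V by rewrite lt_def V0 fn_ge0.
rewrite -(ler_pM2r Vp) -mulrA -expr2 fn_sqr; apply: le_trans (coercive_cols V) _.
apply: le_trans (Re_le_cabs _) _; apply: le_trans (cabs_trace _) _.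
rewrite -mulrA ler_wpM2l ?ler0n //; apply: le_trans (fnM _ _) _.
by rewrite mulrC /fn nrm2_adj.
Qed.

Lemma sec2_unit N : sec a2 N \in unitmx.
Proof.
apply: (bounded_below_unit Cc0) => v.
by have := fn_lower v; rewrite mul1r.
Qed.

Lemma sec2_herm N : (sec a2 N) ^t* = sec a2 N.
Proof. by apply/matrixP => i j; rewrite !mxE [RHS]herm. Qed.

Definition inj_mx (M N : nat) : 'M[C]_(N, M) := \matrix_(i, j) (i == j :> nat)%:R.

Lemma inj_mx_mull M N k (X : 'M[C]_(N, k)) (MN : (M <= N)%N) j l :
  ((inj_mx M N) ^t* *m X) j l = X (widen_ord MN j) l.
Proof.
rewrite !mxE (bigD1 (widen_ord MN j)) //= big1 => [|i ij].
  by rewrite !mxE eqxx rmorph1 mul1r addr0.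
rewrite !mxE; have -> : (i == j :> nat) = false; last by rewrite rmorph0 mul0r.
by apply: contraNF ij => /eqP h; apply/eqP/val_inj.
Qed.

Lemma inj_mx_mulr M N k (X : 'M[C]_(k, N)) (MN : (M <= N)%N) l j :
  (X *m inj_mx M N) l j = X l (widen_ord MN j).
Proof.
rewrite !mxE (bigD1 (widen_ord MN j)) //= big1 => [|i ij].
  by rewrite !mxE eqxx mulr1 addr0.
rewrite !mxE; have -> : (i == j :> nat) = false; last by rewrite mulr0.
by apply: contraNF ij => /eqP h; apply/eqP/val_inj.
Qed.

Lemma inj_mx_sec M N : (M <= N)%N -> (inj_mx M N) ^t* *m (sec a2 N *m inj_mx M N) = sec a2 M.
Proof.
by move=> MN; apply/matrixP => i j; rewrite (inj_mx_mull _ MN) (inj_mx_mulr _ MN) !mxE.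
Qed.

Lemma inj_mx_trunc m (w : nat -> 'rV[C]_m) M N : (M <= N)%N ->
  (inj_mx M N) ^t* *m trunc w N = trunc w M.
Proof. by move=> MN; apply/matrixP => i j; rewrite (inj_mx_mull _ MN) !mxE. Qed.

Section Galerkin.
Variables (m : nat) (w : nat -> 'rV[C]_m) (Mw : R).
Hypothesis w_bound : forall K, \sum_(p < K) nrm2 (w p) <= Mw.

Definition galerkin N : 'M[C]_(N, m) := invmx (sec a2 N) *m trunc w N.
(** Minus twice the minimum of 1/2 <A2 u, u> - Re <u, w> over u supported on the first N
    coordinates, attained at the Galerkin solution; it therefore increases with N. *)
Definition energy N : R := complex.Re (\tr ((galerkin N) ^t* *m trunc w N)).

Lemma sec_galerkin N : sec a2 N *m galerkin N = trunc w N.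
Proof. by rewrite mulKVmx // sec2_unit. Qed.

(* The Galerkin error is controlled by the gain of energy, because A2 is Hermitian. *)
Lemma galerkin_cauchy M N : (M <= N)%N ->
  Cc * nrm2 (galerkin N - inj_mx M N *m galerkin M) <= energy N - energy M.
Proof.
move=> MN; apply: le_trans (coercive_cols _) _.
set A := sec a2 N; set E := inj_mx M N; set v := galerkin N; set u := galerkin M.
have adjM n1 n2 n3 (X : 'M[C]_(n1, n2)) (Y : 'M[C]_(n2, n3)) : (X *m Y) ^t* = Y ^t* *m X ^t*.
  by rewrite trmx_mul map_mxM.
have adjB n1 n2 (X Y : 'M[C]_(n1, n2)) : (X - Y) ^t* = X ^t* - Y ^t*.
  by rewrite linearB /= map_mxB.
(* Galerkin orthogonality: both solutions have the same residual data on the first M coordinates. *)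
have t1 : E ^t* *m (A *m (v - E *m u)) = 0.
  rewrite mulmxBr sec_galerkin mulmxBr mulmxA mulmxA -[_ *m A *m E]mulmxA.
  by rewrite inj_mx_sec // inj_mx_trunc // sec_galerkin subrr.
have -> : (v - E *m u) ^t* *m (A *m (v - E *m u)) = v ^t* *m (A *m (v - E *m u)).
  by rewrite adjB mulmxBl (adjM _ _ _ E u) -[u ^t* *m E ^t* *m _]mulmxA t1 mulmx0 subr0.
have t2 : v ^t* *m A = (trunc w N) ^t*.
  have sA : A ^t* = A := sec2_herm N.
  by rewrite -[X in _ *m X]sA -(adjM _ _ _ A v) sec_galerkin.
have -> : v ^t* *m (A *m (v - E *m u)) = v ^t* *m trunc w N - (trunc w M) ^t* *m u.
  rewrite mulmxBr mulmxBr sec_galerkin; congr (_ - _).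
  by rewrite !mulmxA t2 -(inj_mx_trunc w MN) (adjM _ _ _ (E ^t*) (trunc w N)) trmxCK.
rewrite !raddfB /= lerD2l lerN2 /energy.
have -> : \tr ((trunc w M) ^t* *m u) = conjc (\tr (u ^t* *m trunc w M)).
  rewrite -[in LHS](trmxK ((trunc w M) ^t* *m u)) mxtrace_tr /mxtrace rmorph_sum.
  by apply: eq_bigr => i _; rewrite !mxE rmorph_sum; apply: eq_bigr => k _; rewrite !mxE rmorphM /= conjcK mulrC.
by case: (\tr _).
Qed.

Lemma energy_bounded : exists b, forall N, energy N <= b.
Proof.
have Mw0 : 0 <= Mw by have := w_bound 0; rewrite big_ord0.
exists (m%:R * ((Cc^-1 * (m%:R * Num.sqrt Mw)) * Num.sqrt Mw)) => N.
apply: le_trans (Re_le_cabs _) _; apply: le_trans (cabs_trace _) _.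
rewrite ler_wpM2l ?ler0n //; apply: le_trans (fnM _ _) _.
have wN : fn (trunc w N) <= Num.sqrt Mw by rewrite ler_sqrt // nrm2_trunc.
apply: ler_pM; rewrite ?fn_ge0 //.
rewrite /fn nrm2_adj -/(fn _) ler_pdivlMl //; apply: le_trans (fn_lower _) _.
by rewrite sec_galerkin ler_wpM2l ?ler0n.
Qed.

(** The energies are increasing and bounded. Choose K with energy within Cc e of the supremum: every
    later solution differs from the one of size K, which has no mass beyond K, by less than e in
    squared norm. *)
Lemma galerkin_tail e : 0 < e -> exists K, forall N, tail K (galerkin N) < e.
Proof.
move=> e0; have [b hb] := energy_bounded.
have mono M N : (M <= N)%N -> energy M <= energy N.
  move=> /galerkin_cauchy h; rewrite -subr_ge0; apply: le_trans h.
  by rewrite mulr_ge0 ?(ltW Cc0) // nrm2_ge0.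
have sup_e : has_sup (range energy).
  by split; [exists (energy 0), 0%N|exists b => _ [K _ <-]; apply: hb].
have ep : 0 < Cc * e by rewrite mulr_gt0.
have [_ [K _ <-] hK] := sup_adherent ep sup_e.
exists K => N; have [KN|NK] := leqP K N; last first.
  rewrite /tail big1 // => i Ki; have := ltn_ord i.
  by rewrite ltnNge (leq_trans (ltnW NK) Ki).
have hN : energy N <= sup (range energy) by apply: ub_le_sup; [case: sup_e|exists N].
have := galerkin_cauchy KN; set x := galerkin N - _ => h.
have tx : tail K (galerkin N) = tail K x.
  apply: eq_bigr => i Ki; congr nrm2; apply/rowP => j.
  rewrite ![row _ _ _ _]mxE /x [RHS]mxE [X in _ + X]mxE [X in - X]mxE big1 ?subr0 //.
  move=> k _; rewrite !mxE; have -> : (i == k :> nat) = false; last by rewrite mul0r.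
  by apply: gtn_eqF; apply: leq_trans Ki; apply: ltn_ord.
rewrite tx; apply: le_lt_trans (tail_le K x) _.
by rewrite -(ltr_pM2l Cc0); apply: le_lt_trans h _; lra.
Qed.

End Galerkin.

Lemma row_apply (a : nat -> nat -> C) N m (V : 'M[C]_(N, m)) p :
  (forall p K, \sum_(q < K) cabs (a p q) ^+ 2 <= Mr) ->
  nrm2 (ent (sec a N *m V) p) <= Mr * nrm2 V.
Proof.
move=> ha; have Mr0 : 0 <= Mr by have := ha 0%N 0%N; rewrite big_ord0.
have [pN|Np] := ltnP p N; last by rewrite ent_out // nrm20 mulr_ge0 // nrm2_ge0.
rewrite ent_sec //; have := nrm2_lincomb (index_iota 0 N) (a p) (ent V).
rewrite !big_mkord => h; apply: le_trans h _; rewrite nrm2_ent //.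
by rewrite ler_wpM2r ?nrm2_ge0.
Qed.

Lemma hill_row N m (V : 'M[C]_(N, m)) p : ent (sec hill_mat N *m V) p =
  d p ^+ 2 *: ent (sec a2 N *m V) p + d p *: ent (sec a1 N *m V) p + ent (sec a0 N *m V) p.
Proof.
have [pN|Np] := ltnP p N; last by rewrite !ent_out // !scaler0 !addr0.
rewrite !ent_sec // !scaler_sumr -!big_split /=; apply: eq_bigr => q _.
by rewrite !scalerA -!scalerDl.
Qed.

(** Solve row p of the Hill matrix for the A2 part: it equals d_p^-2 times the bounded image, minus
    d_p^-1 and d_p^-2 times rows of A1 and A0 applied to V, which are bounded by Cauchy-Schwarz.
    Where d_p = 0, [delta p] is 1 and the row bound of A2 suffices. *)
Lemma principal_decay N m (V : 'M[C]_(N, m)) M p : 0 <= M ->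
  nrm2 V <= M -> nrm2 (sec hill_mat N *m V) <= M ->
  fn (ent (sec a2 N *m V) p) <=
    (Num.sqrt M * kappa^-2 + Num.sqrt (Mr * M) * (1 + kappa^-1 + kappa^-2)) * delta p.
Proof.
move=> M0 VM FM; have Mr0 : 0 <= Mr by have := row0 0 0; rewrite big_ord0.
set b := Num.sqrt (Mr * M).
have b0 : 0 <= b := sqrtr_ge0 _.
have s0 : 0 <= Num.sqrt M := sqrtr_ge0 _.
have k1 : 0 <= kappa^-1 by rewrite invr_ge0 ltW.
have k2 : 0 <= kappa^-2 by rewrite invr_ge0 sqr_ge0.
have rb (a : nat -> nat -> C) : (forall p K, \sum_(q < K) cabs (a p q) ^+ 2 <= Mr) -> fn (ent (sec a N *m V) p) <= b.
  move=> ha; rewrite ler_sqrt ?mulr_ge0 //; apply: le_trans (row_apply V p ha) _.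
  by rewrite ler_wpM2l.
have fb : fn (ent (sec hill_mat N *m V) p) <= Num.sqrt M.
  by rewrite ler_sqrt //; apply: le_trans (ent_le _ _) FM.
have [[_ ->]|kd] := d_delta p.
  rewrite mulr1; apply: le_trans (rb _ row2) _.
  have h1 : 0 <= Num.sqrt M * kappa^-2 by rewrite mulr_ge0.
  have h2 : 0 <= b * kappa^-1 by rewrite mulr_ge0.
  have h3 : 0 <= b * kappa^-2 by rewrite mulr_ge0.
  by rewrite !mulrDr mulr1; lra.
have dp : d p != 0.
  apply: contraTneq kd => ->; rewrite cabs0 mul0r -ltNge //.
have dpp : 0 < cabs (d p) by rewrite cabs_gt0.
have i1 : (cabs (d p))^-1 <= kappa^-1 * delta p.
  by rewrite ler_pdivlMl // ler_pdivrMr // mulrC.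
have i1p : 0 <= (cabs (d p))^-1 by rewrite invr_ge0 ltW.
have i2 : (cabs (d p))^-2 <= kappa^-2 * delta p.
  rewrite -!exprVn; apply: le_trans (_ : (kappa^-1 * delta p) ^+ 2 <= _).
    by rewrite ler_pXn2r ?nnegrE ?mulr_ge0.
  rewrite exprMn ler_wpM2l ?sqr_ge0 // expr2 ler_piMr //.
have -> : ent (sec a2 N *m V) p = (d p)^-2 *: ent (sec hill_mat N *m V) p -
    (d p)^-1 *: ent (sec a1 N *m V) p - (d p)^-2 *: ent (sec a0 N *m V) p.
  rewrite hill_row !scalerDr !scalerA mulVf ?expf_neq0 // scale1r.
  have -> : (d p)^-2 * d p = (d p)^-1 by rewrite expr2 invfM -mulrA mulVf // mulr1.
  by rewrite addrAC !addrK.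
apply: le_trans (fnB _ _) _; apply: le_trans (lerD (fnB _ _) (lexx _)) _.
rewrite !fnZ !cabsV !cabsX.
have i2p : 0 <= (cabs (d p))^-2 by rewrite invr_ge0 sqr_ge0.
have f1 : (cabs (d p))^-2 * fn (ent (sec hill_mat N *m V) p) <= kappa^-2 * delta p * Num.sqrt M.
  by apply: ler_pM; rewrite ?fn_ge0.
have f2 : (cabs (d p))^-1 * fn (ent (sec a1 N *m V) p) <= kappa^-1 * delta p * b.
  by apply: ler_pM; rewrite ?fn_ge0 ?rb.
have f3 : (cabs (d p))^-2 * fn (ent (sec a0 N *m V) p) <= kappa^-2 * delta p * b.
  by apply: ler_pM; rewrite ?fn_ge0 ?rb.
have h1 : 0 <= b * delta p by rewrite mulr_ge0.
have -> : (Num.sqrt M * kappa^-2 + b * (1 + kappa^-1 + kappa^-2)) * delta p =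
  kappa^-2 * delta p * Num.sqrt M + kappa^-1 * delta p * b + kappa^-2 * delta p * b + b * delta p.
  by ring.
by rewrite -[leLHS]addr0; apply: lerD => //; apply: lerD => //; apply: lerD.
Qed.

(** By [principal_decay] the vectors W = A2 V are dominated by one square-summable sequence, so they
    converge in norm to some w. Inverting the sections of A2 need not preserve tails; instead V is
    compared, through the lower bound, with the Galerkin solutions for the fixed limit w, whose
    tails are uniformly small. *)
Lemma hill_compactness (U : set_system nat) {UF : UltraFilter U} (Uinf : \oo `<=` U)
    (N_ : nat -> nat) : (forall i, (i <= N_ i)%N) ->
  forall m (V : forall i, 'M[C]_(N_ i, m)) M, (forall i, nrm2 (V i) <= M) ->
  (forall i, nrm2 (sec hill_mat (N_ i) *m V i) <= M) -> tight U V.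
Proof.
move=> N_ge m V M VM FM.
have M0 : 0 <= M by apply: le_trans (VM 0%N); apply: nrm2_ge0.
pose W i := sec a2 (N_ i) *m V i.
pose K := Num.sqrt M * kappa^-2 + Num.sqrt (Mr * M) * (1 + kappa^-1 + kappa^-2).
have WK i p : nrm2 (ent (W i) p) <= K ^+ 2 * delta p ^+ 2.
  rewrite -fn_sqr -exprMn ler_pXn2r ?nnegrE ?fn_ge0 ?principal_decay //.
  by apply: le_trans (fn_ge0 _) (principal_decay p M0 (VM i) (FM i)).
have WM i : nrm2 (W i) <= K ^+ 2 * Md.
  rewrite -(nrm2_ent (W i) (leqnn _)); apply: le_trans (_ : \sum_(p < N_ i) K ^+ 2 * delta p ^+ 2 <= _).
    by apply: ler_sum => p _; apply: WK.
  by rewrite -mulr_sumr ler_wpM2l ?sqr_ge0.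
have tW : tight U W.
  move=> e e0; have [||K0 hK0] := @bounded_series_tail _ (fun p => K ^+ 2 * delta p ^+ 2) (K ^+ 2 * Md) _ _ e e0.
  - by move=> p; rewrite mulr_ge0 ?sqr_ge0.
  - by move=> L; rewrite -mulr_sumr ler_wpM2l ?sqr_ge0.
  exists K0; apply: filterS filterT => i _ /=.
  apply: le_lt_trans (hK0 K0 (maxn K0 (N_ i)) (leqnn _)).
  have -> : tail K0 (W i) = \sum_(K0 <= p < maxn K0 (N_ i)) nrm2 (ent (W i) p).
    apply: (addrI (\sum_(p < K0) nrm2 (ent (W i) p))); rewrite -nrm2_split.
    rewrite -(big_mkord xpredT (fun p => nrm2 (ent (W i) p))) -big_cat_nat ?leq_maxl //=.
    by rewrite big_mkord nrm2_ent // leq_maxr.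
  by apply: ler_sum => p _; apply: WK.
have [w Ww] := plim_ex WM.
have wM L : \sum_(p < L) nrm2 (w p) <= K ^+ 2 * Md by exact: plim_bound WM Ww L.
have d0 : plim U (fun i => W i - trunc w (N_ i)) (fun=> 0).
  move=> p; rewrite -(subrr (w p)).
  by apply: (plimB Ww) => //; apply: plim_trunc.
have td : tight U (fun i => W i - trunc w (N_ i)).
  have -> : (fun i => W i - trunc w (N_ i)) = (fun i => W i + trunc w (N_ i) *m (-1)%:M).
    by apply: functional_extensionality_dep => i; rewrite mul_mx_scalar scaleN1r.
  apply: tightD tW _; apply: (tightM (B := fun=> (-1)%:M) (M := nrm2 ((-1)%:M : 'M[C]_m))) => //.
  by apply: tight_trunc; exists (K ^+ 2 * Md); exact: wM.
have small : forall e, 0 < e -> U [set i | fn (V i - galerkin w (N_ i)) < e].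
  move=> e e0; have k0 : 0 < Cc^-1 * (m%:R + 1) by rewrite mulr_gt0 ?invr_gt0 // ltr_wpDl ?ler0n.
  apply: filterS (tight_plim0 td d0 (divr_gt0 e0 k0)) => i /=.
  rewrite ltr_pdivlMr // => hi; apply: le_lt_trans hi.
  have := fn_lower (V i - galerkin w (N_ i)).
  rewrite mulmxBr sec_galerkin -/(W i) -ler_pdivlMl // => h; apply: le_trans h _.
  rewrite mulrA [leRHS]mulrC; apply: ler_wpM2r; first exact: fn_ge0.
  by rewrite ler_wpM2l ?invr_ge0 ?(ltW Cc0) // lerDl.
have -> : V = fun i => (V i - galerkin w (N_ i)) + galerkin w (N_ i).
  by apply: functional_extensionality_dep => i; rewrite subrK.
apply: tightD; first exact: tight_null.
move=> e e0; have [K1 hK1] := galerkin_tail wM e0.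
by exists K1; apply: filterS filterT => i _; apply: hK1.
Qed.

Lemma hill_mat_row p : exists M, forall K, \sum_(q < K) cabs (hill_mat p q) ^+ 2 <= M.
Proof.
exists ((cabs (d p) ^+ 2) ^+ 2 * Mr * 4 + cabs (d p) ^+ 2 * Mr * 4 + Mr * 4) => K.
have sq (x y z : C) : cabs (x + y + z) ^+ 2 <= (cabs x ^+ 2 + cabs y ^+ 2 + cabs z ^+ 2) * 4.
  have h : cabs (x + y + z) <= cabs x + cabs y + cabs z.
    by apply: le_trans (cabsD _ _) _; rewrite lerD2r cabsD.
  have := cabs_ge0 (x + y + z); have := cabs_ge0 x; have := cabs_ge0 y; have := cabs_ge0 z.
  move: h; set s := cabs (x + y + z); set a := cabs x; set b := cabs y; set c := cabs z.
  move=> h c0 b0 a00 s0; apply: le_trans (_ : (a + b + c) ^+ 2 <= _).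
    by rewrite ler_pXn2r ?nnegrE ?addr_ge0.
  rewrite -subr_ge0.
  have -> : (a ^+ 2 + b ^+ 2 + c ^+ 2) * 4 - (a + b + c) ^+ 2 =
    (a - b) ^+ 2 + (b - c) ^+ 2 + (a - c) ^+ 2 + a ^+ 2 + b ^+ 2 + c ^+ 2 by ring.
  by rewrite !addr_ge0 ?sqr_ge0.
apply: le_trans (ler_sum _ (fun q _ => sq _ _ _)) _.
rewrite -mulr_suml !big_split /= !mulrDl.
have e2 : \sum_(q < K) cabs (d p ^+ 2 * a2 p q) ^+ 2 = (cabs (d p) ^+ 2) ^+ 2 * \sum_(q < K) cabs (a2 p q) ^+ 2.
  by rewrite mulr_sumr; apply: eq_bigr => q _; rewrite cabsM cabsX exprMn.
have e1 : \sum_(q < K) cabs (d p * a1 p q) ^+ 2 = cabs (d p) ^+ 2 * \sum_(q < K) cabs (a1 p q) ^+ 2.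
  by rewrite mulr_sumr; apply: eq_bigr => q _; rewrite cabsM exprMn.
rewrite e1 e2; apply: lerD; last by rewrite ler_pM2r // row0.
by apply: lerD; rewrite ler_pM2r // ler_wpM2l ?sqr_ge0 ?row1 ?row2.
Qed.

End Compactness.

(** * Square-integrable functions on a period *)

Section PeriodIntegral.
Variable R : realType.
Local Notation C := (R[i]).
Local Notation mu := (@lebesgue_measure R).
Variable X : R.
Local Notation I := (`[0, X]%classic : set R).

Definition rint (g : R -> R) : Prop := mu.-integrable I (fun x => (g x)%:E).

Lemma rint_dom (f g : R -> R) : measurable_fun setT f -> rint g ->
  (forall x, `|f x| <= g x) -> rint f.
Proof.
move=> mf ig fg; apply: (@le_integrable _ _ _ mu I _ _ (fun x => (g x)%:E)) => //.
- by apply/measurable_EFinP; apply: (measurable_funS measurableT).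
- move=> x _ /=; rewrite lee_fin; apply: (le_trans (fg x)); exact: ler_norm.
Qed.

Lemma rintD (f g : R -> R) : rint f -> rint g -> rint (fun x => f x + g x).
Proof.
by move=> hf hg; rewrite /rint; under [X in mu.-integrable _ X]funext => x do rewrite EFinD; exact: integrableD.
Qed.

Lemma rintZ (f : R -> R) c : rint f -> rint (fun x => c * f x).
Proof.
by move=> hf; rewrite /rint; under [X in mu.-integrable _ X]funext => x do rewrite EFinM; exact: integrableZl.
Qed.

Lemma rint_cst c : rint (fun=> c).
Proof.
have fin : (mu I < +oo)%E by rewrite lebesgue_measure_itv /=; case: ifP => // _; exact: ltry.
by apply: (@measurable_bounded_integrable _ _ _ mu (fun=> c) I) => //; exact: bounded_cst.
Qed.

Definition cintg (f : R -> C) : Prop :=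
  rint (fun x => complex.Re (f x)) /\ rint (fun x => complex.Im (f x)).

Lemma cintgD f g : cintg f -> cintg g -> cintg (fun x => f x + g x).
Proof.
move=> [f1 f2] [g1 g2]; split; under [X in rint X]funext => x do rewrite raddfD /=; exact: rintD.
Qed.

Lemma Re_mulc (z w : C) : complex.Re (z * w) = complex.Re z * complex.Re w - complex.Im z * complex.Im w.
Proof. by case: z; case: w. Qed.
Lemma Im_mulc (z w : C) : complex.Im (z * w) = complex.Re z * complex.Im w + complex.Im z * complex.Re w.
Proof. by case: z; case: w. Qed.

Lemma Re_conj (z : C) : complex.Re (conjc z) = complex.Re z. Proof. by case: z. Qed.
Lemma Im_conj (z : C) : complex.Im (conjc z) = - complex.Im z. Proof. by case: z. Qed.

Lemma cintgZ f c : cintg f -> cintg (fun x => c * f x).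
Proof.
move=> [f1 f2]; split.
- under [X in rint X]funext => x do rewrite Re_mulc -mulNr; apply: rintD; exact: rintZ.
- under [X in rint X]funext => x do rewrite Im_mulc; apply: rintD; exact: rintZ.
Qed.

Lemma cintg_sum (T : Type) (s : seq T) (F : T -> R -> C) : (forall i, cintg (F i)) ->
  cintg (fun x => \sum_(i <- s) F i x).
Proof.
move=> h; elim: s => [|i s IH].
- under [X in cintg X]funext => x do rewrite big_nil.
  by split=> /=; exact: rint_cst.
- by under [X in cintg X]funext => x do rewrite big_cons; exact: cintgD.
Qed.

Lemma RintD (f g : R -> R) : rint f -> rint g ->
  \int[mu]_(x in I) (f x + g x) = \int[mu]_(x in I) f x + \int[mu]_(x in I) g x.
Proof. by move=> hf hg; exact: RintegralD. Qed.

Lemma RintZ (f : R -> R) c : rint f -> \int[mu]_(x in I) (c * f x) = c * \int[mu]_(x in I) f x.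
Proof. by move=> hf; exact: RintegralZl. Qed.

Lemma eq_cint f g : (forall x, f x = g x) -> cint X f = cint X g.
Proof. by move=> fg; rewrite (_ : f = g) //; exact/funext. Qed.

Lemma cintD f g : cintg f -> cintg g -> cint X (fun x => f x + g x) = cint X f + cint X g.
Proof.
move=> [f1 f2] [g1 g2]; apply/eqP; rewrite eq_complex /= -!RintD //; apply/andP; split;
by apply/eqP; apply: eq_Rintegral => x _; rewrite raddfD.
Qed.

Lemma cintZ f c : cintg f -> cint X (fun x => c * f x) = c * cint X f.
Proof.
move=> [f1 f2]; apply/eqP; rewrite eq_complex Re_mulc Im_mulc /= -mulNr -!RintZ // -!RintD //; try exact: rintZ.
by apply/andP; split; apply/eqP; apply: eq_Rintegral => x _; rewrite ?Re_mulc ?Im_mulc ?mulNr.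
Qed.

Lemma cint_sum (T : Type) (s : seq T) (F : T -> R -> C) : (forall i, cintg (F i)) ->
  cint X (fun x => \sum_(i <- s) F i x) = \sum_(i <- s) cint X (F i).
Proof.
move=> h; elim: s => [|i s IH].
- rewrite (eq_cint (g := fun=> 0)) ?big_nil; last by move=> x; rewrite big_nil.
  by apply/eqP; rewrite eq_complex /= !Rintegral_cst // !mul0r !eqxx.
- rewrite big_cons -IH -cintD //; last exact: cintg_sum.
  by apply: eq_cint => x; rewrite big_cons.
Qed.

Lemma cint_conj f : cintg f -> cint X (fun x => conjc (f x)) = conjc (cint X f).
Proof.
move=> [f1 f2]; apply/eqP; rewrite eq_complex /= -mulN1r -RintZ //.
by apply/andP; split; apply/eqP; apply: eq_Rintegral => x _; case: (f x) => a b //=; rewrite mulN1r.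
Qed.

(** [L2per] without periodicity: inner products and coefficients only see one period. *)
Definition Ltwo (f : R -> C) : Prop :=
  [/\ measurable_fun setT (fun x => complex.Re (f x)),
      measurable_fun setT (fun x => complex.Im (f x)) & rint (fun x => cabs (f x) ^+ 2)].

Lemma Ltwo_mul f g : Ltwo f -> Ltwo g -> cintg (fun x => f x * g x).
Proof.
move=> [f1 f2 f3] [g1 g2 g3].
have h x : cabs (f x * g x) <= cabs (f x) ^+ 2 + cabs (g x) ^+ 2.
  rewrite cabsM; have := cabs_ge0 (f x); have := cabs_ge0 (g x).
  by move: (cabs (f x)) (cabs (g x)) => a b; nra.
split; apply: (rint_dom _ (rintD f3 g3)).
- by under [X in measurable_fun _ X]funext => x do rewrite Re_mulc; apply: measurable_funB; exact: measurable_funM.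
- by move=> x; apply: le_trans (h x); exact: cabs_Re.
- by under [X in measurable_fun _ X]funext => x do rewrite Im_mulc; apply: measurable_funD; exact: measurable_funM.
- by move=> x; apply: le_trans (h x); exact: cabs_Im.
Qed.

Lemma measurable_cabs2 (f : R -> C) : measurable_fun setT (fun x => complex.Re (f x)) ->
  measurable_fun setT (fun x => complex.Im (f x)) -> measurable_fun setT (fun x => cabs (f x) ^+ 2).
Proof.
by move=> h1 h2; under [X in measurable_fun _ X]funext => x do rewrite cabsE; apply: measurable_funD; exact: measurable_funX.
Qed.

Lemma LtwoD f g : Ltwo f -> Ltwo g -> Ltwo (fun x => f x + g x).
Proof.
move=> [f1 f2 f3] [g1 g2 g3].
have mr : measurable_fun setT (fun x => complex.Re (f x + g x)).
  by under [X in measurable_fun _ X]funext => x do rewrite raddfD; exact: measurable_funD.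
have mi : measurable_fun setT (fun x => complex.Im (f x + g x)).
  by under [X in measurable_fun _ X]funext => x do rewrite raddfD; exact: measurable_funD.
split=> //; apply: (rint_dom _ (rintZ 2 (rintD f3 g3))) => [|x].
  exact: measurable_cabs2.
have := cabsD (f x) (g x); have := cabs_ge0 (f x + g x); rewrite ger0_norm ?sqr_ge0 //.
move: (cabs (f x)) (cabs (g x)) (cabs _) => a b c h1 h2.
have /le_trans -> // : c ^+ 2 <= (a + b) ^+ 2 by rewrite ler_sqr // nnegrE // (le_trans h1).
by have := sqr_ge0 (a - b); rewrite !sqrrD; nra.
Qed.

Lemma LtwoM_bounded (f g : R -> C) M : Ltwo f -> measurable_fun setT (fun x => complex.Re (g x)) ->
  measurable_fun setT (fun x => complex.Im (g x)) -> (forall x, cabs (g x) <= M) ->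
  Ltwo (fun x => g x * f x).
Proof.
move=> [f1 f2 f3] g1 g2 gM.
have mr : measurable_fun setT (fun x => complex.Re (g x * f x)).
  by under [X in measurable_fun _ X]funext => x do rewrite Re_mulc; apply: measurable_funB; exact: measurable_funM.
have mi : measurable_fun setT (fun x => complex.Im (g x * f x)).
  by under [X in measurable_fun _ X]funext => x do rewrite Im_mulc; apply: measurable_funD; exact: measurable_funM.
split=> //; apply: (rint_dom _ (rintZ (M ^+ 2) f3)) => [|x]; first exact: measurable_cabs2.
rewrite ger0_norm ?sqr_ge0 // cabsM exprMn ler_wpM2r ?sqr_ge0 //.
by rewrite ler_sqr ?nnegrE ?cabs_ge0 // (le_trans (cabs_ge0 (g x))).
Qed.

Lemma LtwoZ f c : Ltwo f -> Ltwo (fun x => c * f x).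
Proof. by move=> hf; apply: (@LtwoM_bounded _ (fun=> c) (cabs c)). Qed.

Lemma Ltwo0 : Ltwo (fun=> 0).
Proof. by split; [exact: measurable_cst|exact: measurable_cst|rewrite cabs0 expr0n; exact: rint_cst]. Qed.

Lemma Ltwo1 : Ltwo (fun=> 1).
Proof. by split; [exact: measurable_cst|exact: measurable_cst|rewrite cabs1 expr1n; exact: rint_cst]. Qed.

Lemma LtwoB f g : Ltwo f -> Ltwo g -> Ltwo (fun x => f x - g x).
Proof.
move=> hf hg; under [X in Ltwo X]funext => x do rewrite -[- g x]mulN1r.
by apply: LtwoD => //; exact: LtwoZ.
Qed.

Lemma Ltwo_sum (T : Type) (s : seq T) (F : T -> R -> C) : (forall i, Ltwo (F i)) ->
  Ltwo (fun x => \sum_(i <- s) F i x).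
Proof.
move=> h; elim: s => [|i s IH].
- by under [X in Ltwo X]funext => x do rewrite big_nil; exact: Ltwo0.
- by under [X in Ltwo X]funext => x do rewrite big_cons; exact: LtwoD.
Qed.

Lemma Ltwo_conj f : Ltwo f -> Ltwo (fun x => conjc (f x)).
Proof.
move=> [f1 f2 f3]; split.
- by under [X in measurable_fun _ X]funext => x do rewrite Re_conj.
- by under [X in measurable_fun _ X]funext => x do rewrite Im_conj; exact: measurableT_comp.
- by under [X in rint X]funext => x do rewrite cabs_conj.
Qed.

Lemma Ltwo_intg f : Ltwo f -> cintg f.
Proof.
move=> hf; have := Ltwo_mul Ltwo1 hf.
by under [X in cintg X]funext => x do rewrite mul1r.
Qed.

Lemma L2per_Ltwo f : L2per X f -> Ltwo f.
Proof. by case. Qed.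

Definition ip (f g : R -> C) : C := cint X (fun x => f x * conjc (g x)).
Definition nsq (f : R -> C) : R := \int[mu]_(x in I) (cabs (f x) ^+ 2).

Lemma ip_intg f g : Ltwo f -> Ltwo g -> cintg (fun x => f x * conjc (g x)).
Proof. by move=> hf /Ltwo_conj; exact: Ltwo_mul. Qed.

Lemma ipDl f g h : Ltwo f -> Ltwo g -> Ltwo h -> ip (fun x => f x + g x) h = ip f h + ip g h.
Proof.
move=> hf hg hh; rewrite /ip -cintD; try exact: ip_intg.
by apply: eq_cint => x; rewrite mulrDl.
Qed.

Lemma ipZl f h c : Ltwo f -> Ltwo h -> ip (fun x => c * f x) h = c * ip f h.
Proof.
move=> hf hh; rewrite /ip -cintZ; last exact: ip_intg.
by apply: eq_cint => x; rewrite mulrA.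
Qed.

Lemma ip_suml (T : Type) (s : seq T) (F : T -> R -> C) h : (forall i, Ltwo (F i)) -> Ltwo h ->
  ip (fun x => \sum_(i <- s) F i x) h = \sum_(i <- s) ip (F i) h.
Proof.
move=> hF hh; rewrite /ip -cint_sum; last by move=> i; exact: ip_intg.
by apply: eq_cint => x; rewrite mulr_suml.
Qed.

Lemma ipC f g : Ltwo f -> Ltwo g -> ip f g = conjc (ip g f).
Proof.
move=> hf hg; rewrite /ip -cint_conj; last exact: ip_intg.
by apply: eq_cint => x; rewrite rmorphM /= conjcK mulrC.
Qed.

Lemma ipE f : ip f f = (nsq f)%:C%C.
Proof.
apply/eqP; rewrite eq_complex /=; apply/andP; split; apply/eqP.
  by apply: eq_Rintegral => x _; rewrite mulcJ.
rewrite (eq_Rintegral mu (g := fun=> 0)) => [|x _]; last by rewrite mulcJ.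
by rewrite Rintegral_cst // mul0r.
Qed.

Lemma nsq_ge0 f : 0 <= nsq f.
Proof. by apply: Rintegral_ge0 => x _; exact: sqr_ge0. Qed.

Lemma nsqB f g : Ltwo f -> Ltwo g ->
  nsq (fun x => f x - g x) = nsq f - 2 * complex.Re (ip f g) + nsq g.
Proof.
move=> hf hg.
have hN : Ltwo (fun x => -1 * g x) by exact: LtwoZ.
have hB : Ltwo (fun x => f x + -1 * g x) by exact: LtwoD.
have -> : (fun x => f x - g x) = (fun x => f x + -1 * g x) by apply/funext => x; rewrite mulN1r.
have E : complex.Re (ip (fun x => f x + -1 * g x) (fun x => f x + -1 * g x)) = nsq (fun x => f x + -1 * g x) by rewrite ipE.
rewrite -E ipDl // ipZl // (ipC hf hB) (ipC hg hB) !ipDl // !ipZl // !ipE (ipC hg hf).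
by case: (ip f g) => a b /=; rewrite !mulN1r /=; ring.
Qed.

Lemma nsqZ f c : Ltwo f -> nsq (fun x => c * f x) = cabs c ^+ 2 * nsq f.
Proof.
move=> [_ _ hf]; rewrite /nsq -RintZ //.
by apply: eq_Rintegral => x _; rewrite cabsM exprMn.
Qed.

Lemma ip_CS f g : Ltwo f -> Ltwo g -> cabs (ip f g) ^+ 2 <= nsq f * nsq g.
Proof.
move=> hf hg.
have key (t : R) : 0 <= nsq f - 2 * (t * cabs (ip f g) ^+ 2) + t ^+ 2 * cabs (ip f g) ^+ 2 * nsq g.
  have hc := LtwoZ (t%:C%C * ip f g) hg.
  have := nsq_ge0 (fun x => f x - t%:C%C * ip f g * g x); rewrite nsqB // nsqZ // cabsM exprMn cabs_real real_normK ?num_real //.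
  rewrite (ipC hf hc) ipZl // (ipC hg hf) -mulrA mulcJ Re_conj Re_mulc [complex.Im _]/= mul0r subr0.
  exact.
have N0 := nsq_ge0 g; have Nf := nsq_ge0 f.
move: (nsq f) (nsq g) (cabs _ ^+ 2) (sqr_ge0 (cabs (ip f g))) key N0 Nf => a b p p0 key b0 a0.
have [b1|b1] := ltP 0 b; last first.
  have be : b = 0 by apply/eqP; rewrite eq_le b1 b0.
  rewrite be mulr0; rewrite leNgt; apply/negP => pp.
  have := key (a / p); rewrite be mulr0 addr0 divfK ?gt_eqF // => h.
  have := key ((a + 1) / p); rewrite be mulr0 addr0 divfK ?gt_eqF // => h'; lra.
have := key (b^-1); rewrite (_ : _ + _ = a - p / b); last by field; rewrite gt_eqF.
by rewrite subr_ge0 ler_pdivrMr.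
Qed.

End PeriodIntegral.

(** * Fourier modes, trigonometric polynomials and Bessel's inequality *)

Section Modes.
Variable R : realType.
Local Notation C := (R[i]).
Local Notation mu := (@lebesgue_measure R).
Variable X : R.
Hypothesis X0 : 0 < X.
Local Notation I := (`[0, X]%classic : set R).
Local Notation Ltwo := (Ltwo X).
Local Notation inner := (ip X).
Local Notation nsq := (nsq X).

Lemma expi0 : expi (0 : R) = 1. Proof. by rewrite /expi cos0 sin0. Qed.

Lemma expiD (a b : R) : expi (a + b) = expi a * expi b.
Proof. by rewrite /expi cosD sinD /GRing.mul /=; congr (_ +i* _)%C; rewrite addrC. Qed.

Lemma conj_expi (a : R) : conjc (expi a) = expi (- a).
Proof. by rewrite /expi cosN sinN. Qed.

Lemma cabs_expi (a : R) : cabs (expi a) = 1.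
Proof. by rewrite /cabs /= cos2Dsin2 sqrtr1. Qed.

Lemma expi_2pi (k : int) : expi (2 * pi * k%:~R : R) = 1.
Proof.
have nat_case (m : nat) : expi (2 * pi * m%:R : R) = 1.
  elim: m => [|m IH]; first by rewrite mulr0 expi0.
  rewrite -[m.+1]addn1 natrD mulrDr expiD IH mul1r mulr1 /expi.
  by rewrite [2 * pi]mulr_natl cos2pi sin2pi.
case: k => m; first exact: nat_case.
by rewrite NegzE mulrNz mulrN -conj_expi nat_case rmorph1.
Qed.

Definition mode (k : int) (x : R) : C := expi (2 * pi * k%:~R * x / X).

Arguments mode : simpl never.

Lemma mode_measurable k : measurable_fun setT (fun x => complex.Re (mode k x)) /\
  measurable_fun setT (fun x => complex.Im (mode k x)).
Proof.
split; rewrite /mode /=.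
- apply: (@measurableT_comp _ _ _ _ _ _ (@cos R)).
    by apply: continuous_measurable_fun; exact: continuous_cos.
  by apply: measurable_funM => //; exact: measurable_funM.
- apply: (@measurableT_comp _ _ _ _ _ _ (@sin R)).
    by apply: continuous_measurable_fun; exact: continuous_sin.
  by apply: measurable_funM => //; exact: measurable_funM.
Qed.

Lemma cabs_mode k x : cabs (mode k x) = 1.
Proof. exact: cabs_expi. Qed.

Lemma modeD j k x : mode (j + k) x = mode j x * mode k x.
Proof. by rewrite /mode -expiD intrD; congr expi; ring. Qed.

Lemma conj_mode k x : conjc (mode k x) = mode (- k) x.
Proof. by rewrite /mode conj_expi intrN; congr expi; ring. Qed.

Lemma mode0 x : mode 0 x = 1.
Proof. by rewrite /mode mulr0 !mul0r expi0. Qed.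

Lemma modeN k x : expi (- (2 * pi * k%:~R * x / X)) = mode (- k) x.
Proof. by rewrite -conj_mode conj_expi. Qed.

Lemma mode_periodic k x : mode k (x + X) = mode k x.
Proof.
rewrite /mode (_ : _ * (x + X) / X = 2 * pi * k%:~R * x / X + 2 * pi * k%:~R); first by rewrite expiD expi_2pi mulr1.
by field; rewrite gt_eqF.
Qed.

Lemma Ltwo_mulmode f k : Ltwo f -> Ltwo (fun x => f x * mode k x).
Proof.
move=> hf; have [m1 m2] := mode_measurable k.
under [X in Ltwo X]funext => x do rewrite mulrC.
by apply: (LtwoM_bounded (M := 1)) => // x; rewrite cabs_mode.
Qed.

Lemma Ltwo_mode k : Ltwo (mode k).
Proof.
have := Ltwo_mulmode k (Ltwo1 X).
by under [X in Ltwo X]funext => x do rewrite mul1r.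
Qed.

Lemma fcoefE f k : fcoef X f k = (X^-1)%:C%C * inner f (mode k).
Proof. by rewrite /fcoef; congr (_ * _); apply: eq_cint => x; rewrite modeN conj_mode. Qed.

Lemma Rint_derive0 (f F : R -> R) : continuous f -> (forall x : R, is_derive x 1 F (f x)) ->
  F X = F 0 -> \int[mu]_(x in I) f x = 0.
Proof.
move=> cf dF FX; rewrite /Rintegral (@continuous_FTC2 _ f F 0 X X0).
- by rewrite FX subee.
- exact: continuous_subspaceT.
- have cF x : {for x, continuous F}.
    by apply: differentiable_continuous; apply/derivable1_diffP; exact: ex_derive.
  split.
  + by move=> x _; exact: ex_derive.
  + by apply: cvg_at_right_filter; exact: cF.
  + by apply: cvg_at_left_filter; exact: cF.
- by move=> x _; rewrite derive1E; exact: derive_val.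
Qed.

Lemma cint_mode k : cint X (mode k) = if k == 0 then (X%:C)%C else 0.
Proof.
case: eqVneq => [->|k0].
  rewrite (eq_cint X (g := fun=> 1)) => [|x]; last by rewrite mode0.
  have muI : fine (mu I) = X by rewrite lebesgue_measure_itv /= lte_fin X0 /= subr0.
  have cstE c : \int[mu]_(x in I) c = c * X.
    by apply: (etrans (Rintegral_cst mu (measurable_itv _) c)); congr (c * _); exact: muI.
  by apply/eqP; rewrite eq_complex /= !cstE mul0r mul1r !eqxx.
pose w : R := 2 * pi * k%:~R / X.
have w0 : w != 0 by rewrite /w !mulf_neq0 ?invr_neq0 ?intr_eq0 ?pnatr_eq0 // gt_eqF ?pi_gt0.
have wX : w * X = 2 * pi * k%:~R by rewrite /w divfK // gt_eqF.
have modew x : mode k x = expi (w * x) by rewrite /mode /w; congr expi; ring.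
have dw (x : R) : is_derive x 1 ( *%R w) w.
  by apply: is_derive_eq; rewrite /GRing.scale /= mulr1.
have cw : continuous ( *%R w : R -> R).
  by move=> x; apply: differentiable_continuous; apply/derivable1_diffP; exact: ex_derive.
have := expi_2pi k; rewrite -wX /expi => /eqP; rewrite eq_complex /= => /andP[/eqP cX /eqP sX].
rewrite (eq_cint X modew); apply/eqP; rewrite eq_complex /=; apply/andP; split; apply/eqP.
- apply: (Rint_derive0 (F := fun x => w^-1 * sin (w * x))).
  + by move=> x; apply: continuous_comp; [exact: cw|exact: continuous_cos].
  + move=> x; have h : is_derive x 1 (@sin R \o *%R w) (cos (w * x) * w) by apply: is_derive1_comp.
    by have := is_deriveZ (w^-1) h; rewrite /GRing.scale /= [cos _ * w]mulrC mulKf.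
  + by rewrite sX !mulr0 sin0 mulr0.
- apply: (Rint_derive0 (F := fun x => - w^-1 * cos (w * x))).
  + by move=> x; apply: continuous_comp; [exact: cw|exact: continuous_sin].
  + move=> x; have h : is_derive x 1 (@cos R \o *%R w) (- sin (w * x) * w) by apply: is_derive1_comp.
    have := is_deriveZ (- w^-1) h; rewrite /GRing.scale /= mulrC -mulrA mulrN divff // mulrN1 opprK; exact.
  + by rewrite cX mulr0 cos0.
Qed.

Lemma ip_modeE j k : inner (mode j) (mode k) = if j == k then (X%:C)%C else 0.
Proof.
rewrite /ip (eq_cint X (g := mode (j - k))) => [|x]; last by rewrite conj_mode -modeD.
by rewrite cint_mode subr_eq0.
Qed.

Lemma fcoef_ext f g k : (forall x, f x = g x) -> fcoef X f k = fcoef X g k.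
Proof. by move=> fg; rewrite (_ : f = g) //; exact/funext. Qed.

Lemma fcoefD f g k : Ltwo f -> Ltwo g -> fcoef X (fun x => f x + g x) k = fcoef X f k + fcoef X g k.
Proof. by move=> hf hg; rewrite !fcoefE -mulrDr ipDl //; exact: Ltwo_mode. Qed.

Lemma fcoefZ f c k : Ltwo f -> fcoef X (fun x => c * f x) k = c * fcoef X f k.
Proof. by move=> hf; rewrite !fcoefE mulrCA ipZl //; exact: Ltwo_mode. Qed.

Lemma fcoefB f g k : Ltwo f -> Ltwo g -> fcoef X (fun x => f x - g x) k = fcoef X f k - fcoef X g k.
Proof.
move=> hf hg; rewrite (fcoef_ext (g := fun x => f x + -1 * g x)) => [|x]; last by rewrite mulN1r.
by rewrite fcoefD ?fcoefZ ?mulN1r //; exact: LtwoZ.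
Qed.

Lemma fcoef_sum (T : Type) (s : seq T) (F : T -> R -> C) k : (forall i, Ltwo (F i)) ->
  fcoef X (fun x => \sum_(i <- s) F i x) k = \sum_(i <- s) fcoef X (F i) k.
Proof.
move=> h; rewrite fcoefE ip_suml ?mulr_sumr //; last exact: Ltwo_mode.
by apply: eq_bigr => i _; rewrite fcoefE.
Qed.

Lemma fcoef_mode j k : fcoef X (mode j) k = (j == k)%:R.
Proof.
rewrite fcoefE ip_modeE; case: eqP => _; last by rewrite mulr0.
by rewrite -rmorphM mulVf ?rmorph1 // gt_eqF.
Qed.

Lemma fcoef_mulmode f j k : fcoef X (fun x => f x * mode j x) k = fcoef X f (k - j).
Proof.
rewrite /fcoef; congr (_ * _); apply: eq_cint => x.
by rewrite !modeN -mulrA -modeD; congr (_ * mode _ x); ring.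
Qed.

Lemma conjcM (z w : C) : conjc (z * w) = conjc z * conjc w.
Proof. exact: rmorphM. Qed.

Lemma conjc_scale (r : R) (w : C) : conjc (r%:C%C * w) = r%:C%C * conjc w.
Proof. by case: w => a b; apply/eqP; rewrite eq_complex /=; apply/andP; split; apply/eqP; ring. Qed.

Lemma fcoef_conj f k : Ltwo f -> fcoef X (fun x => conjc (f x)) k = conjc (fcoef X f (- k)).
Proof.
move=> hf; rewrite fcoefE [in RHS]fcoefE conjc_scale /ip -cint_conj; last by apply: ip_intg => //; exact: Ltwo_mode.
congr (_ * _).
by apply: eq_cint => x; rewrite conjcM conjcK !conj_mode.
Qed.

Lemma fcoef_bound f k : Ltwo f -> cabs (fcoef X f k) ^+ 2 <= nsq f / X.
Proof.
move=> hf; rewrite fcoefE cabsM exprMn cabs_real.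
have := ip_CS hf (Ltwo_mode k).
have -> : nsq (mode k) = X.
  have := ipE X (mode k); rewrite ip_modeE eqxx => /(congr1 (@complex.Re R)) /=; exact: esym.
move=> h; have Xi : 0 <= X^-1 by rewrite invr_ge0 ltW.
rewrite ger0_norm //.
rewrite (_ : nsq f / X = X^-1 ^+ 2 * (nsq f * X)); last by field; rewrite gt_eqF.
by apply: ler_wpM2l h; exact: sqr_ge0.
Qed.

(* The frequencies are enumerated 0, -1, 1, -2, 2, ... *)
Definition zk (b : nat) : int := if odd b then - (b.+1./2%:Z) else b./2%:Z.

Lemma zk_inj : injective zk.
Proof. by move=> a b; rewrite /zk; case: ifP; case: ifP; lia. Qed.

Lemma zk_surj k : exists b, zk b = k.
Proof.
case: k => m; first by exists m.*2; rewrite /zk odd_double doubleK.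
by exists m.*2.+1; rewrite /zk /= odd_double /= NegzE doubleK.
Qed.

(** This property motivates the enumeration: the frequencies of Hill's truncation are exactly an
    initial segment, so truncations become initial sections. *)
Lemma zk_ltn J b : (b < (2 * J).+1)%N = (absz (zk b) <= J)%N.
Proof. by rewrite /zk; case: ifP; lia. Qed.

Definition trigpoly (c : nat -> C) (B : nat) (x : R) : C := \sum_(b < B) c b * mode (zk b) x.

Lemma Ltwo_term (c : nat -> C) b : Ltwo (fun x => c b * mode (zk b) x).
Proof. by apply: LtwoZ; exact: Ltwo_mode. Qed.

Lemma Ltwo_trigpoly c B : Ltwo (trigpoly c B).
Proof. by apply: Ltwo_sum => i; exact: Ltwo_term. Qed.

Lemma fcoef_trigpoly c B b : fcoef X (trigpoly c B) (zk b) = if (b < B)%N then c b else 0.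
Proof.
rewrite /trigpoly fcoef_sum; last by move=> i; exact: Ltwo_term.
under eq_bigr => i _ do rewrite (fcoefZ _ _ (Ltwo_mode _)) fcoef_mode (inj_eq zk_inj).
case: ltnP => bB.
  rewrite (bigD1 (Ordinal bB)) //= eqxx mulr1 big1 ?addr0 // => i /negPf.
  by rewrite -val_eqE /= => ->; rewrite mulr0.
by rewrite big1 // => i _; rewrite ltn_eqF ?mulr0 // (leq_trans _ bB).
Qed.

Lemma ip_trigpoly f c B : Ltwo f ->
  inner f (trigpoly c B) = X%:C%C * \sum_(b < B) fcoef X f (zk b) * conjc (c b).
Proof.
move=> hf; rewrite ipC //; last exact: Ltwo_trigpoly.
rewrite ip_suml //; last by move=> i; exact: Ltwo_term.
rewrite rmorph_sum mulr_sumr; apply: eq_bigr => b _.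
rewrite -[LHS]/(conjc (inner (fun x => c b * mode (zk b) x) f)).
rewrite ipZl //; last exact: Ltwo_mode.
rewrite conjcM -ipC // ?fcoefE; try exact: Ltwo_mode.
by rewrite !mulrA -rmorphM mulfV ?gt_eqF // rmorph1 mul1r mulrC.
Qed.

Lemma nsq_trigpoly c B : nsq (trigpoly c B) = X * \sum_(b < B) cabs (c b) ^+ 2.
Proof.
have := ipE X (trigpoly c B); rewrite ip_trigpoly; last exact: Ltwo_trigpoly.
under eq_bigr => b _ do rewrite fcoef_trigpoly ltn_ord mulcJ.
by rewrite -rmorph_sum -rmorphM => /(congr1 (@complex.Re R)).
Qed.

Lemma nsq_residual f B : Ltwo f -> nsq (fun x => f x - trigpoly (fun b => fcoef X f (zk b)) B x) =
  nsq f - X * \sum_(b < B) cabs (fcoef X f (zk b)) ^+ 2.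
Proof.
move=> hf; rewrite nsqB ?nsq_trigpoly ?ip_trigpoly //; last exact: Ltwo_trigpoly.
under [X in complex.Re (_ * X)]eq_bigr => b _ do rewrite mulcJ.
by rewrite -rmorph_sum -rmorphM [complex.Re _]/=; ring.
Qed.

Lemma bessel f B : Ltwo f -> \sum_(b < B) cabs (fcoef X f (zk b)) ^+ 2 <= nsq f / X.
Proof.
move=> hf; have := nsq_ge0 X (fun x => f x - trigpoly (fun b => fcoef X f (zk b)) B x).
by rewrite nsq_residual // subr_ge0 ler_pdivlMr // mulrC.
Qed.

(** Bessel's inequality for conj(f) times mode k, whose coefficients are the conjugates of those of
    f at k - zk b. It makes the rows of the Toeplitz matrices square-summable. *)
Lemma bessel_row f k B : Ltwo f -> \sum_(b < B) cabs (fcoef X f (k - zk b)) ^+ 2 <= nsq f / X.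
Proof.
move=> hf; have hg : Ltwo (fun x => conjc (f x) * mode k x) by apply: Ltwo_mulmode; exact: Ltwo_conj.
have -> : nsq f = nsq (fun x => conjc (f x) * mode k x).
  by apply: eq_Rintegral => x _; rewrite cabsM cabs_conj cabs_mode mulr1.
apply: le_trans (bessel B hg); apply: ler_sum => b _.
by rewrite fcoef_mulmode fcoef_conj // cabs_conj opprB.
Qed.

End Modes.

(** * Uniqueness of Fourier coefficients *)

Section RealUniqueness.
Variable R : realType.
Local Notation mu := (@lebesgue_measure R).

Lemma bernoulli_le (y : R) N : 0 <= y <= 1 -> 1 - N%:R * y <= (1 - y) ^+ N.
Proof.
move=> /andP[y0 y1]; elim: N => [|N IH]; first by rewrite mul0r subr0 expr0.
rewrite exprSr; apply: (@le_trans _ _ ((1 - N%:R * y) * (1 - y))).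
  by rewrite -natr1; have := ler0n R N; nra.
by apply: ler_wpM2r => //; rewrite subr_ge0.
Qed.

(** N y <= (1 + y)^N, and (1 - y)(1 + y) <= 1. With y = s^n and N = 2^n it bounds [cutoff s n] by (2
    s)^-n; the lower bound 1 - (2 s)^n is Bernoulli's inequality. *)
Lemma expr_1B_le (y : R) N : 0 <= y <= 1 -> (1 - y) ^+ N * (N%:R * y) <= 1.
Proof.
move=> /andP[y0 y1]; apply: (@le_trans _ _ ((1 - y) ^+ N * (1 + y) ^+ N)).
  apply: ler_wpM2l; first by rewrite exprn_ge0 // subr_ge0.
  elim: N => [|N IH]; first by rewrite mul0r expr0 ler01.
  rewrite exprSr -natr1; apply: (@le_trans _ _ ((1 + y) ^+ N + y)).
    by rewrite mulrDl mul1r lerD2r.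
  have : 1 <= (1 + y) ^+ N by rewrite exprn_ege1 // lerDl.
  nra.
by rewrite -exprMn exprn_ile1 //; nra.
Qed.

(* Tends to 1 for s < 1/2 and to 0 for 1/2 < s <= 1, and is a polynomial in s (Brosowski--Deutsch). *)
Definition cutoff (s : R) (n : nat) : R := (1 - s ^+ n) ^+ (2 ^ n).

Lemma cutoff_itv s n : 0 <= s <= 1 -> 0 <= cutoff s n <= 1.
Proof.
move=> /andP[s0 s1]; have h0 : 0 <= s ^+ n by rewrite exprn_ge0.
have h1 : s ^+ n <= 1 by rewrite exprn_ile1.
by rewrite /cutoff exprn_ge0 ?subr_ge0 //= exprn_ile1 ?subr_ge0 // gerBl.
Qed.

Lemma cutoff_cvg1 s : 0 <= s < 1 / 2 -> cutoff s n @[n --> \oo] --> (1 : R).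
Proof.
move=> /andP[s0 s1]; apply: (@squeeze_cvgr _ _ _ _ (fun n => 1 - (2 * s) ^+ n) (fun=> 1)); last exact: cvg_cst.
- near=> n; have sI : 0 <= s <= 1 by rewrite s0 /=; lra.
  have /andP[_ ->] := cutoff_itv n sI; rewrite andbT exprMn.
  have := @bernoulli_le (s ^+ n) (2 ^ n); rewrite natrX; apply.
  by rewrite exprn_ge0 // exprn_ile1 //; lra.
- rewrite -[X in _ --> X]subr0; apply: cvgB; first exact: cvg_cst.
  by apply: cvg_expr; rewrite ger0_norm; lra.
Unshelve. all: by end_near. Qed.

Lemma cutoff_cvg0 s : 1 / 2 < s <= 1 -> cutoff s n @[n --> \oo] --> (0 : R).
Proof.
move=> /andP[s0 s1]; apply: (@squeeze_cvgr _ _ _ _ (fun=> 0) (fun n => ((2 * s)^-1) ^+ n)); first last.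
- by apply: cvg_expr; rewrite ger0_norm ?invr_ge0 ?invf_lt1; lra.
- exact: cvg_cst.
- near=> n; have sI : 0 <= s <= 1 by lra.
  have /andP[-> _] /= := cutoff_itv n sI.
  rewrite exprVn -[leRHS]div1r ler_pdivlMr ?exprn_gt0; last by lra.
  rewrite exprMn -natrX; apply: expr_1B_le.
  by rewrite exprn_ge0 ?exprn_ile1 //; lra.
Unshelve. all: by end_near. Qed.

Variable X : R.
Hypothesis X0 : 0 < X.
Local Notation I := (`[0, X]%classic : set R).

Lemma ae_notin_countable (N : set R) (P : R -> Prop) : countable N -> (forall x, ~ N x -> P x) ->
  {ae mu, forall x, P x}.
Proof.
move=> cN h; exists N; split.
- exact: countable_measurable.
- exact: countable_lebesgue_measure0.
- by move=> x /= nP; apply: contrapT => nN; exact: (nP (h x nN)).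
Qed.

(** Dominated convergence: off the points 0, b, X the cutoffs of s converge to the indicator of (0,
    b), with |u| as dominating function. *)
Lemma integral_cutoff_limit (u : R -> R) (s : R -> R) b : 0 < b < X ->
  measurable_fun setT u -> rint X u -> measurable_fun setT s -> (forall x, 0 <= s x <= 1) ->
  (forall x, 0 < x < b -> s x < 1 / 2) -> (forall x, b < x < X -> 1 / 2 < s x) ->
  (forall n, \int[mu]_(x in I) (cutoff (s x) n * u x) = 0) ->
  \int[mu]_(x in `[0, b]) u x = 0.
Proof.
move=> /andP[b0 bX] mu_u iu ms s01 sl sr h.
pose ub := u \_ (`[0, b]%classic : set R).
have mub : measurable_fun setT ub by apply/(measurable_restrictT _ _).1 => //; exact: measurable_funS mu_u.
have mphi n : measurable_fun setT (fun x => cutoff (s x) n).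
  by apply: measurable_funX; apply: measurable_funB => //; exact: measurable_funX.
have iphi n : rint X (fun x => cutoff (s x) n * u x).
  apply: (rint_dom (g := fun x => `|u x|)) => [| |x].
  - exact: measurable_funM.
  - exact: (integrable_norm iu).
  - rewrite normrM ger0_norm; last by case/andP: (cutoff_itv n (s01 x)).
    by apply: ler_piMl => //; case/andP: (cutoff_itv n (s01 x)).
have h1 n : measurable_fun I (fun x => (cutoff (s x) n * u x)%:E).
  exact: (measurable_int _ (iphi n)).
have h2 : measurable_fun I (fun x => (ub x)%:E).
  by apply/measurable_EFinP; exact: measurable_funS mub.
have h3 : {ae mu, forall x, I x -> (cutoff (s x) n * u x)%:E @[n --> \oo] --> (ub x)%:E}.
  apply: (@ae_notin_countable [set 0; b; X]); first exact: finite_set_countable.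
  move=> x nN; rewrite /= in_itv /= => /andP[x0 xX].
  have xx0 : 0 < x by rewrite lt_neqAle x0 andbT; apply/eqP => e; apply: nN; left; left.
  have xxX : x < X by rewrite lt_neqAle xX andbT; apply/eqP => e; apply: nN; right.
  apply: cvg_EFin; first by apply: nearW.
  have [xb|bx|xb] := ltgtP x b; last by case: nN; left; right.
  - rewrite /ub patchE mem_set /=; last by rewrite in_itv /= x0 ltW.
    rewrite -[X in _ --> X]mul1r; apply: cvgM; last exact: cvg_cst.
    apply: cutoff_cvg1.
    by case/andP: (s01 x) => -> _ /=; apply: sl; rewrite xx0.
  - rewrite /ub patchE memNset /=; last by rewrite in_itv /= x0 leNgt bx.
    rewrite -[X in _ --> X](mul0r (u x)); apply: cvgM; last exact: cvg_cst.
    apply: cutoff_cvg0.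
    by case/andP: (s01 x) => _ ->; rewrite andbT; apply: sr; rewrite bx.
have h4 : mu.-integrable I (fun x => `|u x|%:E) by exact: (integrable_norm iu).
have h5 : {ae mu, forall x n, I x -> (`|(cutoff (s x) n * u x)%:E| <= `|u x|%:E)%E}.
  apply: aeW => x n _; rewrite abse_EFin lee_fin normrM ger0_norm; last by case/andP: (cutoff_itv n (s01 x)).
  by apply: ler_piMl => //; case/andP: (cutoff_itv n (s01 x)).
have [_ _] := @dominated_convergence _ _ _ mu I (measurable_itv _) _ _ _ h1 h2 h3 h4 h5.
have -> : (fun n => (\int[mu]_(x in I) (cutoff (s x) n * u x)%:E)%E) = fun=> 0%E.
  apply/funext => n; rewrite -(fineK (integrable_fin_num _ (iphi n))) //.
  exact: (congr1 EFin (h n)).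
move=> /(cvg_unique _ (cvg_cst _)) e.
have : \int[mu]_(x in I) ub x = 0 by rewrite /Rintegral -e.
rewrite /ub -Rintegral_mkcondr => E; rewrite -[RHS]E; congr Rintegral; apply/seteqP; split => x /=.
  by rewrite !in_itv /= => /andP[x0 xb]; rewrite x0 xb (le_trans xb (ltW bX)).
by case.
Qed.

(** Lebesgue differentiation: u is almost everywhere the derivative of its primitive, here 0.
    Extending u by zero provides local integrability on the line. *)
Lemma ae_eq0_of_primitive (u : R -> R) : rint X u ->
  (forall b : R, 0 < b < X -> \int[mu]_(x in `[0, b]) u x = 0) ->
  {ae mu, forall x, I x -> u x = 0}.
Proof.
move=> iu h; pose v := u \_ I.
have iv : mu.-integrable setT (EFin \o v).
  have := (@integrable_mkcond _ _ _ mu I (EFin \o u) (measurable_itv _)).1 iu.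
  by rewrite restrict_EFin.
have lv : locally_integrable [set: R] v by exact: integrable_locally_restrict.
have iv' y : mu.-integrable [set` Interval (BLeft 0) (BRight y)] (EFin \o v).
  exact: (integrableS measurableT).
have H := FTC1 iv' lv.
have E : {ae mu, forall x, ~ [set 0; X] x} by apply: (@ae_notin_countable [set 0; X]) => //; exact: finite_set_countable.
refine (@filterS2 _ _ (ae_filter_ringOfSetsType mu) _ _ _ _ H E) => x Hx nN; rewrite /= in_itv /= => /andP[x0 xX].
have xx0 : 0 < x by rewrite lt_neqAle x0 andbT; apply/eqP => e; apply: nN; left.
have xxX : x < X by rewrite lt_neqAle xX andbT; apply/eqP => e; apply: nN; right.
case: Hx => [|_]; first by rewrite /= lte_fin.
have -> : v x = u x by rewrite /v patchE mem_set //= in_itv /= x0.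
move=> <-; rewrite derive1E (@near_eq_derive _ _ _ _ (cst 0)) ?derive_cst ?oner_neq0 //.
near=> y; transitivity (\int[mu]_(z in `[0, y]) u z); last first.
  by apply: h; apply/andP; split; near: y; [exact: lt_nbhsr|exact: lt_nbhsl].
rewrite /v -Rintegral_mkcondr; congr Rintegral; apply/seteqP; split => z /=; first by case.
rewrite !in_itv /= => /andP[z0 zy]; rewrite z0 zy (le_trans zy) //.
by apply: ltW; near: y; exact: lt_nbhsl.
Unshelve. all: by end_near. Qed.
End RealUniqueness.

(** * A function without Fourier coefficients vanishes almost everywhere *)

Section Uniqueness.
Variable R : realType.
Local Notation C := (R[i]).
Local Notation mu := (@lebesgue_measure R).
Variable X : R.
Hypothesis X0 : 0 < X.
Local Notation I := (`[0, X]%classic : set R).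
Variable f : R -> C.
Hypothesis Lf : Ltwo X f.
Hypothesis f_orth : forall k, fcoef X f k = 0.

(** Bounded weights that keep all coefficients of f zero. Boundedness keeps the product
    square-integrable, so linearity of the coefficients stays available. *)
Definition killed (phi : R -> R) : Prop :=
  [/\ measurable_fun setT phi, exists M, forall x, `|phi x| <= M &
      forall k, fcoef X (fun x => (phi x)%:C%C * f x) k = 0].

Lemma killed_Ltwo phi : killed phi -> Ltwo X (fun x => (phi x)%:C%C * f x).
Proof.
move=> [mp [M pM] _]; apply: (LtwoM_bounded (M := M)) => // x.
by rewrite cabs_real.
Qed.

(** Phrased as preservation of [killed], the property is closed under products and differences,
    hence under the polynomials [cutoff], with no expansion into modes. *)
Definition multiplier (g : R -> R) : Prop := forall phi, killed phi -> killed (fun x => g x * phi x).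

Lemma killed1 : killed (fun=> 1).
Proof.
split=> // [|k]; first by exists 1 => x; rewrite normr1.
by rewrite (@fcoef_ext _ X _ f) // => x; rewrite mul1r.
Qed.

Lemma multiplier1 : multiplier (fun=> 1).
Proof. by move=> phi; under [X in _ -> killed X]funext => x do rewrite mul1r. Qed.

Lemma multiplierM g h : multiplier g -> multiplier h -> multiplier (fun x => g x * h x).
Proof.
by move=> hg hh phi p; under [X in killed X]funext => x do rewrite -mulrA; apply: hg; exact: hh.
Qed.

Lemma multiplierX g n : multiplier g -> multiplier (fun x => g x ^+ n).
Proof.
move=> hg; elim: n => [|n IH].
  by under [X in multiplier X]funext => x do rewrite expr0; exact: multiplier1.
by under [X in multiplier X]funext => x do rewrite exprS; exact: multiplierM.
Qed.

Lemma killedB phi psi : killed phi -> killed psi -> killed (fun x => phi x - psi x).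
Proof.
move=> k1 k2; have l1 := killed_Ltwo k1; have l2 := killed_Ltwo k2.
case: k1 => m1 [M1 b1] h1; case: k2 => m2 [M2 b2] h2; split; first exact: measurable_funB.
  by exists (M1 + M2) => x; apply: (le_trans (ler_normB _ _)); exact: lerD.
move=> k; rewrite (@fcoef_ext _ X _ (fun x => (phi x)%:C%C * f x - (psi x)%:C%C * f x)).
  by rewrite fcoefB // h1 h2 subr0.
by move=> x; rewrite rmorphB mulrBl.
Qed.

Lemma multiplierB g h : multiplier g -> multiplier h -> multiplier (fun x => g x - h x).
Proof.
by move=> hg hh phi p; under [X in killed X]funext => x do rewrite mulrBl; apply: killedB; [exact: hg|exact: hh].
Qed.

Section Separator.
Variable b : R.
Local Notation beta := (pi * b / X).

(* A trigonometric polynomial of degree 1 lying below 1/2 on (0, b) and above 1/2 on (b, X),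
   see separatorE; its cutoffs approximate the indicator of (0, b). *)
Definition separator (x : R) : R := 1 / 2 + (cos beta - cos (2 * pi * 1 * x / X - beta)) / 4.

Lemma separatorE x : separator x = (1 + sin (pi * x / X) * sin (pi * (x - b) / X)) / 2.
Proof.
rewrite /separator.
have -> : 2 * pi * 1 * x / X - beta = pi * x / X + pi * (x - b) / X by ring.
have -> : beta = pi * x / X - pi * (x - b) / X by ring.
by rewrite cosB cosD; field.
Qed.

Lemma separator_itv x : 0 <= separator x <= 1.
Proof.
rewrite /separator; move: (cos_le1 beta) (cos_geN1 beta) (cos_le1 (2 * pi * 1 * x / X - beta)) (cos_geN1 (2 * pi * 1 * x / X - beta)).
by move: (cos _) (cos _) => u v; lra.
Qed.

Lemma separator_measurable : measurable_fun setT separator.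
Proof.
apply: measurable_funD => //; apply: measurable_funM => //; apply: measurable_funB => //.
apply: (@measurableT_comp _ _ _ _ _ _ (@cos R)).
  by apply: continuous_measurable_fun; exact: continuous_cos.
by apply: measurable_funB => //; apply: measurable_funM => //; exact: measurable_funM.
Qed.

Lemma separator_modes x : (separator x)%:C%C = (1 / 2 + cos beta / 4)%:C%C
  - (8^-1)%:C%C * expi (- beta) * mode X 1 x - (8^-1)%:C%C * expi beta * mode X (- 1) x.
Proof.
rewrite -conj_mode /separator /mode -conj_expi /expi cosB.
apply/eqP; rewrite eq_complex /=; apply/andP; split; apply/eqP; rewrite ?mulr1z; field => //.
Qed.

(** The separator combines the modes 0, 1 and -1 only, and multiplication by a mode shifts
    coefficients that all vanish. *)
Lemma multiplier_separator : multiplier separator.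
Proof.
move=> phi kp; have lp := killed_Ltwo kp; case: kp => mp [M pM] hp; split.
- by apply: measurable_funM => //; exact: separator_measurable.
- exists M => x; have /andP[s0 s1] := separator_itv x.
  by rewrite normrM ger0_norm // (le_trans _ (pM x)) // ler_piMl.
- move=> k; pose c1 := (1 / 2 + cos beta / 4)%:C%C : C.
  pose c2 : C := (8^-1)%:C%C * expi (- beta); pose c3 : C := (8^-1)%:C%C * expi beta.
  pose h x : C := (phi x)%:C%C * f x.
  have m1 := Ltwo_mulmode 1 lp; have m2 := Ltwo_mulmode (- 1) lp.
  rewrite (@fcoef_ext _ X _ (fun x => c1 * h x - c2 * (h x * mode X 1 x) - c3 * (h x * mode X (- 1) x))).
    rewrite fcoefB; [|apply: LtwoB; exact: LtwoZ|exact: LtwoZ].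
    rewrite fcoefB; [|exact: LtwoZ|exact: LtwoZ].
    by rewrite !fcoefZ // !fcoef_mulmode !hp !mulr0 !subr0.
  move=> x; rewrite [LHS](_ : _ = (separator x)%:C%C * (phi x)%:C%C * f x); last by rewrite rmorphM.
  by rewrite separator_modes /h -/c1 -/c2 -/c3; ring.
Qed.

Lemma killed_cutoff n : killed (fun x => cutoff (separator x) n).
Proof.
have := multiplierX (2 ^ n) (multiplierB multiplier1 (multiplierX n multiplier_separator)) killed1.
by under [X in killed X -> _]funext => x do rewrite mulr1.
Qed.

Hypothesis bX : 0 < b < X.

Lemma separator_lt x : 0 < x < b -> separator x < 1 / 2.
Proof.
move=> /andP[x0 xb]; rewrite separatorE; case/andP: bX => b0 b1; have P := pi_gt0 R.
have s1 : 0 < sin (pi * x / X).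
  by apply: sin_gt0_pi; rewrite divr_gt0 ?mulr_gt0 //= ltr_pdivrMr // ltr_pM2l //; exact: lt_trans b1.
have s2 : sin (pi * (x - b) / X) < 0.
  have -> : pi * (x - b) / X = - (pi * (b - x) / X) by ring.
  rewrite sinN oppr_lt0; apply: sin_gt0_pi.
  by rewrite divr_gt0 ?mulr_gt0 ?subr_gt0 //= ltr_pdivrMr // ltr_pM2l //; lra.
nra.
Qed.

Lemma separator_gt x : b < x < X -> 1 / 2 < separator x.
Proof.
move=> /andP[x0 xb]; rewrite separatorE; case/andP: bX => b0 b1; have P := pi_gt0 R.
have s1 : 0 < sin (pi * x / X).
  have x1 := lt_trans b0 x0.
  apply: sin_gt0_pi; rewrite divr_gt0 ?mulr_gt0 //= ltr_pdivrMr //.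
  by rewrite ltr_pM2l.
have s2 : 0 < sin (pi * (x - b) / X).
  apply: sin_gt0_pi.
  by rewrite divr_gt0 ?mulr_gt0 ?subr_gt0 //= ltr_pdivrMr // ltr_pM2l //; lra.
nra.
Qed.

End Separator.

Lemma cint_killed (phi : R -> R) : killed phi ->
  \int[mu]_(x in I) (phi x * complex.Re (f x)) = 0 /\ \int[mu]_(x in I) (phi x * complex.Im (f x)) = 0.
Proof.
move=> [_ _ /(_ 0)]; rewrite /fcoef => /eqP; rewrite mulf_eq0 => /orP[|].
  by rewrite eq_complex /= invr_eq0 gt_eqF.
rewrite eq_complex /= => /andP[/eqP h1 /eqP h2].
have m0 x : expi (- (2 * pi * 0 * x / X)) = 1 by rewrite mulr0 !mul0r oppr0 expi0.
split; [rewrite -[RHS]h1|rewrite -[RHS]h2]; apply: eq_Rintegral => x _; rewrite m0 mulr1.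
- by case: (f x) => a c /=; ring.
- by case: (f x) => a c /=; ring.
Qed.

(** The zeroth coefficients of the killed products say that the real and imaginary parts of f are
    orthogonal to all cutoffs of the separator, hence have zero integral over every [0, b]. No
    density theorem for trigonometric polynomials is needed. *)
Theorem fcoef_unique : {ae mu, forall x, I x -> f x = 0}.
Proof.
have [f1 f2 f3] := Lf; have [i1 i2] := Ltwo_intg Lf.
have h1 : {ae mu, forall x, I x -> complex.Re (f x) = 0}.
  apply: (ae_eq0_of_primitive i1) => b bX.
  apply: (integral_cutoff_limit bX f1 i1 (separator_measurable b) (separator_itv b) (separator_lt bX) (separator_gt bX)).
  by move=> n; have [] := cint_killed (killed_cutoff b n).
have h2 : {ae mu, forall x, I x -> complex.Im (f x) = 0}.
  apply: (ae_eq0_of_primitive i2) => b bX.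
  apply: (integral_cutoff_limit bX f2 i2 (separator_measurable b) (separator_itv b) (separator_lt bX) (separator_gt bX)).
  by move=> n; have [] := cint_killed (killed_cutoff b n).
refine (@filterS2 _ _ (ae_filter_ringOfSetsType mu) _ _ _ _ h1 h2) => x e1 e2 Ix.
by apply/eqP; rewrite eq_complex /= e1 // e2 // eqxx.
Qed.

End Uniqueness.

(** * The Riesz--Fischer theorem *)

Section BoundedIntegrals.
Variable R : realType.
Local Notation C := (R[i]).
Local Notation mu := (@lebesgue_measure R).
Variable X : R.
Local Notation I := (`[0, X]%classic : set R).

Lemma integral_rintE (g : R -> R) : rint X g ->
  (\int[mu]_(x in I) (g x)%:E)%E = (\int[mu]_(x in I) g x)%:E.
Proof. by move=> hg; rewrite -(fineK (integrable_fin_num _ hg)). Qed.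

Variables (g : nat -> R -> R) (M : R).
Hypothesis mg : forall n, measurable_fun setT (g n).
Hypothesis g0 : forall n x, 0 <= g n x.
Hypothesis ig : forall n, rint X (g n).
Hypothesis gM : forall n, \int[mu]_(x in I) g n x <= M.

Lemma measurable_EFinI (h : R -> R) : measurable_fun setT h -> measurable_fun I (fun x => (h x)%:E).
Proof. by move=> mh; apply/measurable_EFinP; exact: measurable_funS mh. Qed.

Lemma measurable_liminf : measurable_fun I (fun x => limn_einf (fun n => (g n x)%:E)).
Proof.
rewrite /limn_einf; apply: measurableT_comp => //.
apply: measurable_fun_limn_esup => n; apply: measurableT_comp => //; exact: measurable_EFinI.
Qed.

Lemma liminf_ge0 x : (0 <= limn_einf (fun n => (g n x)%:E))%E.
Proof.
rewrite limn_einf_lim; apply: lime_ge; first exact: is_cvg_einfs.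
by apply: nearW => n; apply: le_ereal_inf_tmp => _ [k _ <-]; rewrite lee_fin.
Qed.

Lemma liminf_bound : (\int[mu]_(x in I) limn_einf (fun n => (g n x)%:E) <= M%:E)%E.
Proof.
have h1 n : measurable_fun I (fun x => (g n x)%:E) by exact: measurable_EFinI.
have h2 n (x : R) : I x -> (0 <= (g n x)%:E)%E by rewrite lee_fin.
apply: (le_trans (@fatou _ _ _ mu I (measurable_itv _) _ h1 h2)).
rewrite limn_einf_lim; apply: lime_le; first exact: is_cvg_einfs.
apply: nearW => n; apply: (@le_trans _ _ (\int[mu]_(x in I) (g n x)%:E)%E).
  by apply: ereal_inf_lbound; exists n => //=.
by rewrite integral_rintE // lee_fin.
Qed.

Lemma liminf_integrable : mu.-integrable I (fun x => limn_einf (fun n => (g n x)%:E)).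
Proof.
apply/integrableP; split; first exact: measurable_liminf.
under eq_integral => x _ do rewrite gee0_abs ?liminf_ge0 //.
exact: (le_lt_trans liminf_bound (ltry _)).
Qed.

Lemma liminf_fin : {ae mu, forall x, I x -> limn_einf (fun n => (g n x)%:E) \is a fin_num}.
Proof. exact: (@integrable_ae _ _ _ mu I (measurable_itv _) _ liminf_integrable). Qed.

Lemma limit_bound (h : R -> R) : measurable_fun setT h -> (forall x, 0 <= h x) ->
  {ae mu, forall x, I x -> g n x @[n --> \oo] --> h x} ->
  rint X h /\ \int[mu]_(x in I) h x <= M.
Proof.
move=> mh h0 gh.
have E : (\int[mu]_(x in I) (h x)%:E)%E = (\int[mu]_(x in I) limn_einf (fun n => (g n x)%:E))%E.
  apply: (@ae_eq_integral _ _ _ mu I _ _ (measurable_itv _)).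
  - exact: measurable_EFinI.
  - exact: measurable_liminf.
  refine (@filterS _ _ (ae_filter_ringOfSetsType mu) _ _ _ gh) => x hx Ix.
  have /cvg_limn_einf_sup[-> _] // : (g n x)%:E @[n --> \oo] --> (h x)%:E.
  by apply: cvg_EFin; [exact: nearW|exact: hx].
have ih : rint X h.
  apply/integrableP; split; first exact: measurable_EFinI.
  under eq_integral => x _ do rewrite gee0_abs ?lee_fin //.
  by rewrite E; exact: (le_lt_trans liminf_bound (ltry _)).
by split=> //; rewrite -lee_fin -integral_rintE // E liminf_bound.
Qed.

End BoundedIntegrals.

Lemma bounded_variation_cvg (R : realType) (u : nat -> R) b :
  (forall n, \sum_(j < n) `|u j.+1 - u j| <= b) -> cvgn u.
Proof.
move=> h; pose v j := u j.+1 - u j.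
have cv : cvgn (series v).
  apply: normed_cvg; apply: nondecreasing_is_cvgn.
    by apply: nondecreasing_series => n _ _; exact: normr_ge0.
  by exists b => _ [n _ <-]; have := h n; rewrite -(big_mkord xpredT (fun j => `|u j.+1 - u j|)).
have -> : u = fun n => series v n + u 0%N.
  by apply/funext => n; have e : series v n = u n - u 0%N := telescope_sumr u (leq0n n); rewrite e subrK.
by apply: is_cvgD => //; exact: is_cvg_cst.
Qed.

Section RieszFischer.
Variable R : realType.
Local Notation C := (R[i]).
Local Notation mu := (@lebesgue_measure R).
Variable X : R.
Hypothesis X0 : 0 < X.
Local Notation I := (`[0, X]%classic : set R).

Lemma rint_sum n (F : nat -> R -> R) : (forall i, rint X (F i)) ->
  rint X (fun x => \sum_(i < n) F i x).
Proof.
move=> h; elim: n => [|n IH].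
  by under [Y in rint _ Y]funext => x do rewrite big_ord0; exact: rint_cst.
by under [Y in rint _ Y]funext => x do rewrite big_ord_recr; exact: rintD.
Qed.

Lemma Rint_sum n (F : nat -> R -> R) : (forall i, rint X (F i)) ->
  \int[mu]_(x in I) (\sum_(i < n) F i x) = \sum_(i < n) \int[mu]_(x in I) F i x.
Proof.
move=> h; elim: n => [|n IH].
  rewrite big_ord0 (eq_Rintegral mu (g := fun=> 0)) => [|x _]; last by rewrite big_ord0.
  by rewrite Rintegral_cst // mul0r.
rewrite big_ord_recr /= -IH -RintD //; last exact: rint_sum.
by apply: eq_Rintegral => x _; rewrite big_ord_recr.
Qed.

Lemma Rint_cst (c : R) : \int[mu]_(x in I) c = c * X.
Proof.
have muI : fine (mu I) = X by rewrite lebesgue_measure_itv /= lte_fin X0 /= subr0.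
by apply: (etrans (Rintegral_cst mu (measurable_itv _) c)); congr (c * _); exact: muI.
Qed.

Lemma nsq_trigpolyB (c : nat -> C) B B' : (B <= B')%N ->
  nsq X (fun x => trigpoly X c B' x - trigpoly X c B x) = X * \sum_(B <= b < B') cabs (c b) ^+ 2.
Proof.
move=> BB; pose c' b := if (b < B)%N then 0 else c b.
have -> : (fun x => trigpoly X c B' x - trigpoly X c B x) = trigpoly X c' B'.
  apply/funext => x; rewrite /trigpoly.
  rewrite -!(big_mkord xpredT (fun b => _ b * mode X (zk b) x)) (big_cat_nat (leq0n B) BB) /=.
  rewrite [in RHS](big_cat_nat (leq0n B) BB) /= addrAC subrr add0r.
  rewrite [X in _ = X + _]big_nat_cond [X in _ = X + _]big1 ?add0r.
    by rewrite !big_nat; apply: eq_bigr => b /andP[bB _]; rewrite /c' ltnNge bB.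
  by move=> b /andP[/andP[_ bB] _]; rewrite /c' bB mul0r.
rewrite nsq_trigpoly //; congr (X * _).
rewrite -(big_mkord xpredT (fun b => cabs (c' b) ^+ 2)) (big_cat_nat (leq0n B) BB) /=.
rewrite [Y in Y + _]big_nat_cond [Y in Y + _]big1 ?add0r.
  by rewrite !big_nat; apply: eq_bigr => b /andP[bB _]; rewrite /c' ltnNge bB.
by move=> b /andP[/andP[_ bB] _]; rewrite /c' bB cabs0 expr0n.
Qed.

Lemma sum_halves n : \sum_(i < n) (2^-1 : R) ^+ i <= 2.
Proof.
suff -> : \sum_(i < n) (2^-1 : R) ^+ i = 2 - 2 * 2^-1 ^+ n by rewrite gerBl mulr_ge0 // exprn_ge0.
elim: n => [|n IH]; first by rewrite big_ord0 expr0 mulr1 subrr.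
by rewrite big_ord_recr /= IH exprS; field.
Qed.

Variables (c : nat -> C) (M : R).
Hypothesis c_ell2 : forall K, \sum_(b < K) cabs (c b) ^+ 2 <= M.

Lemma fast_truncation : exists N : nat -> nat, [/\ forall j, (j <= N j)%N,
  {homo N : i j / (i <= j)%N} &
  forall j K, \sum_(N j <= b < K) cabs (c b) ^+ 2 <= 4^-1 ^+ j].
Proof.
have h j : exists N0, forall K K', (N0 <= K)%N -> \sum_(K <= b < K') cabs (c b) ^+ 2 < (4^-1 : R) ^+ j.
  by apply: (bounded_series_tail (M := M)) => [b|//|]; rewrite ?sqr_ge0 ?exprn_gt0.
have [N0 hN0] := choice h.
(* Summation makes N monotone and at least N0 j; the added 1 ensures j <= N j. *)
pose N j := (\sum_(i < j.+1) (N0 i + 1))%N.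
have NS j : N j.+1 = (N j + (N0 j.+1 + 1))%N by rewrite /N big_ord_recr.
exists N; split.
- by elim=> [//|j IH]; rewrite NS; lia.
- by apply: homo_leq => [//|? ? ?|j]; [exact: leq_trans|rewrite NS leq_addr].
- move=> j K; apply: ltW; apply: hN0.
  by rewrite /N big_ord_recr /=; lia.
Qed.

Lemma trigpoly_periodic B x : trigpoly X c B (x + X) = trigpoly X c B x.
Proof. by apply: eq_bigr => b _; rewrite mode_periodic. Qed.

Theorem riesz_fischer : exists f, [/\ L2per X f, forall b, fcoef X f (zk b) = c b &
  forall e, 0 < e -> exists B0, forall B, (B0 <= B)%N -> nsq X (fun x => f x - trigpoly X c B x) < e].
Proof.
have [N [jN Nmono Nt]] := fast_truncation.
pose S j := trigpoly X c (N j).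
have LS j : Ltwo X (S j) by exact: Ltwo_trigpoly.
have LD j m : Ltwo X (fun x => S (j + m)%N x - S m x) by exact: LtwoB.
have mD j m : measurable_fun setT (fun x => cabs (S (j + m)%N x - S m x) ^+ 2).
  by have [? ? _] := LD j m; exact: measurable_cabs2.
have nD j m : nsq X (fun x => S (j + m)%N x - S m x) <= X * 4^-1 ^+ m.
  by rewrite nsq_trigpolyB ?ler_pM2l //; apply: Nmono; exact: leq_addl.
(* By the arithmetic-geometric inequality h_j dominates |S_(j+1) - S_j|, while its integral is at
   most 2 X 2^-j because the squared distance is at most X 4^-j. Finiteness of the sum of the h_j
   almost everywhere gives pointwise convergence. *)
pose h j x := (2^-1 : R) ^+ j + 2 ^+ j * cabs (S (1 + j)%N x - S j x) ^+ 2.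
have h0 j x : 0 <= h j x by apply: addr_ge0; [apply: exprn_ge0; rewrite invr_ge0 ler0n|apply: mulr_ge0; [exact: exprn_ge0|exact: sqr_ge0]].
have ih j : rint X (h j).
  by apply: rintD; [exact: rint_cst|apply: rintZ; case: (LD 1%N j)].
have intd j : rint X (fun x => cabs (S (1 + j)%N x - S j x) ^+ 2) by case: (LD 1%N j).
have intM j : \int[mu]_(x in I) h j x <= 2 * X * 2^-1 ^+ j.
  rewrite /h RintD; [|exact: rint_cst|exact: rintZ].
  rewrite Rint_cst RintZ //.
  have := nD 1%N j; rewrite /nsq; move: (\int[mu]_(x in I) _) => y hy.
  have : 2 ^+ j * y <= 2 ^+ j * (X * 4^-1 ^+ j) by rewrite ler_pM2l ?exprn_gt0.
  have -> : 2 ^+ j * (X * 4^-1 ^+ j) = X * (2^-1 : R) ^+ j.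
    by rewrite mulrCA -exprMn; congr (_ * _ ^+ _); field.
  lra.
pose G n x := \sum_(j < n) h j x.
have mG n : measurable_fun setT (G n).
  have mh j : measurable_fun setT (h j).
    apply: measurable_funD; first exact: measurable_cst.
    by apply: measurable_funM; [exact: measurable_cst|exact: (mD 1%N j)].
  by rewrite /G; under [Y in measurable_fun _ Y]funext => x do rewrite -(big_mkord xpredT (fun j => h j x)); apply: measurable_sum.
have G0 n x : 0 <= G n x by apply: sumr_ge0 => j _; exact: h0.
have iG n : rint X (G n) by exact: rint_sum.
have GM n : \int[mu]_(x in I) G n x <= 4 * X.
  rewrite Rint_sum //; apply: (@le_trans _ _ (\sum_(j < n) 2 * X * 2^-1 ^+ j)).
    by apply: ler_sum => j _; exact: intM.
  rewrite -mulr_sumr; have := sum_halves n; have := X0; nra.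
have Gfin := liminf_fin mG G0 iG GM.
have cvS : {ae mu, forall x, I x -> cvgn (fun j => complex.Re (S j x)) /\ cvgn (fun j => complex.Im (S j x))}.
  refine (@filterS _ _ (ae_filter_ringOfSetsType mu) _ _ _ Gfin) => x fx Ix.
  have {fx} := fx Ix; set l := limn_einf _ => fl.
  have Gl m : G m x <= fine l.
    rewrite -lee_fin fineK // /l limn_einf_lim; apply: lime_ge; first exact: is_cvg_einfs.
    exists m => // n /= mn; apply: le_ereal_inf_tmp => _ [k nk <-]; rewrite lee_fin.
    rewrite /G -!(big_mkord xpredT (fun j => h j x)).
    rewrite (big_cat_nat (leq0n m) (leq_trans mn nk)) /= lerDl.
    by apply: sumr_ge0 => j _; exact: h0.
  have Dh j : cabs (S j.+1 x - S j x) <= h j x.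
    rewrite /h add1n; set d := cabs _; have p : 0 < (2 : R) ^+ j by rewrite exprn_gt0.
    have -> : (2^-1 : R) ^+ j + 2 ^+ j * d ^+ 2 = d + (2^-1 ^+ j - d + 2 ^+ j * d ^+ 2) by ring.
    rewrite lerDl -(pmulr_rge0 _ p) exprVn.
    have -> : 2 ^+ j * (2 ^- j - d + 2 ^+ j * d ^+ 2) = 1 - 2 ^+ j * d + (2 ^+ j * d) ^+ 2.
      by field; rewrite gt_eqF.
    by move: (2 ^+ j * d) => y; nra.
  split; apply: (@bounded_variation_cvg _ _ (fine l)) => n; apply: le_trans (Gl n);
    apply: ler_sum => j _; apply: le_trans (Dh j).
  - by rewrite -raddfB cabs_Re.
  - by rewrite -raddfB cabs_Im.
(* Taking [fine] of an upper limit defines f at every point, so measurability and exact periodicity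
   hold without an exceptional set. *)
pose f x := Complex (fine (limn_esup (fun j => (complex.Re (S j x))%:E)))
                    (fine (limn_esup (fun j => (complex.Im (S j x))%:E))) : C.
have mRe : measurable_fun setT (fun x => complex.Re (f x)).
  rewrite /f /=; apply: measurableT_comp => //; apply: measurable_fun_limn_esup => n.
  by apply/measurable_EFinP; case: (LS n).
have mIm : measurable_fun setT (fun x => complex.Im (f x)).
  rewrite /f /=; apply: measurableT_comp => //; apply: measurable_fun_limn_esup => n.
  by apply/measurable_EFinP; case: (LS n).
have per x : f (x + X) = f x.
  have SX : S^~ (x + X) = S^~ x by apply/funext => j; exact: trigpoly_periodic.
  have h1 j := congr1 (fun F : nat -> C => complex.Re (F j)) SX.
  have h2 j := congr1 (fun F : nat -> C => complex.Im (F j)) SX.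
  by rewrite /f; congr (_ +i* _)%C; congr (fine (limn_esup _)); apply/funext => j; [rewrite -h1|rewrite -h2].
have cvf : {ae mu, forall x, I x -> complex.Re (S j x) @[j --> \oo] --> complex.Re (f x) /\ complex.Im (S j x) @[j --> \oo] --> complex.Im (f x)}.
  refine (@filterS _ _ (ae_filter_ringOfSetsType mu) _ _ _ cvS) => x cx Ix.
  have lim_fine (u : nat -> R) : cvgn u -> u j @[j --> \oo] --> fine (limn_esup (fun j => (u j)%:E)).
    move=> /cvg_ex[l ul]; have /cvg_limn_einf_sup[_ ->] // : (u j)%:E @[j --> \oo] --> l%:E.
    by apply: cvg_EFin; [exact: nearW|].
  by have [c1 c2] := cx Ix; split; exact: lim_fine.
(* Fatou's lemma along n for |S_(n+m) - S_m|^2 gives the L2 distance of the pointwise limit to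
   S_m. *)
have bound m : rint X (fun x => cabs (f x - S m x) ^+ 2) /\ nsq X (fun x => f x - S m x) <= X * 4^-1 ^+ m.
  apply: (@limit_bound _ _ (fun n x => cabs (S (n + m)%N x - S m x) ^+ 2)).
  - by move=> n; exact: mD.
  - by move=> n x; exact: sqr_ge0.
  - by move=> n; case: (LD n m).
  - by move=> n; exact: nD.
  - have [s1 s2 _] := LS m; apply: measurable_cabs2.
    + by under [Y in measurable_fun _ Y]funext => x do rewrite raddfB; exact: measurable_funB.
    + by under [Y in measurable_fun _ Y]funext => x do rewrite raddfB; exact: measurable_funB.
  - by move=> x; exact: sqr_ge0.
  refine (@filterS _ _ (ae_filter_ringOfSetsType mu) _ _ _ cvf) => x cx Ix; have [c1 c2] := cx Ix.
  have sq (u : nat -> R) (l : R) : u j @[j --> \oo] --> l -> u j ^+ 2 @[j --> \oo] --> l ^+ 2.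
    by move=> ul; rewrite expr2; under eq_fun => j do rewrite expr2; exact: cvgM.
  rewrite cabsE; under eq_fun => n do rewrite cabsE !raddfB.
  rewrite !raddfB; apply: cvgD; apply: sq; apply: cvgB; try exact: cvg_cst.
  - by rewrite -(cvg_shiftn m) in c1; exact: c1.
  - by rewrite -(cvg_shiftn m) in c2; exact: c2.
have Lf : Ltwo X f.
  have [b1 b2] := bound 0%N.
  have Lr : Ltwo X (fun x => f x - S 0%N x).
    have [s1 s2 _] := LS 0%N; split=> //.
    + by under [Y in measurable_fun _ Y]funext => x do rewrite raddfB; exact: measurable_funB.
    + by under [Y in measurable_fun _ Y]funext => x do rewrite raddfB; exact: measurable_funB.
  have := LtwoD Lr (LS 0%N).
  by under [Y in Ltwo X Y -> _]funext => x do rewrite subrK.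
have quarter e : 0 < e -> exists m0, forall m, (m0 <= m)%N -> (4^-1 : R) ^+ m < e.
  move=> e0; have : (4^-1 : R) ^+ n @[n --> \oo] --> (0 : R) by apply: cvg_expr; rewrite ger0_norm //; lra.
  move=> /cvgrPdist_lt /(_ e e0) [m0 _ hm]; exists m0 => m /hm /=.
  by rewrite sub0r normrN ger0_norm // exprn_ge0.
have coef b : fcoef X f (zk b) = c b.
  apply/eqP; rewrite -subr_eq0 -cabs_eq0 -sqrf_eq0 eq_le sqr_ge0 andbT.
  rewrite leNgt; apply/negP => p0; have [m0 hm0] := quarter _ p0.
  pose m := maxn m0 b.+1.
  have : cabs (fcoef X f (zk b) - c b) ^+ 2 <= 4^-1 ^+ m.
    have -> : c b = fcoef X (S m) (zk b).
      by rewrite fcoef_trigpoly //; case: ifP => // /negP; case; apply: leq_trans (jN m); exact: leq_maxr.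
    rewrite -fcoefB //; apply: (le_trans (fcoef_bound X0 _ (LtwoB Lf (LS m)))).
    by rewrite ler_pdivrMr // mulrC; case: (bound m).
  by rewrite leNgt hm0 // leq_maxl.
exists f; split=> //; first by case: Lf.
move=> e e0; have eX : 0 < e / X by rewrite divr_gt0.
have [m hm] := quarter _ eX; exists (N m) => B NB.
(* The distance to the partial sums decreases with K, so the bound at the index N m extends to all
   larger indices. *)
have resid K : nsq X (fun x => f x - trigpoly X c K x) = nsq X f - X * \sum_(b < K) cabs (c b) ^+ 2.
  rewrite [Y in _ = _ - _ * Y](eq_bigr (fun b : 'I_K => cabs (fcoef X f (zk b)) ^+ 2)) => [|b _]; last by rewrite coef.
  rewrite -nsq_residual //; congr (nsq X _); apply/funext => x; congr (_ - _).
  by apply: eq_bigr => b _; rewrite coef.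
have : nsq X (fun x => f x - S m x) < e.
  apply: (le_lt_trans (bound m).2); have := hm m (leqnn m).
  by rewrite ltr_pdivlMr // mulrC.
apply: le_lt_trans; rewrite !resid lerD2l lerN2 ler_pM2l //.
rewrite -!(big_mkord xpredT (fun b => cabs (c b) ^+ 2)) (big_cat_nat (leq0n (N m)) NB) /= lerDl.
by apply: sumr_ge0 => b _; exact: sqr_ge0.
Qed.

End RieszFischer.

(** * Parseval and convolution *)

Section Convolution.
Variable R : realType.
Local Notation C := (R[i]).
Local Notation mu := (@lebesgue_measure R).
Variable X : R.
Hypothesis X0 : 0 < X.
Local Notation I := (`[0, X]%classic : set R).

Lemma nsq_ae u v : Ltwo X u -> Ltwo X v -> {ae mu, forall x, I x -> u x = v x} -> nsq X u = nsq X v.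
Proof.
move=> [u1 u2 u3] [v1 v2 v3] uv; apply: EFin_inj; rewrite -!integral_rintE //.
apply: (@ae_eq_integral _ _ _ mu I _ _ (measurable_itv _)).
- by apply: measurable_EFinI; exact: measurable_cabs2.
- by apply: measurable_EFinI; exact: measurable_cabs2.
- by refine (@filterS _ _ (ae_filter_ringOfSetsType mu) _ _ _ uv) => x e Ix; rewrite e.
Qed.

Lemma fcoef_ae0 u k : Ltwo X u -> {ae mu, forall x, I x -> u x = 0} -> fcoef X u k = 0.
Proof.
move=> hu u0; have e := nsq_ae hu (Ltwo0 X) u0.
have n0 : nsq X (fun=> 0) = 0 by rewrite /nsq cabs0 expr0n Rint_cst // mul0r.
have := fcoef_bound X0 k hu; rewrite e n0 mul0r => h.
by apply/eqP; rewrite -cabs_eq0 -sqrf_eq0 eq_le sqr_ge0 h.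
Qed.

(** Riesz-Fischer provides a function with the coefficients of u that is the L2 limit of the partial
    sums; by uniqueness it agrees with u almost everywhere. *)
Lemma parseval u e : Ltwo X u -> 0 < e -> exists B0, forall B, (B0 <= B)%N ->
  nsq X (fun x => u x - trigpoly X (fun b => fcoef X u (zk b)) B x) < e.
Proof.
move=> hu e0; have [f [Lf cf fs]] := @riesz_fischer _ X X0 (fun b => fcoef X u (zk b)) _ (fun K => bessel X0 K hu).
have hf := L2per_Ltwo Lf.
have uf : {ae mu, forall x, I x -> u x - f x = 0}.
  apply: (fcoef_unique X0 (LtwoB hu hf)) => k; have [b <-] := zk_surj k.
  by rewrite fcoefB // cf subrr.
have [B0 hB] := fs e e0; exists B0 => B /hB; apply: le_lt_trans.
rewrite (@nsq_ae _ (fun x => f x - trigpoly X (fun b => fcoef X u (zk b)) B x)) //.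
- by apply: LtwoB => //; exact: Ltwo_trigpoly.
- by apply: LtwoB => //; exact: Ltwo_trigpoly.
refine (@filterS _ _ (ae_filter_ringOfSetsType mu) _ _ _ uf) => x ex Ix.
by congr (_ - _); apply/eqP; rewrite -subr_eq0 ex.
Qed.

(** The coefficient is an inner product of u with h = conj(g) times mode j. Replacing u by its
    partial sum gives the truncated convolution, and Cauchy-Schwarz bounds the error by the Parseval
    remainder. *)
Lemma fcoef_convolution g u j e : Ltwo X g -> Ltwo X u -> 0 < e ->
  exists B0, forall B, (B0 <= B)%N ->
  cabs (fcoef X (fun x => g x * u x) j - \sum_(b < B) fcoef X g (j - zk b) * fcoef X u (zk b)) < e.
Proof.
move=> hg hu e0; pose h x := conjc (g x) * mode X j x.
have hh : Ltwo X h by apply: Ltwo_mulmode; exact: Ltwo_conj.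
have conjh x : conjc (h x) = g x * mode X (- j) x by rewrite /h conjcM conjcK conj_mode.
have E1 : fcoef X (fun x => g x * u x) j = (X^-1)%:C%C * ip X u h.
  by rewrite /fcoef /ip; congr (_ * _); apply: eq_cint => x; rewrite conjh modeN; ring.
pose c b := fcoef X u (zk b).
have E2 B : (X^-1)%:C%C * ip X (trigpoly X c B) h = \sum_(b < B) fcoef X g (j - zk b) * c b.
  rewrite ip_suml //; last by move=> b; exact: Ltwo_term.
  rewrite mulr_sumr; apply: eq_bigr => b _.
  rewrite ipZl //; last exact: Ltwo_mode.
  rewrite mulrCA mulrC; congr (_ * _); rewrite /fcoef /ip; congr (_ * _); apply: eq_cint => x.
  by rewrite conjh modeN mulrCA -modeD; congr (_ * mode _ _ x); ring.
pose q := X ^- 2 * (nsq X h + 1).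
have q0 : 0 < q by rewrite mulr_gt0 ?invr_gt0 ?exprn_gt0 // ltr_wpDl ?nsq_ge0.
have [B0 hB] := parseval hu (divr_gt0 (exprn_gt0 2 e0) q0).
exists B0 => B /hB; set r := fun x => _; move=> rB.
have hr : Ltwo X r by apply: LtwoB => //; exact: Ltwo_trigpoly.
have -> : fcoef X (fun x => g x * u x) j - \sum_(b < B) fcoef X g (j - zk b) * fcoef X u (zk b)
    = (X^-1)%:C%C * ip X r h.
  rewrite E1 -[X in _ - X]E2 -mulrBr; congr (_ * _); rewrite /r -/c.
  have hs : Ltwo X (trigpoly X c B) by exact: Ltwo_trigpoly.
  have -> : (fun x => u x - trigpoly X c B x) = (fun x => u x + -1 * trigpoly X c B x).
    by apply/funext => x; rewrite mulN1r.
  by rewrite ipDl ?ipZl ?mulN1r //; exact: LtwoZ.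
rewrite -(ltr_pXn2r (n := 2)) // ?nnegrE ?cabs_ge0 ?(ltW e0) //.
rewrite cabsM exprMn cabs_real ger0_norm ?invr_ge0 ?(ltW X0) //.
have X2 : 0 < X^-1 ^+ 2 by rewrite exprn_gt0 // invr_gt0.
apply: (@le_lt_trans _ _ (X^-1 ^+ 2 * (nsq X r * nsq X h))).
  by rewrite ler_pM2l //; exact: ip_CS.
move: rB; rewrite ltr_pdivlMr //; apply: le_lt_trans.
rewrite /q -exprVn mulrCA; apply: ler_wpM2l; first exact: nsq_ge0.
by rewrite ler_pM2l // lerDl.
Qed.

End Convolution.

(** * The operator in Fourier coordinates *)

Section Coordinates.
Variable R : realType.
Local Notation C := (R[i]).
Variable X : R.
Hypothesis X0 : 0 < X.
Variable n : nat.
Hypothesis n0 : (0 < n)%N.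

(* Coordinate p of a sequence stands for component p mod n of the Fourier mode zk (p / n). *)
Definition mode_of (p : nat) : int := zk (p %/ n).
Definition comp_of (p : nat) : 'I_n := Ordinal (ltn_pmod p n0).

Lemma mode_ofE b (l : 'I_n) : mode_of (b * n + l) = zk b.
Proof. by rewrite /mode_of divnMDl // divn_small ?addn0. Qed.

Lemma comp_ofE b (l : 'I_n) : comp_of (b * n + l) = l.
Proof. by apply: val_inj; rewrite /= modnMDl modn_small. Qed.

Lemma coordinate_surj k (i : 'I_n) : exists p, mode_of p = k /\ comp_of p = i.
Proof. by have [b <-] := zk_surj k; exists (b * n + i)%N; rewrite mode_ofE comp_ofE. Qed.

Lemma sum_blocks (V : nmodType) (F : nat -> V) B :
  \sum_(p < B * n) F p = \sum_(b < B) \sum_(l < n) F (b * n + l)%N.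
Proof.
elim: B => [|B IH]; first by rewrite mul0n !big_ord0.
by rewrite mulSnr big_split_ord /= IH [RHS]big_ord_recr.
Qed.

Lemma sum_blocks_le (F : nat -> R) K : (forall p, 0 <= F p) ->
  \sum_(p < K) F p <= \sum_(l < n) \sum_(b < K) F (b * n + l)%N.
Proof.
move=> F0; rewrite exchange_big /= -sum_blocks -!(big_mkord xpredT F).
rewrite (big_cat_nat (leq0n K) (leq_pmulr K n0)) /= lerDl.
by apply: sumr_ge0 => p _; exact: F0.
Qed.

Definition toep (A : R -> 'M[C]_n) (p q : nat) : C :=
  fcoef X (fun x => A x (comp_of p) (comp_of q)) (mode_of p - mode_of q).

Definition fcoord (U : R -> 'cV[C]_n) (p : nat) : C :=
  fcoef X (fun x => U x (comp_of p) 0) (mode_of p).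

Definition hat (U : R -> 'cV[C]_n) (p : nat) : 'rV[C]_1 := (fcoord U p)%:M.

Lemma nrm2_scalar (z : C) : nrm2 (z%:M : 'M[C]_1) = cabs z ^+ 2.
Proof. by rewrite /nrm2 !big_ord1 mxE eqxx mulr1n. Qed.

Definition row_bound (A : R -> 'M[C]_n) : R :=
  \sum_(i < n) \sum_(l < n) nsq X (fun x => A x i l) / X.

Lemma row_bound_ge0 A : 0 <= row_bound A.
Proof.
by do 2!(apply: sumr_ge0 => ? _); rewrite divr_ge0 ?(ltW X0) //; exact: nsq_ge0.
Qed.

Lemma toep_row A : L2per_mx X A -> forall p K, \sum_(q < K) cabs (toep A p q) ^+ 2 <= row_bound A.
Proof.
move=> hA p K; apply: (le_trans (@sum_blocks_le (fun q => cabs (toep A p q) ^+ 2) K (fun q => sqr_ge0 _))).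
apply: (@le_trans _ _ (\sum_(l < n) nsq X (fun x => A x (comp_of p) l) / X)).
  apply: ler_sum => l _; rewrite /toep.
  under eq_bigr => b _ do rewrite mode_ofE comp_ofE.
  by apply: bessel_row => //; exact: L2per_Ltwo (hA _ _).
rewrite /row_bound [leRHS](bigD1 (comp_of p)) //= lerDl.
by do 2!(apply: sumr_ge0 => ? _); rewrite divr_ge0 ?(ltW X0) //; exact: nsq_ge0.
Qed.

Lemma fcoord_ell2 U : L2per_mx X U -> exists M, forall K, \sum_(p < K) cabs (fcoord U p) ^+ 2 <= M.
Proof.
move=> hU; exists (\sum_(l < n) nsq X (fun x => U x l 0) / X) => K.
apply: (le_trans (@sum_blocks_le (fun p => cabs (fcoord U p) ^+ 2) K (fun q => sqr_ge0 _))).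
apply: ler_sum => l _; rewrite /fcoord.
under eq_bigr => b _ do rewrite mode_ofE comp_ofE.
by apply: bessel => //; exact: L2per_Ltwo (hU _ _).
Qed.

Lemma hat_ell2 U : L2per_mx X U -> ell2 (hat U).
Proof.
move=> /fcoord_ell2[M hM]; exists M => K.
by under eq_bigr => p _ do rewrite nrm2_scalar; exact: hM.
Qed.

(** The summands of a matrix product A U are only integrable, not square-integrable, which calls for
    additivity under this weaker assumption. *)
Lemma fcoef_sum_int (F : 'I_n -> R -> C) k : (forall l, cintg X (fun x => F l x * mode X (- k) x)) ->
  fcoef X (fun x => \sum_(l < n) F l x) k = \sum_(l < n) fcoef X (F l) k.
Proof.
move=> hF; rewrite /fcoef -mulr_sumr; congr (_ * _).
rewrite (eq_cint X (g := fun x => \sum_(l < n) F l x * mode X (- k) x)).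
  by rewrite cint_sum //; apply: eq_bigr => l _; apply: eq_cint => x; rewrite modeN.
by move=> x; rewrite mulr_suml modeN.
Qed.

(** Convolution gives convergence of the sums over complete blocks of n coordinates. The incomplete
    last block is bounded by a tail of the two square-summable sequences. *)
Lemma toep_acts A U : L2per_mx X A -> L2per_mx X U -> acts (toep A) (hat U) (hat (fun x => A x *m U x)).
Proof.
move=> hA hU p; have LA i j := L2per_Ltwo (hA i j); have LU i := L2per_Ltwo (hU i 0).
pose term q := toep A p q * fcoord U q.
suff main : forall e, 0 < e -> exists K0, forall K, (K0 <= K)%N ->
    cabs (\sum_(q < K) term q - fcoord (fun x => A x *m U x) p) < e.
  apply: (@mlim_ext _ _ _ _ _ (fun K => (\sum_(q < K) term q)%:M)).
    exists 0%N => // K _ /=; rewrite raddf_sum; apply: eq_bigr => q _.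
    by rewrite /hat scale_scalar_mx.
  by apply/mlim_scalarP => e /main[K0 h]; exists K0.
move=> e e0; have e2 : 0 < e / 2 by rewrite divr_gt0.
have blocks : exists B0, forall B, (B0 <= B)%N ->
    cabs (\sum_(q < B * n) term q - fcoord (fun x => A x *m U x) p) < e / 2.
  have -> : fcoord (fun x => A x *m U x) p
     = \sum_(l < n) fcoef X (fun x => A x (comp_of p) l * U x l 0) (mode_of p).
    rewrite /fcoord -fcoef_sum_int; first by apply: fcoef_ext => x; rewrite mxE.
    move=> l; have := Ltwo_mul (LA (comp_of p) l) (Ltwo_mulmode (- mode_of p) (LU l)).
    by under [Y in cintg X Y -> _]funext => x do rewrite mulrA.
  pose part (l : 'I_n) B := \sum_(b < B) fcoef X (fun x => A x (comp_of p) l) (mode_of p - zk b)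
                                          * fcoef X (fun x => U x l 0) (zk b).
  have lim_part l : mlim \oo (fun B => (part l B)%:M : 'M[C]_1)
      (fcoef X (fun x => A x (comp_of p) l * U x l 0) (mode_of p))%:M.
    apply/mlim_scalarP => d d0.
    have [B0 hB] := fcoef_convolution X0 (mode_of p) (LA (comp_of p) l) (LU l) d0.
    by exists B0 => // B /hB; rewrite /= cabs_distC.
  have h : mlim \oo (fun B => (\sum_(l < n) part l B)%:M : 'M[C]_1)
      (\sum_(l < n) fcoef X (fun x => A x (comp_of p) l * U x l 0) (mode_of p))%:M.
    rewrite raddf_sum; apply: mlim_ext (mlim_sum (index_enum _) lim_part).
    by exists 0%N => // B _ /=; rewrite raddf_sum.
  have [B0 _ hB] := (mlim_scalarP _ _).1 h _ e2.
  exists B0 => B /hB /=; congr (cabs (_ - _) < _).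
  rewrite sum_blocks exchange_big /=; apply: eq_bigr => l _; apply: eq_bigr => b _.
  by rewrite /term /toep /fcoord mode_ofE comp_ofE.
have [Mu hMu] := fcoord_ell2 hU.
have [K1 hK1] : exists K1, forall K K', (K1 <= K)%N ->
    \sum_(K <= q < K') (cabs (toep A p q) ^+ 2 + cabs (fcoord U q) ^+ 2) < e / 2.
  apply: (bounded_series_tail (M := row_bound A + Mu)) => // [q|K].
    by apply: addr_ge0; exact: sqr_ge0.
  by rewrite big_split; apply: lerD; [exact: (toep_row hA p K)|exact: (hMu K)].
have [B0 hB] := blocks.
exists (maxn B0 K1 * n + n)%N => K hK.
have KB : (maxn B0 K1 <= K %/ n)%N by rewrite leq_divRL //; apply: leq_trans hK; exact: leq_addr.
have Kn : (K %/ n * n <= K)%N by exact: leq_trunc_div.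
rewrite -(big_mkord xpredT term) (big_cat_nat (leq0n _) Kn) /= big_mkord addrAC.
apply: (le_lt_trans (cabsD _ _)); rewrite [e]splitr; apply: ltrD.
  by apply: hB; apply: leq_trans KB; exact: leq_maxl.
apply: (le_lt_trans (cabs_sum _ _ _)).
have : (K1 <= K %/ n * n)%N.
  by apply: leq_trans (leq_pmulr _ n0); apply: leq_trans KB; exact: leq_maxr.
move=> hle; apply: le_lt_trans (hK1 _ K hle); apply: ler_sum => q _.
rewrite cabsM; have := cabs_ge0 (toep A p q); have := cabs_ge0 (fcoord U q).
by move: (cabs _) (cabs _) => a b; nra.
Qed.

End Coordinates.

(** * Symmetry, coercivity and multiplier growth for the Hill matrix *)

Section HillMatrix.
Local Open Scope sesquilinear_scope.
Variable R : realType.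
Local Notation C := (R[i]).
Local Notation mu := (@lebesgue_measure R).
Variable X : R.
Hypothesis X0 : 0 < X.
Variable n : nat.
Hypothesis n0 : (0 < n)%N.
Local Notation I := (`[0, X]%classic : set R).
Local Notation comp_of := (comp_of n0).
Local Notation mode_of := (mode_of n).
Local Notation toep := (toep X n0).
Local Notation fcoord := (fcoord X n0).
Local Notation hat := (hat X n0).

Lemma conjc_sum (T : Type) (s : seq T) (F : T -> C) : conjc (\sum_(i <- s) F i) = \sum_(i <- s) conjc (F i).
Proof. exact: rmorph_sum. Qed.

Lemma coordinate_inj p q : mode_of p = mode_of q -> comp_of p = comp_of q -> p = q.
Proof.
move=> /(zk_inj X0) e /(congr1 (@nat_of_ord n)) /= e'.
by rewrite (divn_eq p n) (divn_eq q n) e e'.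
Qed.

Definition scalar_field (c : C) (x : R) : 'M[C]_n := c%:M.

Lemma Ltwo_cst (c : C) : Ltwo X (fun=> c).
Proof. by have := LtwoZ c (Ltwo1 X); under [Y in Ltwo X Y -> _]funext => x do rewrite mulr1. Qed.

Lemma toep_scalar c p q : toep (scalar_field c) p q = c *+ (p == q).
Proof.
rewrite /toep (@fcoef_ext _ X _ (fun x => (c *+ (comp_of p == comp_of q)) * mode X 0 x)).
  rewrite fcoefZ ?fcoef_mode //; last exact: Ltwo_mode.
  rewrite (eq_sym 0) subr_eq0; case: (eqVneq p q) => [->|pq]; first by rewrite !eqxx mulr1.
  case: (eqVneq (mode_of p)) => [e|_]; last by rewrite mulr0.
  case: (eqVneq (comp_of p)) => [e'|_]; last by rewrite mul0r.
  by case/eqP: pq; exact: coordinate_inj.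
by move=> x; rewrite mxE mode0 mulr1.
Qed.

Lemma toepB (A B : R -> 'M[C]_n) p q : (forall i j, Ltwo X (fun x => A x i j)) -> (forall i j, Ltwo X (fun x => B x i j)) ->
  toep (fun x => A x - B x) p q = toep A p q - toep B p q.
Proof. by move=> hA hB; rewrite /toep -fcoefB //; apply: fcoef_ext => x; rewrite !mxE. Qed.

(** The trigonometric polynomial with coordinate vector v: integrals of its pointwise quadratic form
    are quadratic forms of Toeplitz sections in v, see [cint_qform]. *)
Definition synth N (v : 'cV[C]_N) (x : R) : 'cV[C]_n :=
  \col_i \sum_(q < N) (v q 0 * mode X (mode_of q) x) *+ (comp_of q == i).

Definition qform (B : 'M[C]_n) (w : 'cV[C]_n) : C :=
  \sum_(i < n) \sum_(j < n) conjc (w i 0) * B i j * w j 0.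

Lemma sum_synth N (v : 'cV[C]_N) x (G : 'I_n -> C) :
  \sum_i G i * synth v x i 0 = \sum_(q < N) G (comp_of q) * (v q 0 * mode X (mode_of q) x).
Proof.
under eq_bigr => i _ do rewrite mxE mulr_sumr.
rewrite exchange_big /=; apply: eq_bigr => q _.
rewrite (bigD1 (comp_of q)) //= eqxx big1 ?addr0 // => i /negPf; rewrite eq_sym => ->.
by rewrite mulr0.
Qed.

Lemma qform_synth N (v : 'cV[C]_N) (B : 'M[C]_n) x : qform B (synth v x) =
  \sum_(p < N) \sum_(q < N) (conjc (v p 0) * v q 0) * (B (comp_of p) (comp_of q) * mode X (- (mode_of p - mode_of q)) x).
Proof.
rewrite /qform; under eq_bigr => i _ do rewrite sum_synth.
transitivity (conjc (\sum_i conjc (\sum_(q < N) B i (comp_of q) * (v q 0 * mode X (mode_of q) x)) * synth v x i 0)).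
  rewrite conjc_sum; apply: eq_bigr => i _; rewrite conjcM conjcK mulr_suml.
  by apply: eq_bigr => q _; ring.
rewrite sum_synth conjc_sum; apply: eq_bigr => p _.
rewrite !conjcM conjcK mulr_suml; apply: eq_bigr => q _.
by rewrite conj_mode opprB modeD; ring.
Qed.

Lemma cint_qform N (v : 'cV[C]_N) (A : R -> 'M[C]_n) : (forall i j, Ltwo X (fun x => A x i j)) ->
  cint X (fun x => qform (A x) (synth v x)) =
  X%:C%C * \sum_(p < N) \sum_(q < N) (conjc (v p 0) * v q 0) * toep A p q.
Proof.
move=> hA; rewrite (eq_cint X (fun x => qform_synth v (A x) x)).
have hi p q : cintg X (fun x => A x (comp_of p) (comp_of q) * mode X (- (mode_of p - mode_of q)) x).
  by apply: Ltwo_intg; exact: Ltwo_mulmode.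
have hi2 p : cintg X (fun x => \sum_(q < N) (conjc (v p 0) * v q 0) * (A x (comp_of p) (comp_of q) * mode X (- (mode_of p - mode_of q)) x)).
  by apply: cintg_sum => q; exact: cintgZ.
rewrite cint_sum // mulr_sumr; apply: eq_bigr => p _.
rewrite cint_sum ?mulr_sumr; last by move=> q; exact: cintgZ.
apply: eq_bigr => q _; rewrite cintZ // mulrCA; congr (_ * _).
rewrite /toep /fcoef mulrA -rmorphM mulfV ?gt_eqF // rmorph1 mul1r.
by apply: eq_cint => x; rewrite modeN.
Qed.

(** Integrate the pointwise inequality at w = [synth v x]. Subtracting the constant field c first
    reduces it to positivity of one integral, and the constant field contributes exactly c |v|^2
    since its Toeplitz matrix is scalar. *)
Lemma toep_coercive (A : R -> 'M[C]_n) (c : R) : (forall i j, Ltwo X (fun x => A x i j)) ->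
  (forall x (w : 'cV[C]_n), c * (\sum_(i < n) cabs (w i 0) ^+ 2) <= complex.Re (qform (A x) w)) ->
  forall N (v : 'cV[C]_N), c * nrm2 v <= complex.Re (\tr (v ^t* *m (sec (toep A) N *m v))).
Proof.
move=> hA hc N v; pose D x := A x - scalar_field c%:C%C x.
have hS i j : Ltwo X (fun x => scalar_field c%:C%C x i j) by rewrite /scalar_field; exact: Ltwo_cst.
have hD i j : Ltwo X (fun x => D x i j).
  have := LtwoB (hA i j) (hS i j); rewrite (_ : (fun x => _ - _) = (fun x => D x i j)) //.
  by apply/funext => x; rewrite !mxE.
have ReB (z w : C) : complex.Re (z - w) = complex.Re z - complex.Re w by case: z; case: w.
have pos : 0 <= complex.Re (cint X (fun x => qform (D x) (synth v x))).
  apply: Rintegral_ge0 => x _; rewrite (_ : qform _ _ = qform (A x) (synth v x) - \sum_i c%:C%C * (conjc (synth v x i 0) * synth v x i 0)).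
    rewrite ReB subr_ge0 -mulr_sumr Re_mulc /= mul0r subr0; apply: le_trans (hc x (synth v x)).
    rewrite raddf_sum /= le_eqVlt; apply/orP; left; apply/eqP; congr (_ * _).
    by apply: eq_bigr => i _; rewrite mulrC mulcJ.
  rewrite /qform -sumrB; apply: eq_bigr => i _.
  have e : c%:C%C * (conjc (synth v x i 0) * synth v x i 0) = \sum_j conjc (synth v x i 0) * scalar_field c%:C%C x i j * synth v x j 0.
    have sE j : scalar_field c%:C%C x i j = c%:C%C *+ (i == j) by rewrite /scalar_field mxE.
    rewrite (bigD1 i) //= big1 ?addr0; first by rewrite sE eqxx mulr1n; ring.
    by move=> j /negPf ji; rewrite sE eq_sym ji mulr0n mulr0 mul0r.
  have DE j : D x i j = A x i j - scalar_field c%:C%C x i j by rewrite /D !mxE.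
  by rewrite e -sumrB; apply: eq_bigr => j _; rewrite DE; ring.
have trE : \tr (v ^t* *m (sec (toep A) N *m v)) = \sum_(p < N) \sum_(q < N) (conjc (v p 0) * v q 0) * toep A p q.
  rewrite /mxtrace big_ord1 mxE; apply: eq_bigr => p _; rewrite !mxE mulr_sumr.
  by apply: eq_bigr => q _; rewrite !mxE -[RHS]mulrA [v q 0 * _]mulrC.
move: pos; rewrite cint_qform // Re_mulc /= mul0r subr0 pmulr_rge0 //.
have -> : \sum_(p < N) \sum_(q < N) (conjc (v p 0) * v q 0) * toep D p q =
  \tr (v ^t* *m (sec (toep A) N *m v)) - (c * nrm2 v)%:C%C.
  rewrite trE (_ : (c * nrm2 v)%:C%C = \sum_(p < N) \sum_(q < N) (conjc (v p 0) * v q 0) * toep (scalar_field c%:C%C) p q).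
    rewrite -sumrB; apply: eq_bigr => p _; rewrite -sumrB; apply: eq_bigr => q _.
    by rewrite /D toepB // mulrBr.
  rewrite /nrm2 mulr_sumr raddf_sum /=; apply: eq_bigr => p _.
  rewrite big_ord1 (bigD1 p) //= big1 ?addr0.
    by rewrite toep_scalar eqxx mulr1n [conjc _ * _]mulrC mulcJ rmorphM mulrC.
  by move=> q /negPf qp; rewrite toep_scalar eq_sym -val_eqE /= in qp *; rewrite qp mulr0.
by rewrite ReB subr_ge0.
Qed.

Lemma toep_herm (A : R -> 'M[C]_n) : (forall i j, Ltwo X (fun x => A x i j)) ->
  (forall x i j, A x j i = conjc (A x i j)) -> forall p q, toep A q p = conjc (toep A p q).
Proof.
move=> hA h p q; rewrite /toep (fcoef_ext X _ (fun x => h x (comp_of p) (comp_of q))).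
by rewrite fcoef_conj // opprB.
Qed.

Definition decay (p : nat) : R := ((absz (mode_of p)).+1%:R)^-1.

Lemma decay_gt0 p : 0 < decay p. Proof. by rewrite invr_gt0. Qed.
Lemma decay_le1 p : decay p <= 1. Proof. by rewrite invf_le1 // ler1n. Qed.

Lemma decay_sum K : \sum_(p < K) decay p ^+ 2 <= n%:R * 8.
Proof.
apply: (le_trans (@sum_blocks_le _ _ n0 (fun p => decay p ^+ 2) K (fun p => sqr_ge0 _))).
rewrite mulr_natl -[X in _ *+ X]card_ord -sumr_const; apply: ler_sum => l _.
(* Telescoping: |zk K| + 1 is at least (K + 2)/2, so its inverse square is at most 4/(k (k + 1)) =
   4/k - 4/(k + 1) for k = K + 1. *)
suff h : \sum_(b < K) decay (b * n + l) ^+ 2 <= 8 - 4 / K.+1%:R.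
  by apply: (le_trans h); rewrite gerBl divr_ge0.
elim: K => [|K IH]; first by rewrite big_ord0 divr1; lra.
rewrite big_ord_recr /=; apply: (le_trans (lerD IH (lexx _))).
rewrite /decay (mode_ofE n0).
have h : (K.+2 <= 2 * (absz (zk K)).+1)%N by rewrite /zk; case: ifP; lia.
move: h; move: (absz (zk K)) => a; rewrite -(ler_nat R) natrM => h.
set u : R := a.+1%:R in h *; have u0 : 0 < u by rewrite ltr0n.
have k1 : (K.+2%:R : R) = K.+1%:R + 1 by rewrite -natr1.
rewrite k1 in h *; have : 0 < (K.+1%:R : R) by rewrite ltr0n.
move: (K.+1%:R : R) h => k h k0.
have le1 : u^-1 ^+ 2 <= 4 / (k * (k + 1)).
  rewrite exprVn ler_pdivlMr ?mulr_gt0 ?addr_gt0 // mulrC ler_pdivrMr ?exprn_gt0 //.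
  nra.
have -> : 8 - 4 / (k + 1) = 8 - 4 / k + 4 / (k * (k + 1)).
  by field; rewrite !gt_eqF ?addr_gt0.
by rewrite lerD2l.
Qed.

(** For |k| >= 1 one has |k| + 1 <= 2 |k|, which costs half of 2 pi / X. *)
Lemma decay_dmult p : (dmult X (mode_of p) = 0 /\ decay p = 1) \/
  pi / X <= cabs (dmult X (mode_of p)) * decay p.
Proof.
case: (eqVneq (mode_of p) 0) => [e|k0]; [left|right].
  by rewrite /dmult /decay e mulr0 mul0r invr1.
have -> : cabs (dmult X (mode_of p)) = 2 * pi * (absz (mode_of p))%:R / X.
  rewrite /cabs /= expr0n add0r sqrtr_sqr !normrM normfV (gtr0_norm X0) (gtr0_norm (pi_gt0 R)) gtr0_norm //.
  by rewrite -intr_norm natr_absz.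
rewrite /decay; have : (0 < absz (mode_of p))%N by rewrite absz_gt0.
move: (absz _) => a a0; have -> : (a.+1%:R : R) = a%:R + 1 by rewrite -natr1.
rewrite ler_pdivlMr ?ltr_wpDl // mulrDr mulr1.
rewrite -(ler_nat R) in a0; have P : 0 < pi / X by rewrite divr_gt0 // pi_gt0.
have -> : 2 * pi * a%:R / X = 2 * (pi / X) * a%:R by ring.
move: (pi / X) P (a%:R : R) a0 => y y0 z z0; nra.
Qed.

End HillMatrix.

(** * Dictionary between periodic functions and coordinate sequences *)

Section HillOperator.
Variable R : realType.
Local Notation C := (R[i]).
Local Notation mu := (@lebesgue_measure R).
Variable X : R.
Hypothesis X0 : 0 < X.
Variable n : nat.
Hypothesis n0 : (0 < n)%N.
Local Notation I := (`[0, X]%classic : set R).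
Local Notation comp_of := (comp_of n0).
Local Notation mode_of := (mode_of n).
Local Notation fcoord := (fcoord X n0).
Local Notation hat := (hat X n0).

Lemma hatE U p : hat U p = (fcoef_mx X U (mode_of p) (comp_of p) 0)%:M.
Proof. by have -> : hat U p = (fcoord U p)%:M by []; rewrite mxE. Qed.

Lemma scalar11_inj (a b : C) : a%:M = b%:M :> 'M[C]_1 -> a = b.
Proof. by move=> /matrixP/(_ 0 0); rewrite !mxE eqxx !mulr1n. Qed.

Lemma ae_zero_hat (U : R -> 'cV[C]_n) : L2per_mx X U -> ae_zero X U <-> forall p, hat U p = 0.
Proof.
move=> hU; have LU i := L2per_Ltwo (hU i 0); split=> h.
- move=> p; rewrite hatE mxE fcoef_ae0 ?raddf0 //.
  refine (@filterS _ _ (ae_filter_ringOfSetsType mu) _ _ _ h) => x Ux Ix.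
  by rewrite Ux // mxE.
- have H (i : 'I_n) : {ae mu, forall x, I x -> U x i 0 = 0}.
    apply: fcoef_unique => // k; have [p [<- <-]] := coordinate_surj n0 k i.
    by have := h p; rewrite hatE mxE -(raddf0 (@scalar_mx C 1)) => /scalar11_inj.
  have := @filter_forall _ _ _ _ (ae_filter_ringOfSetsType mu) H.
  refine (@filterS _ _ (ae_filter_ringOfSetsType mu) _ _ _) => x hx Ix.
  by apply/matrixP => i j; rewrite ord1 hx // mxE.
Qed.

Lemma ell2_hat_surj (u : nat -> 'rV[C]_1) : ell2 u -> exists U, L2per_mx X U /\ forall p, hat U p = u p.
Proof.
move=> [M hM]; have h (i : 'I_n) : exists f, L2per X f /\ forall b, fcoef X f (zk b) = u (b * n + i)%N 0 0.
  have bound K : \sum_(b < K) cabs (u (b * n + i)%N 0 0) ^+ 2 <= M.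
    apply: le_trans (hM (K * n)%N); rewrite (@sum_blocks n _ (fun p => nrm2 (u p)) K); apply: ler_sum => b _.
    rewrite (bigD1 i) //= /nrm2 !big_ord1 lerDl.
    by apply: sumr_ge0 => j _; rewrite !big_ord1 sqr_ge0.
  by have [f [f1 f2 _]] := @riesz_fischer _ X X0 (fun b => u (b * n + i)%N 0 0) M bound; exists f.
have [f hf] := choice h.
exists (fun x => \col_i f i x); split=> [i j|p].
  by rewrite (_ : (fun x => _) = f i); [case: (hf i)|apply/funext => x; rewrite mxE].
rewrite hatE mxE (@fcoef_ext _ X _ (f (comp_of p))) => [|x]; last by rewrite mxE.
have -> : mode_of p = zk (p %/ n) by [].
rewrite (hf (comp_of p)).2 /= -divn_eq.
by rewrite [RHS]mx11_scalar.
Qed.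

Lemma L2per_lincomb m (c : 'I_m -> C) (us : 'I_m -> R -> 'cV[C]_n) :
  (forall i, L2per_mx X (us i)) -> L2per_mx X (fun x => \sum_i c i *: us i x).
Proof.
move=> hu i j; have e x : (\sum_k c k *: us k x) i j = \sum_k c k * us k x i j.
  by rewrite summxE; apply: eq_bigr => k _; rewrite mxE.
have hs : Ltwo X (fun x => \sum_k c k * us k x i j).
  by apply: Ltwo_sum => k; apply: LtwoZ; exact: L2per_Ltwo (hu k i j).
rewrite (_ : (fun x => _) = (fun x => \sum_k c k * us k x i j)); last exact/funext.
case: hs => s1 s2 s3; split=> // x.
by apply: eq_bigr => k _; have [-> _ _ _] := hu k i j.
Qed.

Lemma hat_lincomb m (c : 'I_m -> C) (us : 'I_m -> R -> 'cV[C]_n) p :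
  (forall i, L2per_mx X (us i)) -> hat (fun x => \sum_i c i *: us i x) p = \sum_i c i *: hat (us i) p.
Proof.
move=> hu; rewrite hatE mxE.
rewrite (@fcoef_ext _ X _ (fun x => \sum_i c i * us i x (comp_of p) 0)) => [|x]; last first.
  by rewrite summxE; apply: eq_bigr => k _; rewrite mxE.
have L k : Ltwo X (fun x => us k x (comp_of p) 0) by exact: L2per_Ltwo (hu k _ _).
rewrite fcoef_sum; last by move=> k; exact: LtwoZ.
rewrite raddf_sum; apply: eq_bigr => k _ /=.
by rewrite fcoefZ // hatE mxE scale_scalar_mx.
Qed.

Lemma lin_indep_hat m (us : 'I_m -> R -> 'cV[C]_n) : (forall i, L2per_mx X (us i)) ->
  lin_indep X us <-> indep_cols (fun i => hat (us i)).
Proof.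
move=> hu; split=> h c hc; apply: h.
- by apply/(ae_zero_hat (L2per_lincomb c hu)) => p; rewrite hat_lincomb.
- by move=> p; rewrite -hat_lincomb //; exact: (ae_zero_hat (L2per_lincomb c hu)).1.
Qed.

Lemma L2per0 : L2per_mx X (fun=> 0 : 'cV[C]_n).
Proof.
move=> i j; rewrite (_ : (fun x => _) = fun=> 0); last by apply/funext => x; rewrite mxE.
by have [h1 h2 h3] := Ltwo0 X; split.
Qed.

Lemma hat0 p : hat (fun=> 0) p = 0.
Proof. by apply: (ae_zero_hat L2per0).1; apply: aeW. Qed.

Variables (A0 A1 A2 : R -> 'M[C]_n).
Hypothesis hA0 : L2per_mx X A0.
Hypothesis hA1 : L2per_mx X A1.
Hypothesis hA2 : L2per_mx X A2.
Local Notation mat := (hill_mat (toep X n0 A0) (toep X n0 A1) (toep X n0 A2) (fun p => dmult X (mode_of p))).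

Lemma hill_acts U : L2per_mx X U -> acts mat (hat U) (fun p =>
  (((dmult X (mode_of p)) ^+ 2 *: fcoef_mx X (fun x => A2 x *m U x) (mode_of p)
   + dmult X (mode_of p) *: fcoef_mx X (fun x => A1 x *m U x) (mode_of p)
   + fcoef_mx X (fun x => A0 x *m U x) (mode_of p)) (comp_of p) 0)%:M).
Proof.
move=> hU p.
have e (M2 M1 M0 : 'cV[C]_n) (d2 d1 : C) i : ((d2 *: M2 + d1 *: M1 + M0) i 0)%:M =
    d2%:M *m (M2 i 0)%:M + d1%:M *m (M1 i 0)%:M + (M0 i 0)%:M :> 'M[C]_1.
  by rewrite !mul_scalar_mx !scale_scalar_mx -!raddfD !mxE.
rewrite [Y in mlim _ _ Y](_ : _ = ((dmult X (mode_of p)) ^+ 2)%:M *m hat (fun x => A2 x *m U x) p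
  + (dmult X (mode_of p))%:M *m hat (fun x => A1 x *m U x) p + hat (fun x => A0 x *m U x) p); last first.
  by rewrite !hatE; exact: e.
apply: mlim_ext (mlimD (mlimD (mlimMl _ (toep_acts X0 n0 hA2 hU p)) (mlimMl _ (toep_acts X0 n0 hA1 hU p))) (toep_acts X0 n0 hA0 hU p)).
exists 0%N => // K _ /=.
rewrite !mul_scalar_mx !scaler_sumr -!big_split; apply: eq_bigr => q _ /=.
by rewrite !scalerA -!scalerDl.
Qed.

(** Every pair of a mode and a component is one coordinate p, so testing against all modes is the
    same as the system of all row equations. *)
Lemma Lshift_acts lam U V : L2per_mx X U -> L2per_mx X V ->
  Lshift X A0 A1 A2 lam U V <-> acts mat (hat U) (fun p => hat V p + lam *: hat U p).
Proof.
move=> hU hV; have hh := hill_acts hU.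
have e (M N : 'cV[C]_n) i : (M - lam *: N) i 0 = M i 0 - lam * N i 0 by rewrite !mxE.
split.
- move=> [_ _ h]; apply: acts_ext hh => // p.
  rewrite !hatE scale_scalar_mx -raddfD; congr (_ %:M); rewrite -h.
  by rewrite e subrK.
- move=> h; split=> // j; apply/matrixP => i j0; rewrite ord1.
  have [p [<- <-]] := coordinate_surj n0 j i.
  have := acts_uniq hh h p; rewrite !hatE scale_scalar_mx -raddfD => /scalar11_inj.
  by rewrite e => ->; rewrite addrK.
Qed.

Lemma is_eigL_hat lam : is_eigL X A0 A1 A2 lam <-> is_eig mat lam.
Proof.
split.
- move=> [U [hU Unz HL]]; exists (hat U); split; first exact: hat_ell2.
    apply: contrapT => h; apply: Unz; apply/(ae_zero_hat hU) => p.
    by apply/eqP; apply: contrapT => /negP hp; apply: h; exists p.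
  by apply: acts_ext ((Lshift_acts lam hU L2per0).1 HL) => // p; rewrite hat0 add0r.
- move=> [u [u2 [p up] hu]]; have [U [hU Uu]] := ell2_hat_surj u2.
  exists U; split=> //.
    by move=> /(ae_zero_hat hU)/(_ p); rewrite Uu => e; rewrite e eqxx in up.
  apply/(Lshift_acts lam hU L2per0); apply: acts_ext hu => q; first by rewrite Uu.
  by rewrite hat0 add0r Uu.
Qed.

(** A chain with m = 0 imposes no square integrability on U, but it makes U vanish almost
    everywhere, which is excluded; for m > 0 every member occurs in some link. The finite chain is
    continued by zero. *)
Lemma gen_eigL_hat lam U : gen_eigL X A0 A1 A2 lam U -> ~ ae_zero X U ->
  L2per_mx X U /\ gen_eig mat lam (hat U).
Proof.
move=> [[|m] [ch [<- hs ae]]] nz; first by case: nz.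
have hch l : (l <= m.+1)%N -> L2per_mx X (ch l).
  rewrite leq_eqVlt => /predU1P[->|lm]; first by have [] := hs m (ltnSn m).
  by have [] := hs l lm.
split; first exact: hch.
pose ch' l := if (l < m.+1)%N then hat (ch l) else fun=> 0.
have hch' : ch' m.+1 = hat (ch m.+1).
  rewrite /ch' ltnn; apply/funext => p.
  by rewrite ((ae_zero_hat (hch _ (leqnn _))).1 ae).
have ch'E l : (l <= m.+1)%N -> ch' l = hat (ch l).
  by rewrite leq_eqVlt => /predU1P[->//|lm]; rewrite /ch' lm.
exists ch'; split=> [//|l|l|].
- rewrite /ch'; case: ifP => [lm|_]; first by apply: hat_ell2 => //; apply: hch; exact: ltnW.
  by exists 0 => K; rewrite big1 // => p _; rewrite /nrm2 !big_ord1 mxE cabs0 expr0n.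
- case: (ltnP l m.+1) => lm.
    rewrite !ch'E //; last exact: ltnW.
    by apply/(Lshift_acts lam (hch _ (ltnW lm)) (hch _ lm)); exact: hs.
  have c0 k : (m.+1 <= k)%N -> ch' k = fun=> 0 by move=> mk; rewrite /ch' ltnNge mk.
  rewrite !c0 //; last exact: leqW.
  move=> p; rewrite scaler0 addr0; apply: mlim_ext (mlim_cst _).
  by exists 0%N => // K _ /=; rewrite big1 // => q _; rewrite scaler0.
- by exists m.+1 => l p ml; rewrite /ch' ltnNge ml.
Qed.

Lemma gen_eig_hat lam u : gen_eig mat lam u ->
  exists U, [/\ L2per_mx X U, gen_eigL X A0 A1 A2 lam U & forall p, hat U p = u p].
Proof.
move=> [ch [<- che hs [len hlen]]].
have [F hF] := choice (fun l => ell2_hat_surj (che l)).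
exists (F 0%N); split; [by case: (hF 0%N)| |by case: (hF 0%N)].
exists len, F; split=> // [l _|].
  have [f1 f2] := hF l; have [g1 g2] := hF l.+1.
  by apply/(Lshift_acts lam f1 g1); apply: acts_ext (hs l) => p; rewrite ?f2 ?g2.
have [f1 f2] := hF len; apply/(ae_zero_hat f1) => p.
by rewrite f2 hlen.
Qed.

Lemma lin_indep_nonzero m (us : 'I_m -> R -> 'cV[C]_n) i : lin_indep X us -> ~ ae_zero X (us i).
Proof.
move=> ind z; have := ind (fun j => (j == i)%:R).
have e : ae_zero X (fun x => \sum_(j < m) (j == i)%:R *: us j x).
  refine (@filterS _ _ (ae_filter_ringOfSetsType mu) _ _ _ z) => x zx Ix.
  rewrite (bigD1 i) //= eqxx scale1r zx // add0r big1 // => j /negPf ->.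
  by rewrite scale0r.
by move=> /(_ e i)/eqP; rewrite eqxx oner_eq0.
Qed.

Lemma alg_multL_hat lam m :
  (exists us : 'I_m -> nat -> 'rV[C]_1, (forall i, gen_eig mat lam (us i)) /\ indep_cols us) ->
  (forall us : 'I_m.+1 -> nat -> 'rV[C]_1, (forall i, gen_eig mat lam (us i)) -> ~ indep_cols us) ->
  alg_multL X A0 A1 A2 lam m.
Proof.
move=> [us [gus ius]] mx; split.
- have [F hF] := choice (fun i => gen_eig_hat (gus i)).
  exists F; split=> [i|]; first by case: (hF i).
  apply/lin_indep_hat; first by move=> i; case: (hF i).
  move=> c hc; apply: ius => p; rewrite -[RHS](hc p); apply: eq_bigr => i _.
  by have [_ _ ->] := hF i.
- move=> vs gvs ivs.
  have h i := gen_eigL_hat (gvs i) (lin_indep_nonzero ivs).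
  apply: (mx (fun i => hat (vs i))); first by move=> i; case: (h i).
  by apply/lin_indep_hat => // i; case: (h i).
Qed.

Definition zk_index (k : int) : nat := match k with Posz m => m.*2 | Negz m => m.*2.+1 end.

Lemma zk_indexK k : zk (zk_index k) = k.
Proof.
case: k => m; first by rewrite /zk odd_double doubleK.
by rewrite /zk /= odd_double /= NegzE doubleK.
Qed.

(** [LJ] orders frequencies as -J, ..., J, the section as 0, -1, 1, and so on; simultaneous
    permutation of rows and columns is a similarity. *)
Lemma char_poly_LJ J : char_poly (LJ X A0 A1 A2 J) = char_poly (sec mat ((2 * J).+1 * n)).
Proof.
set N := ((2 * J).+1 * n)%N.
(* Frequencies with |k| <= J occupy exactly the first 2 J + 1 places of [zk], so the reindexing
   stays below N. *)
have phi_lt (a : 'I_N) : (zk_index (freq (blk a).1) * n + (blk a).2 < N)%N.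
  have hz : (zk_index (freq (blk a).1) < (2 * J).+1)%N.
    rewrite (zk_ltn X0) zk_indexK /freq; have := ltn_ord (blk a).1; lia.
  apply: (@leq_trans ((zk_index (freq (blk a).1)).+1 * n)); last by rewrite leq_mul2r hz orbT.
  by rewrite (mulSnr (zk_index (freq (blk a).1))) ltn_add2l.
pose phi a := Ordinal (phi_lt a).
have phi_inj : injective phi.
  move=> a b /(congr1 val) /= e.
  have k : freq (blk a).1 = freq (blk b).1.
    have := congr1 (fun p => mode_of p) e; rewrite /= !(mode_ofE n0) !zk_indexK //.
  have l : (blk a).2 = (blk b).2.
    have := congr1 (fun p => comp_of p) e; rewrite /= !comp_ofE //.
  have k' : (blk a).1 = (blk b).1.
    by apply: val_inj; move: k; rewrite /freq => /(congr1 (fun z => z + J%:Z)); rewrite !subrK => -[].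
  have : blk a = blk b by rewrite [LHS]surjective_pairing [RHS]surjective_pairing k' l.
  by move=> /enum_val_inj /cast_ord_inj.
pose s := perm phi_inj.
have modeE a : mode_of (phi a) = freq (blk a).1 by rewrite /= (mode_ofE n0) zk_indexK.
have compE a : comp_of (phi a) = (blk a).2 by exact: comp_ofE.
have -> : LJ X A0 A1 A2 J = perm_mx s *m sec mat N *m perm_mx (s^-1)%g.
  rewrite -row_permE -col_permE; apply/matrixP => a b.
  rewrite [RHS]mxE [RHS]mxE [RHS]mxE /s !permE /hill_mat /toep !modeE !compE.
  by rewrite [LHS]mxE; congr (_ * _ + _ * _ + _); rewrite mxE.
by apply: char_poly_similar; rewrite -perm_mxM mulgV perm_mx1.
Qed.

End HillOperator.

Theorem theorem4p3 (R : realType) (X : R) (n : nat)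
  (A0 A1 A2 : R -> 'M[R[i]]_n) (C : R) :
  0 < X -> (0 < n)%N ->
  L2per_mx X A0 -> L2per_mx X A1 -> L2per_mx X A2 ->
  (* A2(x) Hermitian *)
  (forall x i j, A2 x j i = conjc (A2 x i j)) ->
  0 < C ->
  (* A2(x) >= C I *)
  (forall x (v : 'cV[R[i]]_n),
      C * (\sum_(i < n) cabs (v i 0) ^+ 2)
      <= complex.Re (\sum_(i < n) \sum_(j < n) conjc (v i 0) * A2 x i j * v j 0)) ->
  forall Rad : R, 0 < Rad ->
  (forall lam : R[i], cabs lam = Rad -> ~ is_eigL X A0 A1 A2 lam) ->
  exists2 eps0 : R, 0 < eps0 &
  forall eps : R, 0 < eps -> eps < eps0 ->
  exists J0 : nat, forall J : nat, (J0 <= J)%N ->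
    (forall z : R[i], eigenvalue (LJ X A0 A1 A2 J) z -> cabs z < Rad ->
       exists lam, is_eigL X A0 A1 A2 lam /\ cabs (z - lam) < eps) /\
    (forall lam : R[i], is_eigL X A0 A1 A2 lam -> cabs lam < Rad ->
       exists m : nat, alg_multL X A0 A1 A2 lam m /\
         count (fun z => cabs (z - lam) < eps) (eigseq (LJ X A0 A1 A2 J)) = m).
Proof.
move=> X0 n0 hA0 hA1 hA2 herm C0 coer Rad Rad0 noeig.
(* Extending the filter of cofinite sets makes the ultrafilter free: every statement true for all
   large i holds along it. *)
have [U [UF Uinf]] : exists U : set_system nat, UltraFilter U /\ \oo `<=` U by exact: ultraFilterLemma.
have LA2 i j : Ltwo X (fun x => A2 x i j) by exact: L2per_Ltwo (hA2 i j).
pose Mr := row_bound X A0 + row_bound X A1 + row_bound X A2.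
have b0 := row_bound_ge0 X0 A0; have b1 := row_bound_ge0 X0 A1; have b2 := row_bound_ge0 X0 A2.
have r0 p K : \sum_(q < K) cabs (toep X n0 A0 p q) ^+ 2 <= Mr.
  by apply: (le_trans (toep_row X0 n0 hA0 p K)); rewrite /Mr -addrA lerDl addr_ge0.
have r1 p K : \sum_(q < K) cabs (toep X n0 A1 p q) ^+ 2 <= Mr.
  by apply: (le_trans (toep_row X0 n0 hA1 p K)); rewrite /Mr -addrA addrCA lerDl addr_ge0.
have r2 p K : \sum_(q < K) cabs (toep X n0 A2 p q) ^+ 2 <= Mr.
  by apply: (le_trans (toep_row X0 n0 hA2 p K)); rewrite /Mr lerDr addr_ge0.
pose d p := dmult X (mode_of n p).
have rows := hill_mat_row d r0 r1 r2.
have toep_h := toep_herm n0 LA2 herm.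
have toep_c := toep_coercive X0 n0 LA2 coer.
have kappa0 : 0 < pi / X by rewrite divr_gt0 // pi_gt0.
have dec0 p : 0 <= decay R n p by apply: ltW; exact: decay_gt0.
have dec1 p : decay R n p <= 1 by exact: decay_le1.
have decs K : \sum_(p < K) decay R n p ^+ 2 <= n%:R * 8 by exact: decay_sum.
have ddel p : (d p = 0 /\ decay R n p = 1) \/ pi / X <= cabs (d p) * decay R n p by exact: decay_dmult.
have compact (N_ : nat -> nat) : (forall i, (i <= N_ i)%N) -> forall m (V : forall i, 'M[R[i]]_(N_ i, m)) (M : R),
    (forall i, nrm2 (V i) <= M) ->
    (forall i, nrm2 (sec (hill_mat (toep X n0 A0) (toep X n0 A1) (toep X n0 A2) d) (N_ i) *m V i) <= M) -> tight U V.
  move=> hN m V M h1 h2.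
  exact: (hill_compactness r0 r1 r2 toep_h C0 toep_c kappa0 dec0 dec1 decs ddel Uinf hN h1 h2).
have noeig' lam : cabs lam = Rad -> ~ is_eig (hill_mat (toep X n0 A0) (toep X n0 A1) (toep X n0 A2) d) lam.
  by move=> /noeig h /(is_eigL_hat X0 n0 hA0 hA1 hA2).
case: (@section_convergence R _ rows U UF Uinf compact Rad Rad0 noeig') => eps0 e0 H.
exists eps0 => // eps ep eps_lt.
have [N2 HN] := H eps ep eps_lt.
exists N2 => J NJ.
set s := eigseq (LJ X A0 A1 A2 J).
have chs : char_poly (LJ X A0 A1 A2 J) = \prod_(z <- s) ('X - z%:P).
  rewrite /s /eigseq; case: closed_field_poly_normal => /= r e.
  by rewrite {1}e (monicP (char_poly_monic _)) scale1r.
have hN : (N2 <= (2 * J).+1 * n)%N.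
  by apply: (leq_trans NJ); apply: leq_trans (leq_pmulr _ n0); lia.
have chs' := chs; rewrite (_ : char_poly _ = char_poly (sec (hill_mat (toep X n0 A0) (toep X n0 A1)
  (toep X n0 A2) d) ((2 * J).+1 * n))) in chs'; last by exact: char_poly_LJ.
have [loc mult] := HN _ hN s chs'.
split.
- move=> z; rewrite eigenvalue_root_char chs root_prod_XsubC => zs zR.
  have [lam [l1 l2]] := loc z zs zR.
  by exists lam; split=> //; apply/(is_eigL_hat X0 n0 hA0 hA1 hA2).
- move=> lam /(is_eigL_hat X0 n0 hA0 hA1 hA2) el lR.
  have [m [m1 m2 m3]] := mult lam el lR.
  by exists m; split=> //; exact: (alg_multL_hat X0 hA0 hA1 hA2 m1 m2).
Qed.
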